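(* Let $G=\mathrm{Aut}(\mathfrak{so}(8))$, with identity component $G_0\cong\mathrm{SO}(8)/\langle -I\rangle$, and let $F_{10},F_{11},F_{12}\subset G$ be the abelian subgroups defined in the context. With $W(F)=N_G(F)/C_G(F)$, one has $$|W(F_{10})|=3\times 2^6,\qquad |W(F_{11})|=3\times 2^7,\qquad W(F_{12})\cong S_6\times\{\pm1\}.$$
   Context: $\mathfrak{so}(8)$ is the compact real Lie algebra. $\mathrm{O}(8)/\langle -I\rangle$ is regarded as a subgroup of $G$ via conjugation on $\mathfrak{so}(8)$. Put $I_{p,q}=\mathrm{diag}(-I_p,I_q)$. Let $Z=\langle(-1,-1,1,1),(-1,1,-1,1),(-1,1,1,-1)\rangle\subset\mathrm{Sp}(1)^4$, and let $H_4\cong\mathrm{Sp}(1)^4/Z$ be the connected subgroup of $G_0$ corresponding to the sub-root system $4A_1=\{\beta,\alpha_1,\alpha_3,\alpha_4\}$ of $D_4$, where $\alpha_1,\dots,\alpha_4$ are simple roots in Bourbaki numbering and $\beta=\alpha_1+2\alpha_2+\alpha_3+\alpha_4$ (equivalently, up to conjugacy, the image of $\mathrm{SO}(4)\times\mathrm{SO}(4)$ in $\mathrm{SO}(8)/\langle -I\rangle$). Let $\mathrm{U}(1)=\{a+b\mathbf{i}\}\subset\mathrm{Sp}(1)$, with $\mathbf{i},\mathbf{j},\mathbf{k}$ the standard quaternion units. $F_{10}=\bigl((\mathrm{U}(1)\times\mathrm{U}(1))\cdot\langle(\mathbf{i},\mathbf{i}),(\mathbf{j},\mathbf{j})\rangle\bigr)/Z\subset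 H_4$, i.e. the image in $H_4$ of the subgroup generated by $\mathrm{U}(1)\times\mathrm{U}(1)\times1\times1$, $(1,1,\mathbf{i},\mathbf{i})$, $(1,1,\mathbf{j},\mathbf{j})$ and $Z$. $F_{11}=\bigl(\mathrm{U}(1)\cdot\langle(\mathbf{i},\mathbf{i},\mathbf{i}),(\mathbf{j},\mathbf{j},1),(1,\mathbf{j},\mathbf{j})\rangle\bigr)/Z\subset H_4$, i.e. the image in $H_4$ of the subgroup generated by $\mathrm{U}(1)\times1\times1\times1$, $(1,\mathbf{i},\mathbf{i},\mathbf{i})$, $(1,\mathbf{j},\mathbf{j},1)$, $(1,1,\mathbf{j},\mathbf{j})$ and $Z$. $F_{12}=\mathrm{SO}(2)\times\langle I_{2,4},I_{4,2},\mathrm{diag}\{I_{1,1},I_{1,1},I_2\},\mathrm{diag}\{I_2,I_{1,1},I_{1,1}\}\rangle$, understood as its image in the block-diagonal subgroup $H_1\cong(\mathrm{SO}(2)\times\mathrm{O}(6))/\langle(-I,-I)\rangle$ of $\mathrm{O}(8)/\langle -I\rangle$. *)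

(* Defs.v *)
From HB Require Import structures.
From mathcomp Require Import all_boot all_order all_algebra all_fingroup.
From mathcomp Require Import generic_quotient ring.
From mathcomp Require Import all_classical all_reals.

Set Implicit Arguments.
Unset Strict Implicit.
Unset Printing Implicit Defensive.

Import GRing.Theory Num.Theory.
Local Open Scope classical_set_scope.
Local Open Scope ring_scope.
Local Open Scope quotient_scope.

Section Subgroups.
Local Open Scope group_scope.
Variable G : groupType.

Definition is_subgroup (H : set G) : Prop :=
  H 1 /\ forall x y, H x -> H y -> H (x * y^-1).

Definition gen (S : set G) : set G := smallest is_subgroup S.

Definition norm_set (F : set G) : set G := [set g | [set x ^ g | x in F] = F].

Definition cent_set (F : set G) : set G :=
  [set g | forall x, F x -> commute g x].

End Subgroups.

(* weyl F is the quotient group N_G(F) / C_G(F), as the set of left cosets. *)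

Section Weyl.
Local Open Scope group_scope.
Variables (G : groupType) (F : set G).

Definition in_norm : {pred G} := [pred g | `[< norm_set F g >]].

Lemma in_norm_closed : group_closed in_norm.
Proof.
have N1 : norm_set F 1.
  rewrite /norm_set /=; apply/seteqP; split => [_ [x Fx <-]|x Fx] /=.
    by rewrite conjg1.
  by exists x => //; rewrite conjg1.
have NV y : norm_set F y -> norm_set F y^-1.
  rewrite /norm_set /= => Ny; apply/seteqP; split => [_ [x Fx <-]|x Fx] /=.
    by move: Fx; rewrite -{1}Ny => -[z Fz <-]; rewrite conjgK.
  by exists (x ^ y); rewrite ?conjgK // -Ny; exists x.
split; [exact/asboolP|move=> x y].
move=> /asboolP Nx /asboolP Ny; apply/asboolP.
rewrite /norm_set /= -{2}(NV y Ny) -{2}Nx image_comp.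
by apply: eq_imagel => z _ /=; rewrite conjgM.
Qed.

Definition normG := {g : G | in_norm g}.
HB.instance Definition _ := Choice.on normG.
HB.instance Definition _ := SubType.on normG.
HB.instance Definition _ :=
  @SubChoice_isSubGroup.Build G in_norm normG in_norm_closed.

Lemma normGP (g : normG) x : F (x ^ val g) <-> F x.
Proof.
have /asboolP Ng := valP g; split=> Fx; last by rewrite -Ng; exists x.
by move: Fx; rewrite -{1}Ng => -[y Fy /conjg_inj <-].
Qed.

Definition eqC : rel normG := fun g h => `[< cent_set F (val (g^-1 * h)) >].

Lemma eqCP (g h : normG) :
  reflect (forall x, F x -> x ^ val g = x ^ val h) (eqC g h).
Proof.
rewrite /eqC; apply: (iffP (asboolP _)) => [C x Fx|E x Fx].
  have Fxg : F (x ^ val g) by apply/normGP.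
  have /esym := C _ Fxg; rewrite gmulfM gmulfV => E.
  have {E}: (x ^ val g) ^ ((val g)^-1 * val h) = x ^ val g.
    by rewrite conjgE E mulKg.
  by rewrite -conjgM mulgA mulgV mul1g => ->.
have Fxg : F (x ^ val g^-1) by apply/normGP.
have := E _ Fxg; rewrite gmulfV -!conjgM mulVg conjg1 => E'.
by rewrite /commute gmulfM gmulfV {1}E' conjgE mulVKg.
Qed.

Lemma eqC_equiv : equiv_class_of eqC.
Proof.
split=> [g|g h|h g k].
- exact/eqCP.
- by apply/eqCP/eqCP => E x Fx; rewrite E.
- by move=> /eqCP E1 /eqCP E2; apply/eqCP => x Fx; rewrite E1 ?E2.
Qed.

Canonical eqC_equiv_rel := EquivRelPack eqC_equiv.

Definition weyl := {eq_quot eqC}.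
HB.instance Definition _ := Choice.on weyl.
HB.instance Definition _ := EqQuotient.on weyl.

Lemma weylP (g h : normG) :
  (forall x, F x -> x ^ val g = x ^ val h) <-> g = h %[mod weyl].
Proof.
by split=> [?|/eqmodP/eqCP]; first exact/eqmodP/eqCP.
Qed.

Definition weyl_one : weyl := \pi_(weyl) (1 : normG).
Definition weyl_mul (a b : weyl) : weyl := \pi_(weyl) (repr a * repr b).
Definition weyl_inv (a : weyl) : weyl := \pi_(weyl) (repr a)^-1.

Lemma weyl_mulE (g h : normG) :
  weyl_mul (\pi_(weyl) g) (\pi_(weyl) h) = \pi_(weyl) (g * h).
Proof.
rewrite /weyl_mul; case: piP => g' /weylP Eg; case: piP => h' /weylP Eh.
apply/weylP => x Fx; rewrite !gmulfM !conjgM -Eg // -Eh //.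
exact/normGP.
Qed.

Lemma weyl_invE (g : normG) : weyl_inv (\pi_(weyl) g) = \pi_(weyl) g^-1.
Proof.
rewrite /weyl_inv; case: piP => h /weylP E.
apply/weylP => x Fx; have Fy : F (x ^ val g^-1) by apply/normGP.
have := E _ Fy; rewrite !gmulfV conjgKV => {1}->.
by rewrite conjgK.
Qed.

Lemma weyl_mulA : associative weyl_mul.
Proof.
move=> a b c; elim/quotW: a => a; elim/quotW: b => b; elim/quotW: c => c.
rewrite (weyl_mulE b c) (weyl_mulE a (b * c)).
by rewrite (weyl_mulE a b) (weyl_mulE (a * b)) mulgA.
Qed.

Lemma weyl_mul1 : left_id weyl_one weyl_mul.
Proof. by move=> a; elim/quotW: a => a; rewrite weyl_mulE mul1g. Qed.

Lemma weyl_1mul : right_id weyl_one weyl_mul.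
Proof. by move=> a; elim/quotW: a => a; rewrite weyl_mulE mulg1. Qed.

Lemma weyl_mulV : left_inverse weyl_one weyl_inv weyl_mul.
Proof. by move=> a; elim/quotW: a => a; rewrite weyl_invE weyl_mulE mulVg. Qed.

Lemma weyl_Vmul : right_inverse weyl_one weyl_inv weyl_mul.
Proof. by move=> a; elim/quotW: a => a; rewrite weyl_invE weyl_mulE mulgV. Qed.

HB.instance Definition _ :=
  isGroup.Build weyl weyl_mulA weyl_mul1 weyl_1mul weyl_mulV weyl_Vmul.

End Weyl.

Definition isomorphic (A B : groupType) : Prop :=
  exists2 f : A -> B, bijective f & {morph f : x y / (x * y)%g}.

Definition pm1_pred : {pred int} := [pred s | (s == 1) || (s == -1)].

Definition pm1 := {s : int | pm1_pred s}.
HB.instance Definition _ := Choice.on pm1.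
HB.instance Definition _ := SubType.on pm1.

Lemma pm1_mul_subproof (a b : pm1) : pm1_pred (val a * val b).
Proof. by case/orP: (valP a) => /eqP->; case/orP: (valP b) => /eqP->. Qed.

Definition pm1_mul (a b : pm1) : pm1 := Sub (val a * val b) (pm1_mul_subproof a b).
Definition pm1_one : pm1 := Sub 1 isT.

Lemma pm1_mulA : associative pm1_mul.
Proof. by move=> a b c; apply/val_inj; rewrite /= mulrA. Qed.
Lemma pm1_mul1 : left_id pm1_one pm1_mul.
Proof. by move=> a; apply/val_inj; rewrite /= mul1r. Qed.
Lemma pm1_1mul : right_id pm1_one pm1_mul.
Proof. by move=> a; apply/val_inj; rewrite /= mulr1. Qed.
Lemma pm1_mulV : left_inverse pm1_one id pm1_mul.
Proof. by move=> a; apply/val_inj => /=; case/orP: (valP a) => /eqP->. Qed.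
HB.instance Definition _ :=
  isGroup.Build pm1 pm1_mulA pm1_mul1 pm1_1mul pm1_mulV pm1_mulV.

Section LieAut.
Variables (R : pzRingType) (L : lmodType R) (br : L -> L -> L).

Definition is_lie_aut (f : L -> L) : Prop :=
  [/\ linear f, bijective f & {morph f : x y / br x y}].

Definition lie_aut := {f : L -> L | `[< is_lie_aut f >]}.
HB.instance Definition _ := gen_eqMixin lie_aut.
HB.instance Definition _ := gen_choiceMixin lie_aut.

Definition lie_fun (f : lie_aut) : L -> L := proj1_sig f.
Coercion lie_fun : lie_aut >-> Funclass.

Lemma lie_autP (f : lie_aut) : is_lie_aut f.
Proof. exact: (asboolW (proj2_sig f)). Qed.

Lemma lie_aut_ext (f g : lie_aut) : f =1 g -> f = g.
Proof.
case: f g => [f Pf] [g Pg] /= /funext; rewrite /lie_fun /= => E.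
by subst g; rewrite (bool_irrelevance Pf Pg).
Qed.

Definition LieAut (f : L -> L) (Pf : is_lie_aut f) : lie_aut :=
  exist _ f (asboolT Pf).

Lemma lie_id_subproof : is_lie_aut id.
Proof. by split=> //; exists id. Qed.

Lemma lie_comp_subproof (f g : lie_aut) : is_lie_aut (f \o g).
Proof.
have [lf bf mf] := lie_autP f; have [lg bg mg] := lie_autP g.
split=> [a x y||x y] /=; first by rewrite lg lf.
  exact: bij_comp.
by rewrite mg mf.
Qed.

Definition lie_inv_fun (f : lie_aut) (x : L) : L := xget 0 [set y | f y = x].

Lemma lie_invK (f : lie_aut) : cancel (lie_inv_fun f) f.
Proof.
move=> x; have [_ [g _ gK] _] := lie_autP f.
by rewrite /lie_inv_fun; apply: (@xgetPex _ 0 [set y | f y = x]); exists (g x).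
Qed.

Lemma lie_inj (f : lie_aut) : injective f.
Proof. by have [_ /bij_inj] := lie_autP f. Qed.

Lemma lie_Vinv (f : lie_aut) : cancel f (lie_inv_fun f).
Proof. by move=> x; apply: (@lie_inj f); rewrite lie_invK. Qed.

Lemma lie_inv_subproof (f : lie_aut) : is_lie_aut (lie_inv_fun f).
Proof.
have [lf bf mf] := lie_autP f.
have fK := lie_invK f; have Kf := lie_Vinv f.
split=> [a x y||x y]; apply: (@lie_inj f) || exists f => //.
  by rewrite lf !fK.
by rewrite mf !fK.
Qed.

Definition lie_one : lie_aut := LieAut lie_id_subproof.
(* the product of automorphisms is composition: (f * g) x = f (g x) *)
Definition lie_mul (f g : lie_aut) : lie_aut := LieAut (lie_comp_subproof f g).
Definition lie_inv (f : lie_aut) : lie_aut := LieAut (lie_inv_subproof f).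

Lemma lie_mulA : associative lie_mul.
Proof. by move=> f g h; apply: lie_aut_ext. Qed.
Lemma lie_mul1 : left_id lie_one lie_mul.
Proof. by move=> f; apply: lie_aut_ext. Qed.
Lemma lie_1mul : right_id lie_one lie_mul.
Proof. by move=> f; apply: lie_aut_ext. Qed.
Lemma lie_mulV : left_inverse lie_one lie_inv lie_mul.
Proof. by move=> f; apply: lie_aut_ext => x; apply: lie_Vinv. Qed.
Lemma lie_Vmul : right_inverse lie_one lie_inv lie_mul.
Proof. by move=> f; apply: lie_aut_ext => x; apply: lie_invK. Qed.

HB.instance Definition _ :=
  isGroup.Build lie_aut lie_mulA lie_mul1 lie_1mul lie_mulV lie_Vmul.
End LieAut.

Section Orthogonal.
Variables (R : realType) (n : nat).

Definition skew : {pred 'M[R]_n} := [pred X | X^T == - X].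

Lemma skew_submod : submod_closed skew.
Proof.
split=> [|a X Y]; rewrite !inE ?trmx0 ?oppr0 // => /eqP EX /eqP EY.
by rewrite linearD linearZ /= EX EY scalerN opprD.
Qed.
HB.instance Definition _ := GRing.isSubmodClosed.Build R _ skew skew_submod.

Definition so := {X : 'M[R]_n | skew X}.
HB.instance Definition _ := Choice.on so.
HB.instance Definition _ := SubType.on so.
HB.instance Definition _ := [SubChoice_isSubLmodule of so by <:].

Lemma so_bracket_subproof (X Y : so) :
  skew (val X *m val Y - val Y *m val X).
Proof.
have /eqP EX := valP X; have /eqP EY := valP Y.
by rewrite /skew /= linearB /= !trmx_mul EX EY !mulNmx !mulmxN !opprK opprB.
Qed.

Definition so_bracket (X Y : so) : so := Sub _ (so_bracket_subproof X Y).

Definition orth : {pred 'M[R]_n} := [pred A | A *m A^T == 1%:M].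

Definition orthG := {A : 'M[R]_n | orth A}.
HB.instance Definition _ := Choice.on orthG.
HB.instance Definition _ := SubType.on orthG.

Lemma orthG_mulT (A : orthG) : val A *m (val A)^T = 1%:M.
Proof. exact/eqP/(valP A). Qed.
Lemma orthG_Tmul (A : orthG) : (val A)^T *m val A = 1%:M.
Proof. exact/mulmx1C/orthG_mulT. Qed.

Lemma orthG_one_subproof : orth 1%:M.
Proof. by rewrite /orth /= trmx1 mulmx1. Qed.
Lemma orthG_mul_subproof (A B : orthG) : orth (val A *m val B).
Proof.
by rewrite /orth /= trmx_mul mulmxA -(mulmxA (val A)) orthG_mulT mulmx1 orthG_mulT.
Qed.
Lemma orthG_inv_subproof (A : orthG) : orth (val A)^T.
Proof. by rewrite /orth /= trmxK orthG_Tmul. Qed.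

Definition orthG_one : orthG := Sub _ orthG_one_subproof.
Definition orthG_mul (A B : orthG) : orthG := Sub _ (orthG_mul_subproof A B).
Definition orthG_inv (A : orthG) : orthG := Sub _ (orthG_inv_subproof A).

Lemma orthG_mulA : associative orthG_mul.
Proof. by move=> A B C; apply/val_inj; rewrite /= mulmxA. Qed.
Lemma orthG_mul1 : left_id orthG_one orthG_mul.
Proof. by move=> A; apply/val_inj; rewrite /= mul1mx. Qed.
Lemma orthG_1mul : right_id orthG_one orthG_mul.
Proof. by move=> A; apply/val_inj; rewrite /= mulmx1. Qed.
Lemma orthG_mulV : left_inverse orthG_one orthG_inv orthG_mul.
Proof. by move=> A; apply/val_inj; rewrite /= orthG_Tmul. Qed.
Lemma orthG_Vmul : right_inverse orthG_one orthG_inv orthG_mul.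
Proof. by move=> A; apply/val_inj; rewrite /= orthG_mulT. Qed.
HB.instance Definition _ :=
  isGroup.Build orthG orthG_mulA orthG_mul1 orthG_1mul orthG_mulV orthG_Vmul.

Definition SO : set orthG := [set A | \det (val A) = 1].

Lemma conj_skew_subproof (A : orthG) (X : so) :
  skew (val A *m val X *m (val A)^T).
Proof.
have /eqP EX := valP X.
by rewrite /skew /= !trmx_mul trmxK EX mulNmx mulmxN mulmxA.
Qed.

Definition conj_so (A : orthG) (X : so) : so := Sub _ (conj_skew_subproof A X).

Lemma conj_soK (A : orthG) : cancel (conj_so A) (conj_so A^-1%g).
Proof.
move=> X; apply/val_inj => /=.
by rewrite trmxK !mulmxA orthG_Tmul mul1mx -mulmxA orthG_Tmul mulmx1.
Qed.

Lemma conj_so_aut (A : orthG) : is_lie_aut so_bracket (conj_so A).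
Proof.
split=> [a X Y||X Y].
- by apply/val_inj; rewrite /= mulmxDr mulmxDl -scalemxAr -scalemxAl.
- exists (conj_so A^-1%g); first exact: conj_soK.
  by move=> X; rewrite -{1}(invgK A) conj_soK.
- apply/val_inj; rewrite /= mulmxBr mulmxBl !mulmxA.
  by rewrite -!(mulmxA _ _^T (val A)) orthG_Tmul !mulmx1.
Qed.

Definition Ad (A : orthG) : lie_aut so_bracket := LieAut (conj_so_aut A).

Lemma Ad_morphism (A B : orthG) : Ad (A * B)%g = (Ad A * Ad B)%g.
Proof.
apply: lie_aut_ext => X; apply/val_inj => /=.
by rewrite trmx_mul !mulmxA.
Qed.

End Orthogonal.

Section OrthogonalBlocks.
Variable R : realType.

Lemma oblock_subproof m n (A : orthG R m) (B : orthG R n) :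
  orth (block_mx (val A) 0 0 (val B)).
Proof.
rewrite /orth /= tr_block_mx mulmx_block !trmx0 !mulmx0 !mul0mx !addr0 !add0r.
by rewrite !orthG_mulT -scalar_mx_block.
Qed.

Definition oblock m n (A : orthG R m) (B : orthG R n) : orthG R (m + n) :=
  Sub _ (oblock_subproof A B).

Lemma oneg_subproof n : orth (- 1%:M : 'M[R]_n).
Proof. by rewrite /orth /= linearN /= trmx1 mulNmx mulmxN opprK mulmx1. Qed.

Definition oneg n : orthG R n := Sub _ (oneg_subproof n).

Lemma oblock_morphism m n (A A' : orthG R m) (B B' : orthG R n) :
  oblock (A * A')%g (B * B')%g = (oblock A B * oblock A' B')%g.
Proof.
apply/val_inj; rewrite /= mulmx_block !mulmx0 !mul0mx !addr0 !add0r.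
by [].
Qed.

(* I_{p,q} = diag(-I_p, I_q) *)
Definition Ipq p q : orthG R (p + q) := oblock (oneg p) 1%g.
End OrthogonalBlocks.

Section Quaternions.
Variable R : realType.

Record quat := Quat { q_re : R; q_i : R; q_j : R; q_k : R }.
HB.instance Definition _ := gen_eqMixin quat.
HB.instance Definition _ := gen_choiceMixin quat.

Definition qmul (p q : quat) : quat :=
  let: Quat a b c d := p in let: Quat x y z t := q in
  Quat (a * x - b * y - c * z - d * t) (a * y + b * x + c * t - d * z)
       (a * z - b * t + c * x + d * y) (a * t + b * z - c * y + d * x).

Definition qconj (p : quat) : quat :=
  let: Quat a b c d := p in Quat a (- b) (- c) (- d).

Definition qnorm2 (p : quat) : R :=
  let: Quat a b c d := p in a ^+ 2 + b ^+ 2 + c ^+ 2 + d ^+ 2.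

Lemma qmulA : associative qmul.
Proof. by move=> [a b c d] [x y z t] [? ? ? ?] /=; congr Quat; ring. Qed.

Lemma qnorm2M p q : qnorm2 (qmul p q) = qnorm2 p * qnorm2 q.
Proof. by move: p q => [a b c d] [x y z t] /=; ring. Qed.

Lemma qnorm2_conj p : qnorm2 (qconj p) = qnorm2 p.
Proof. by move: p => [a b c d] /=; ring. Qed.

Lemma qconjM p q : qconj (qmul p q) = qmul (qconj q) (qconj p).
Proof. by move: p q => [a b c d] [x y z t] /=; congr Quat; ring. Qed.

Lemma qmulC p : qmul p (qconj p) = Quat (qnorm2 p) 0 0 0.
Proof. by move: p => [a b c d] /=; congr Quat; ring. Qed.

Lemma qmulC' p : qmul (qconj p) p = Quat (qnorm2 p) 0 0 0.
Proof. by move: p => [a b c d] /=; congr Quat; ring. Qed.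

Lemma qmul1 p : qmul (Quat 1 0 0 0) p = p.
Proof. by move: p => [a b c d] /=; congr Quat; ring. Qed.

Lemma q1mul p : qmul p (Quat 1 0 0 0) = p.
Proof. by move: p => [a b c d] /=; congr Quat; ring. Qed.

Definition unit_quat : {pred quat} := [pred q | qnorm2 q == 1].

Definition Sp1 := {q : quat | unit_quat q}.
HB.instance Definition _ := Choice.on Sp1.
HB.instance Definition _ := SubType.on Sp1.

Lemma Sp1_norm (p : Sp1) : qnorm2 (val p) = 1.
Proof. exact/eqP/(valP p). Qed.

Lemma Sp1_mul_subproof (p q : Sp1) : unit_quat (qmul (val p) (val q)).
Proof. by rewrite /unit_quat /= qnorm2M !Sp1_norm mulr1. Qed.
Lemma Sp1_inv_subproof (p : Sp1) : unit_quat (qconj (val p)).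
Proof. by rewrite /unit_quat /= qnorm2_conj Sp1_norm. Qed.
Lemma Sp1_one_subproof : unit_quat (Quat 1 0 0 0).
Proof. by apply/eqP => /=; ring. Qed.
Lemma Sp1_neg_subproof : unit_quat (Quat (-1) 0 0 0).
Proof. by apply/eqP => /=; ring. Qed.
Lemma Sp1_i_subproof : unit_quat (Quat 0 1 0 0).
Proof. by apply/eqP => /=; ring. Qed.
Lemma Sp1_j_subproof : unit_quat (Quat 0 0 1 0).
Proof. by apply/eqP => /=; ring. Qed.

Definition Sp1_mul (p q : Sp1) : Sp1 := Sub _ (Sp1_mul_subproof p q).
Definition Sp1_inv (p : Sp1) : Sp1 := Sub _ (Sp1_inv_subproof p).
Definition Sp1_one : Sp1 := Sub _ Sp1_one_subproof.
Definition Sp1_neg : Sp1 := Sub _ Sp1_neg_subproof.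
Definition Sp1_i : Sp1 := Sub _ Sp1_i_subproof.
Definition Sp1_j : Sp1 := Sub _ Sp1_j_subproof.

Lemma Sp1_mulA : associative Sp1_mul.
Proof. by move=> p q r; apply/val_inj; rewrite /= qmulA. Qed.
Lemma Sp1_mul1 : left_id Sp1_one Sp1_mul.
Proof. by move=> p; apply/val_inj; exact: qmul1. Qed.
Lemma Sp1_1mul : right_id Sp1_one Sp1_mul.
Proof. by move=> p; apply/val_inj; exact: q1mul. Qed.
Lemma Sp1_mulV : left_inverse Sp1_one Sp1_inv Sp1_mul.
Proof. by move=> p; apply/val_inj; rewrite [LHS]qmulC' Sp1_norm. Qed.
Lemma Sp1_Vmul : right_inverse Sp1_one Sp1_inv Sp1_mul.
Proof. by move=> p; apply/val_inj; rewrite [LHS]qmulC Sp1_norm. Qed.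
HB.instance Definition _ :=
  isGroup.Build Sp1 Sp1_mulA Sp1_mul1 Sp1_1mul Sp1_mulV Sp1_Vmul.

Definition U1 : set Sp1 := [set q | q_j (val q) = 0 /\ q_k (val q) = 0].

Definition qvec (q : quat) : 'cV[R]_4 :=
  \col_(i < 4) [:: q_re q; q_i q; q_j q; q_k q]`_i.

Definition qbasis (i : 'I_4) : quat :=
  Quat (i == 0 :> nat)%:R (i == 1%N :> nat)%:R
       (i == 2%N :> nat)%:R (i == 3%N :> nat)%:R.

(* the matrix of x |-> p x q^* in the basis 1, i, j, k *)
Definition lr_mx (p q : quat) : 'M[R]_4 :=
  \matrix_(i, j) qvec (qmul (qmul p (qbasis j)) (qconj q)) i 0.

Lemma lr_mxE p q x :
  lr_mx p q *m qvec x = qvec (qmul (qmul p x) (qconj q)).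
Proof.
apply/colP => i; rewrite mxE !big_ord_recl big_ord0 !mxE.
case: p q x => [a b c d] [a' b' c' d'] [x y z t].
by case: i => [[|[|[|[|]]]]] //= _; ring.
Qed.

Lemma qvec_inj : injective qvec.
Proof.
move=> [a b c d] [x y z t] /colP E.
have := E (inord 0); have := E (inord 1); have := E (inord 2); have := E (inord 3).
by rewrite !mxE !inordK //= => -> -> -> ->.
Qed.

Lemma qvec_basis i : qvec (qbasis i) = delta_mx i 0.
Proof.
apply/colP => j; rewrite !mxE andbT -val_eqE.
by case: i => [[|[|[|[|]]]]] //= _; case: j => [[|[|[|[|]]]]].
Qed.

Lemma lr_mx_orth p q : lr_mx p q *m (lr_mx p q)^T = (qnorm2 p * qnorm2 q)%:M.
Proof.
apply/matrixP => i j; rewrite mxE !big_ord_recl big_ord0 !mxE -val_eqE.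
case: p q => [a b c d] [a' b' c' d'].
case: i => [[|[|[|[|]]]]] //= _; case: j => [[|[|[|[|]]]]] //= _; ring.
Qed.

Lemma lr_mxM p q p' q' :
  lr_mx p q *m lr_mx p' q' = lr_mx (qmul p p') (qmul q q').
Proof.
apply/matrixP => i j.
suff /matrixP/(_ i 0): col j (lr_mx p q *m lr_mx p' q') =
    col j (lr_mx (qmul p p') (qmul q q')) by rewrite !mxE.
by rewrite !colE -qvec_basis -mulmxA !lr_mxE qconjM !qmulA.
Qed.

Lemma lr_subproof (p q : Sp1) : orth (lr_mx (val p) (val q)).
Proof. by rewrite /orth /= lr_mx_orth !Sp1_norm mulr1. Qed.

Definition lr (p q : Sp1) : orthG R 4 := Sub _ (lr_subproof p q).

Lemma lr_morphism (p q p' q' : Sp1) :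
  lr (p * p')%g (q * q')%g = (lr p q * lr p' q')%g.
Proof. by apply/val_inj; rewrite /= lr_mxM. Qed.

End Quaternions.

Section Subgroups_of_AutSo8.
Variable R : realType.

Definition autso8 : groupType := lie_aut (@so_bracket R 8).

Definition Sp1_4 : groupType := (Sp1 R * Sp1 R * Sp1 R * Sp1 R)%type.

(* Ad is the conjugation action of O(8), with kernel <-I>.  The map below is
   the covering Sp(1)^4 -> SO(4) x SO(4) -> SO(8)/<-I> -> Aut(so(8)) with image
   H_4 and kernel Z.  On the coordinates (1, i, j, k) of H,
   left multiplication by exp(ti) rotates the planes (1, i) and (j, k) by the
   angles (t, t), and right multiplication by exp(-ti) by the angles (-t, t);
   so on the first block the left factor is the SL_2 of beta = e1 + e2 and the
   right one that of alpha_1 = e1 - e2, and on the second block the left factor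
   is that of alpha_4 = e3 + e4 and the right one that of alpha_3 = e3 - e4.
   This explains the order of the last two arguments. *)
Definition spin4 (x : Sp1_4) : autso8 :=
  let: (a, b, c, d) := x in Ad (oblock (lr a b) (lr d c) : orthG R 8).

Lemma spin4_morphism (x y : Sp1_4) : spin4 (x * y)%g = (spin4 x * spin4 y)%g.
Proof.
move: x y => [[[a b] c] d] [[[a' b'] c'] d'].
by rewrite /spin4 /= !lr_morphism oblock_morphism (@Ad_morphism R 8).
Qed.

Local Notation e := (1%g : Sp1 R).
Local Notation m := (Sp1_neg R).
Local Notation i := (Sp1_i R).
Local Notation j := (Sp1_j R).

Definition Z : set Sp1_4 := gen [set (m, m, e, e); (m, e, m, e); (m, e, e, m)].

Definition F10 : set autso8 :=
  spin4 @` gen ([set (a, b, e, e) | a in @U1 R & b in @U1 R] `|`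
                [set (e, e, i, i); (e, e, j, j)] `|` Z).

Definition F11 : set autso8 :=
  spin4 @` gen ([set (a, e, e, e) | a in @U1 R] `|`
                [set (e, i, i, i); (e, j, j, e); (e, e, j, j)] `|` Z).

Definition F12_gen : set (orthG R 6) :=
  [set (Ipq R 2 4 : orthG R 6); (Ipq R 4 2 : orthG R 6);
       (oblock (Ipq R 1 1) (oblock (Ipq R 1 1) (1%g : orthG R 2)) : orthG R 6);
       (oblock (1%g : orthG R 2) (oblock (Ipq R 1 1) (Ipq R 1 1)) : orthG R 6)].

Definition F12 : set autso8 :=
  [set Ad (oblock A B : orthG R 8) | A in @SO R 2 & B in gen F12_gen].

End Subgroups_of_AutSo8.

Arguments autso8 R : clear implicits.
Arguments F10 R : clear implicits.
Arguments F11 R : clear implicits.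
Arguments F12 R : clear implicits.

(* Main.v *)
From HB Require Import structures.
From mathcomp Require Import all_boot all_order all_algebra all_fingroup.
From mathcomp Require Import generic_quotient ring complex.
From mathcomp Require Import all_classical all_reals.
Require Import Defs.

(** The group G acts on the complexification of so(8), so each of the three
    abelian subgroups F gives a decomposition into joint eigenspaces; the
    functions lam on F with x W = lam(x) W for a nonzero W are the weights.
    An element g of N_G(F) permutes the weights, and when the weights separate
    the points of F the group W(F) is faithfully represented by these
    permutations.

    For all three groups a single orbit of weights carries the whole
    information.  A weight is called core here if its square is not trivial and
    if some other weight has the same square; this condition is visibly
    preserved by N_G(F).  In each case the core weights have multiplicity one
    and are in bijection with an explicit finite set of labels, their
    eigenvectors generate so(8), and F is the group of all automorphisms which
    act on those eigenvectors by a system of scalars in an explicit set K.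
    Any g in N_G(F) then permutes the labels, and preserves K and the pairs of
    labels whose product is again a weight.  These constraints cut the
    permutations of labels down to an explicit finite set T, and conversely
    each element of T is induced by some explicit element of G, which
    normalizes F because it preserves the description of F by K.  Hence W(F) is
    in bijection with T ([weyl_actions], [card_weyl]).

    F_10 and F_12 are groups of matrices that are diagonal in a basis made of
    the isotropic vectors e + i e', e - i e' of some planes and of some
    coordinate vectors, with characters z_a, z_a^-1 on the planes and signs
    with product one on the coordinate vectors.  The core weights are
    z_a^(+-1) eps_b, so T consists of the permutations of the planes, of the
    inversions of the z_a, and of the permutations of the signs.  For F_10
    there are two planes and four signs, and 2! 2^2 4! = 3 * 2^6; for F_12
    there are one plane and six signs, and one gets S_6 x {+-1}.

    For F_11 the off-diagonal part of so(8) with respect to 8 = 4 + 4 is the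
    tensor product of two copies of the quaternions.  Its core weights are
    z^(+-1) (-1)^(b1 x + b2 y + b3 w), labelled by a sign and three bits x, y,
    w, so there are 16 of them.  The weights which occur on the diagonal blocks
    are z^(+-2) (-1)^b1 and weights of order two.  In particular a product of
    two core weights is z^(+-2) (-1)^b1 exactly when their labels differ in x
    only, so that the pair (y, w) and the bit x play different roles: W(F_11)
    acts on the four pairs (y, w) by all of S_4, flips the sign, and changes x
    by an affine function of (y, w).  This gives 2 * 24 * 8 = 3 * 2^7.  Most of these
    permutations come from O(8); the remaining generator is the outer
    automorphism exchanging the second and third of the four commuting
    copies of sp(1), which is constructed explicitly ([sigma_bracket]). *)

Set Implicit Arguments.
Unset Strict Implicit.
Unset Printing Implicit Defensive.

Import GRing.Theory Num.Theory.
Local Open Scope classical_set_scope.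
Local Open Scope card_scope.
Local Open Scope ring_scope.
Local Open Scope quotient_scope.

(** * The action on the complexified Lie algebra *)

Section Complexification.
Variable R : realType.
Local Notation C := R[i].
Local Notation G := (lie_aut (@so_bracket R 8)).
Local Notation I := ('i%C : C).
Local Notation cplx X := (map_mx (real_complex R) X).

Lemma skew_part_subproof (X : 'M[R]_8) : skew (2^-1 *: (X - X^T)).
Proof. by rewrite /skew /= linearZ linearB /= trmxK -scalerN opprB. Qed.

Definition skew_part (X : 'M[R]_8) : so R 8 := Sub _ (skew_part_subproof X).

Lemma skew_part_val (X : so R 8) : skew_part (val X) = X.
Proof.
have /eqP EX := valP X; apply/val_inj; rewrite /= EX opprK -mulr2n.
by rewrite -scaler_nat scalerA mulVf ?pnatr_eq0 // scale1r.
Qed.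

Lemma skew_part_is_linear : linear skew_part.
Proof.
move=> a X Y; apply/val_inj/matrixP => i j; rewrite /= !mxE; ring.
Qed.
HB.instance Definition _ := GRing.isLinear.Build R 'M[R]_8 (so R 8) _ skew_part
  skew_part_is_linear.

Lemma cplx_ReIm m n (W : 'M[C]_(m, n)) :
  W = cplx (map_mx (@complex.Re R) W) + I *: cplx (map_mx (@complex.Im R) W).
Proof. by apply/matrixP => i j; rewrite !mxE [LHS]complexE. Qed.

(** Elements of G act real-linearly on skew real matrices only.  Composing
    with the projection onto skew matrices and acting on real and imaginary
    parts gives a total complex-linear map on all complex matrices, which is
    the complexified action on the skew ones. *)
Definition xact (x : G) (W : 'M[C]_8) : 'M[C]_8 :=
  cplx (val (x (skew_part (map_mx (@complex.Re R) W)))) +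
  I *: cplx (val (x (skew_part (map_mx (@complex.Im R) W)))).

Lemma lie_linear (x : G) : linear x.
Proof. by have [] := lie_autP x. Qed.
HB.instance Definition _ (x : G) := GRing.isLinear.Build R (so R 8) (so R 8) _
  (lie_fun x) (lie_linear x).

Lemma xactE (x : G) (X Y : so R 8) :
  xact x (cplx (val X) + I *: cplx (val Y)) =
  cplx (val (x X)) + I *: cplx (val (x Y)).
Proof.
rewrite /xact.
have -> : map_mx (@complex.Re R) (cplx (val X) + I *: cplx (val Y)) = val X.
  by apply/matrixP => i j; rewrite !mxE /=; ring.
have -> : map_mx (@complex.Im R) (cplx (val X) + I *: cplx (val Y)) = val Y.
  by apply/matrixP => i j; rewrite !mxE /=; ring.
by rewrite !skew_part_val.
Qed.

Lemma xact_is_linear (x : G) : linear (xact x).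
Proof.
move=> [a b] V W; rewrite /xact.
have -> : map_mx (@complex.Re R) ((a +i* b)%C *: V + W) =
  a *: map_mx (@complex.Re R) V +
  ((- b) *: map_mx (@complex.Im R) V + map_mx (@complex.Re R) W).
  apply/matrixP => i j; rewrite !mxE.
  by case: (V i j) (W i j) => [v v'] [w w'] /=; ring.
have -> : map_mx (@complex.Im R) ((a +i* b)%C *: V + W) =
  a *: map_mx (@complex.Im R) V +
  (b *: map_mx (@complex.Re R) V + map_mx (@complex.Im R) W).
  apply/matrixP => i j; rewrite !mxE.
  by case: (V i j) (W i j) => [v v'] [w w'] /=; ring.
rewrite !linearP.
set V1 := x _; set V2 := x (skew_part (map_mx (@complex.Im R) V)).
set W1 := x _; set W2 := x _.
apply/matrixP => i j; rewrite !mxE /=.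
by apply/eqP; rewrite eq_complex /=; apply/andP; split; apply/eqP; ring.
Qed.

HB.instance Definition _ (x : G) := GRing.isLinear.Build C 'M[C]_8 'M[C]_8 _
  (xact x) (xact_is_linear x).

Lemma xactZ (x : G) c W : xact x (c *: W) = c *: xact x W.
Proof. exact: linearZ. Qed.

Lemma xactD (x : G) V W : xact x (V + W) = xact x V + xact x W.
Proof. exact: linearD. Qed.

Lemma xact_comb (x : G) a b V W : xact x (a *: V + b *: W) = a *: xact x V + b *: xact x W.
Proof. by rewrite xactD !xactZ. Qed.

Lemma xact_so (x : G) (X : so R 8) : xact x (cplx (val X)) = cplx (val (x X)).
Proof.
have /matrixP x0 : val (x 0) = 0.
  by rewrite linear0.
have E (Y : 'M[R]_8) : cplx Y = cplx Y + I *: cplx (val (0 : so R 8)).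
  by apply/matrixP => i j; rewrite !mxE /= !mulr0 addr0.
rewrite E xactE; apply/matrixP => i j; rewrite !mxE x0.
by rewrite mxE mulr0 addr0.
Qed.

Lemma skew_cplx (X : so R 8) : (cplx (val X))^T = - cplx (val X).
Proof. by have /eqP EX := valP X; rewrite map_trmx EX; apply/matrixP => i j; rewrite !mxE rmorphN. Qed.

Lemma skew_ReIm (W : 'M[C]_8) : W^T = - W ->
  exists X Y : so R 8, W = cplx (val X) + I *: cplx (val Y).
Proof.
move=> EW.
have sRe : skew (map_mx (@complex.Re R) W).
  apply/eqP/matrixP => i j; rewrite !mxE.
  by move/matrixP: EW => /(_ i j); rewrite !mxE => ->; case: (W i j).
have sIm : skew (map_mx (@complex.Im R) W).
  apply/eqP/matrixP => i j; rewrite !mxE.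
  by move/matrixP: EW => /(_ i j); rewrite !mxE => ->; case: (W i j).
by exists (Sub _ sRe), (Sub _ sIm); exact: cplx_ReIm.
Qed.

Lemma xact_skew (x : G) W : (xact x W)^T = - xact x W.
Proof. by rewrite /xact linearD linearZ /= !skew_cplx scalerN opprD. Qed.

Lemma xactM (x y : G) W : xact (x * y)%g W = xact x (xact y W).
Proof. by rewrite {3}/xact xactE. Qed.

Lemma xact1 W : W^T = - W -> xact (1%g : G) W = W.
Proof. by move=> /skew_ReIm [X [Y ->]]; rewrite xactE. Qed.

Lemma xactK (x : G) W : W^T = - W -> xact x^-1%g (xact x W) = W.
Proof. by move=> sW; rewrite -xactM mulVg xact1. Qed.

Lemma xact_eq0 (x : G) W : W^T = - W -> xact x W = 0 -> W = 0.
Proof. by move=> sW E; rewrite -(xactK x sW) E linear0. Qed.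

Lemma xactAd (M : orthG R 8) W : W^T = - W ->
  xact (Ad M) W = cplx (val M) *m W *m (cplx (val M))^T.
Proof.
move=> /skew_ReIm [X [Y ->]]; rewrite xactE /= !map_mxM /=.
by rewrite mulmxDr mulmxDl -scalemxAr -scalemxAl map_trmx.
Qed.

(** The trace form is the invariant form of so(8), up to a scalar. *)
Lemma xactAd_tr (M : orthG R 8) V W : V^T = - V -> W^T = - W ->
  \tr (xact (Ad M) V *m (xact (Ad M) W)^T) = \tr (V *m W^T).
Proof.
move=> sV sW; rewrite !xactAd //.
set N := cplx _; have NN : N^T *m N = 1%:M.
  by rewrite map_trmx -map_mxM orthG_Tmul map_mx1.
rewrite !trmx_mul trmxK !mulmxA -[_ *m N^T *m N]mulmxA NN mulmx1.
rewrite -!mulmxA mxtrace_mulC !mulmxA.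
by rewrite -[_ *m N^T *m N]mulmxA NN mulmx1.
Qed.

Definition rot_mx (i j : 'I_8) : 'M[R]_8 := delta_mx i j - delta_mx j i.

Lemma rot_subproof i j : skew (rot_mx i j).
Proof. by apply/eqP; rewrite /rot_mx linearB /= !trmx_delta opprB. Qed.

Definition rot i j : so R 8 := Sub _ (rot_subproof i j).

Lemma rotN i j : rot j i = - rot i j.
Proof. by apply/val_inj; rewrite /= /rot_mx opprB. Qed.

Lemma rot_bracket i j k : i != j -> i != k -> k != j -> 
  so_bracket (rot i k) (rot k j) = rot i j.
Proof.
move=> ij ik kj; apply/val_inj; rewrite /= /rot_mx.
rewrite !mulmxBl !mulmxBr !mul_delta_mx_cond.
rewrite !eqxx (eq_sym j k) (eq_sym k i) (eq_sym j i) (negPf ij) (negPf ik) (negPf kj) /=.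
by rewrite ?mulr0n ?mulr1n !(subr0, sub0r, oppr0, add0r, opprK, addr0).
Qed.

Lemma so_rot_sum (X : so R 8) : X = 2^-1 *: \sum_i \sum_j val X i j *: rot i j.
Proof.
apply/val_inj/matrixP => a b /=.
have vsum (f : 'I_8 -> so R 8) : val (\sum_i f i) = \sum_i val (f i).
  by elim/big_rec2: _ => // i x y _ <-.
rewrite vsum mxE summxE.
under eq_bigr => i _ do rewrite vsum summxE.
under eq_bigr => i _ do under eq_bigr => j _ do rewrite !mxE.
have E1 : \sum_i \sum_j sval X i j * (((a == i) && (b == j))%:R : R) = val X a b.
  rewrite (bigD1 a) //= [X in _ + X]big1 ?addr0; last first.
    by move=> i /negPf ia; apply: big1 => j _; rewrite eq_sym ia mulr0.
  rewrite (bigD1 b) //= [X in _ + X]big1 ?addr0 ?eqxx ?mulr1 //.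
  by move=> j /negPf jb; rewrite ?eqxx [b == j]eq_sym jb mulr0.
have E2 : \sum_i \sum_j sval X i j * (((a == j) && (b == i))%:R : R) = val X b a.
  rewrite (bigD1 b) //= [X in _ + X]big1 ?addr0; last first.
    by move=> i /negPf ia; apply: big1 => j _; rewrite [b == i]eq_sym ia andbF mulr0.
  rewrite (bigD1 a) //= [X in _ + X]big1 ?addr0 ?eqxx ?mulr1 //.
  by move=> j /negPf jb; rewrite [a == j]eq_sym jb mulr0.
transitivity (2^-1 * (val X a b - val X b a)); last first.
  rewrite -E1 -E2 -sumrB; congr (_ * _); apply: eq_bigr => i _.
  by rewrite -sumrB; apply: eq_bigr => j _; rewrite mulrBr.
have /eqP/matrixP/(_ a b) := valP X; rewrite !mxE => ->.
by rewrite opprK; field.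
Qed.

(** If k lies outside the class of i and j, then the rotation in the plane (i,
    j) is the bracket of those in the planes (i, k) and (k, j); so the
    rotations mixing the two classes of indices generate so(8). *)
Lemma lie_aut_rot1 (P : pred 'I_8) (x : G) :
  (exists i, P i) -> (exists j, ~~ P j) ->
  (forall i j, P i -> ~~ P j -> x (rot i j) = rot i j) -> x = 1%g.
Proof.
move=> [p Pp] [q Pq] fx; have [_ _ brx] := lie_autP x.
have fx' i j : P i != P j -> x (rot i j) = rot i j.
  case Pi: (P i); case Pj: (P j) => // _; first by apply: fx; rewrite ?Pi ?Pj.
  by rewrite rotN linearN /= fx ?Pi ?Pj.
have {}fx i j : x (rot i j) = rot i j.
  have [PP|] := eqVneq (P i) (P j); last exact: fx'.
  have [->|ij] := eqVneq i j.
    suff -> : rot j j = 0 by rewrite linear0.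
    by apply/val_inj; rewrite /= /rot_mx subrr.
  have [k Pk] : exists k, P k != P j.
    by case: (P j); [exists q; case: (P q) Pq|exists p; rewrite Pp].
  have ik : i != k by apply: contraNneq Pk => <-; rewrite PP.
  have kj : k != j by apply: contraNneq Pk => <-.
  by rewrite -(rot_bracket ij ik kj) brx !fx' ?PP // eq_sym.
apply: lie_aut_ext => X /=; rewrite [in LHS](so_rot_sum X) [RHS](so_rot_sum X).
rewrite linearZ linear_sum; congr (_ *: _); apply: eq_bigr => i _.
by rewrite linear_sum; apply: eq_bigr => j _; rewrite linearZ /= fx.
Qed.

End Complexification.

(** * Weights and core weights *)

Section Weights.
Variables (R : realType) (F : set (lie_aut (@so_bracket R 8))).
Local Notation C := R[i].
Local Notation G := (lie_aut (@so_bracket R 8)).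

Definition weight (lam : G -> C) : Prop :=
  exists W : 'M[C]_8,
    [/\ W^T = - W, W != 0 & forall x, F x -> xact x W = lam x *: W].

(** Weights of order at most two are excluded by the first condition, and the
    other unwanted ones, which are determined by their squares, by the second. *)
Definition core (lam : G -> C) : Prop :=
  [/\ weight lam,
      exists2 x, F x & lam x ^+ 2 != 1
    & exists mu, [/\ weight mu, exists2 x, F x & mu x != lam x
                   & forall x, F x -> mu x ^+ 2 = lam x ^+ 2]].

Variable g : G.
Hypothesis Ng : norm_set F g.

Lemma normJ x : F x -> F (x ^ g)%g.
Proof. by move=> Fx; rewrite -Ng; exists x. Qed.

Lemma normVJ x : F x -> exists2 y, F y & x = (y ^ g)%g.
Proof. by rewrite -{1}Ng => -[y Fy <-]; exists y. Qed.

Lemma weight_conj lam : weight lam -> weight (fun x => lam (x ^ g)%g).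
Proof.
move=> [W [sW W0 EW]]; exists (xact g W); split.
- exact: xact_skew.
- by apply: contra_neq W0; exact: xact_eq0.
- by move=> x Fx; rewrite -xactM conjgC xactM EW ?linearZ //; exact: normJ.
Qed.

Lemma core_conj lam : core lam -> core (fun x => lam (x ^ g)%g).
Proof.
move=> [wl [x /normVJ [y Fy ->] ly] [mu [wm [z /normVJ [t Ft ->] mt] E]]].
split; [exact: weight_conj|by exists y|].
exists (fun x => mu (x ^ g)%g); split; [exact: weight_conj|by exists t|].
by move=> u Fu; apply: E; exact: normJ.
Qed.

End Weights.

Lemma weight_eq (R : realType) (F : set (lie_aut (@so_bracket R 8))) lam mu :
  (forall x, F x -> lam x = mu x) -> weight F lam -> weight F mu.
Proof.
by move=> E [W [sW W0 EW]]; exists W; split=> // x Fx; rewrite EW // E.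
Qed.

(** Eigenvectors with respect to an invariant form can only be paired
    nontrivially if their eigenvalues are inverse to each other. *)
Lemma weight_dual (R : realType) (M : orthG R 8) (V W : 'M[R[i]]_8) a b :
  V^T = - V -> W^T = - W ->
  xact (Ad M) V = a *: V -> xact (Ad M) W = b *: W ->
  \tr (V *m W^T) != 0 -> a * b = 1.
Proof.
move=> sV sW EV EW; have := xactAd_tr M sV sW.
rewrite EV EW linearZ /= -scalemxAl -scalemxAr scalerA linearZ /=.
by move=> E t0; apply: (mulIf t0); rewrite mul1r.
Qed.

Lemma xactJ (R : realType) (x g : lie_aut (@so_bracket R 8)) W :
  xact (x ^ g)%g W = xact g^-1%g (xact x (xact g W)).
Proof. by rewrite -!xactM. Qed.

(** * The Weyl group as a group of permutations of labels *)

Section WeylAction.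
Variables (R : realType) (F : set (autso8 R)) (L : finType).
Local Notation C := R[i].
Local Notation G := (lie_aut (@so_bracket R 8)).
Variable U : L -> 'M[C]_8.

Definition eigen (x : G) (k : L -> C) : Prop :=
  forall l, xact x (U l) = k l *: U l.

(** The eigenvalue of x on U l is made a total function by choice, since
    weights are functions on all of G. *)
Definition ev (x : G) (l : L) : C := xget 0 [set c | xact x (U l) = c *: U l].

Variables (K : set (L -> C)) (T : finType) (act : T -> L -> L).

Hypothesis skewU : forall l, (U l)^T = - U l.
Hypothesis neq0U : forall l, U l != 0.
Hypothesis genU : forall x : G, (forall l, xact x (U l) = U l) -> x = 1%g.
Hypothesis FP : forall x : G, F x <-> exists2 k, K k & eigen x k.
Hypothesis realK : forall k, K k -> exists x, eigen x k.
Hypothesis act_inj : forall t, injective (act t).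
Hypothesis actK : forall t k, K (k \o act t) <-> K k.
Hypothesis act_faithful : forall t u,
  (forall k, K k -> k \o act t =1 k \o act u) -> t = u.
Hypothesis act_onto : forall t,
  exists g : G, forall l, exists c, xact g (U l) = c *: U (act t l).
Hypothesis coreP : forall lam : G -> C,
  core F lam <-> exists l, forall x, F x -> lam x = ev x l.
Hypothesis labelP : forall phi : L -> L,
  (forall k, K k -> K (k \o phi)) ->
  (forall k, K k -> exists2 k', K k' & k = k' \o phi) ->
  (forall l m, weight F (fun x => ev x l * ev x m) ->
               weight F (fun x => ev x (phi l) * ev x (phi m))) ->
  exists t, phi =1 act t.

Lemma eigen_unique x k k' : eigen x k -> eigen x k' -> k = k'.
Proof.
move=> E E'; apply/funext => l; have := E l; rewrite E' => /eqP.
by rewrite -subr_eq0 -scalerBl scaler_eq0 (negPf (neq0U l)) orbF subr_eq0 => /eqP.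
Qed.

Lemma evP x k : eigen x k -> ev x = k.
Proof.
move=> E; apply: (eigen_unique (x := x)) => // l.
by apply: (@xgetPex _ 0 [set c | xact x (U l) = c *: U l]); exists (k l).
Qed.

(** The vectors U generate the Lie algebra, so their eigenvalues determine x. *)
Lemma eigen_inj x y k : eigen x k -> eigen y k -> x = y.
Proof.
move=> Ex Ey; suff: (y^-1 * x)%g = 1%g :> G by move/(canRL (mulKVg y)); rewrite mulg1.
by apply: genU => l; rewrite xactM Ex -Ey xactK.
Qed.

Lemma eigenP x k : K k -> eigen x k -> F x.
Proof. by move=> Kk E; apply/FP; exists k. Qed.

(** An element g of N_G(F) maps core weights to core weights, hence permutes
    the labels; the hypothesis [labelP] shows that the permutation is one of
    T. *)
Lemma norm_act (g : G) : norm_set F g -> exists t,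
  forall x k, F x -> eigen x k -> eigen (x ^ g)%g (k \o act t).
Proof.
move=> Ng; have /choice[phi phiP] l : exists m, forall x, F x ->
    ev (x ^ g)%g l = ev x m.
  by apply/(coreP (fun x => ev (x ^ g)%g l))/(core_conj Ng (lam := fun x => ev x l))/coreP; exists l.
have phiE x k : F x -> eigen x k -> eigen (x ^ g)%g (k \o phi).
  move=> Fx Ex; have /FP[k' _ Exg] : F (x ^ g)%g by exact: normJ.
  suff -> : k \o phi = k' by [].
  by apply/funext => l; rewrite /= -(evP Exg) -(evP Ex) phiP.
have [k Kk|k Kk|l m lm|t phit] := labelP (phi := phi); last first.
- exists t => x k Fx Ex l /=; rewrite -phit.
  exact: phiE.
- apply: weight_eq (weight_conj Ng lm) => x Fx.
  by rewrite !phiP.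
- have [x Ex] := realK Kk; have [y Fy xE] := normVJ Ng (eigenP Kk Ex).
  have /FP[k' Kk' Ey] := Fy; exists k' => //.
  by apply: (eigen_unique (x := x)) => //; rewrite xE; exact: phiE.
have [x Ex] := realK Kk; have Fx := eigenP Kk Ex.
have /FP[k' Kk' Exg] : F (x ^ g)%g by exact: normJ.
by rewrite (eigen_unique (phiE _ _ Fx Ex) Exg).
Qed.

Definition acts (g : G) (t : T) : Prop :=
  forall x k, F x -> eigen x k -> eigen (x ^ g)%g (k \o act t).

(** The systems of eigenvalues in K separate the elements of T. *)
Lemma acts_unique g t u : acts g t -> acts g u -> t = u.
Proof.
move=> gt gu; apply: act_faithful => k Kk; have [x Ex] := realK Kk.
have Fx := eigenP Kk Ex.
by move=> l; rewrite (eigen_unique (gt x k Fx Ex) (gu x k Fx Ex)).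
Qed.

(** An automorphism that permutes the lines of the vectors U according to t
    normalizes F, because F is defined by those lines and by K, and K is
    stable under t. *)
Lemma acts_exists t : exists2 g : G, norm_set F g & acts g t.
Proof.
have [g /choice[c gP]] := act_onto t; exists g.
all: have c0 l : c l != 0
  by apply: contra_neq (neq0U l) => cl0; apply: (xact_eq0 (x := g)) => //;
     rewrite gP cl0 scale0r.
all: have gt x k : eigen x k -> eigen (x ^ g)%g (k \o act t)
  by move=> Ex l; rewrite xactJ gP xactZ Ex scalerA mulrC -scalerA;
     rewrite -gP xactZ xactK.
  have t_bij := injF_bij (@act_inj t).
  rewrite /norm_set /=; apply/seteqP; split=> [_ [x /FP[k Kk Ex] <-]|x /FP[k Kk Ex]].
    by apply: (@eigenP _ (k \o act t)); [apply/actK|exact: gt].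
  exists (x ^ g^-1)%g; last by rewrite -conjgM mulVg conjg1.
  have [t' tK Kt] := t_bij.
  apply: (@eigenP _ (k \o t')).
    by apply/(actK t); rewrite (_ : _ \o _ = k) //; apply/funext => l /=; rewrite tK.
  move=> l /=; have Ul : U l = (c (t' l))^-1 *: xact g (U (t' l)).
    by rewrite gP Kt scalerA mulVf ?scale1r.
  rewrite xactJ invgK {1}Ul !xactZ xactK // Ex xactZ.
  by rewrite scalerA mulrC -scalerA -Ul.
by move=> x k _; exact: gt.
Qed.

(** Two elements of N_G(F) act on the labels in the same way exactly when they
    are equal modulo C_G(F), since the elements of F are determined by their
    eigenvalues.  The compatibility with products is stated on K because T
    carries no group law. *)
Lemma weyl_actions : exists f : weyl F -> T, bijective f /\
  forall v w k, K k -> k \o act (f (v * w)%g) =1 k \o act (f v) \o act (f w).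
Proof.
have /choice[f fP] (w : weyl F) : exists t, acts (val (repr w)) t.
  by have /asboolP/norm_act := valP (repr w).
have pi_acts (g : normG F) : acts (val g) (f (\pi_(weyl F) g)).
  have : repr (\pi_(weyl F) g) = g %[mod weyl F] by rewrite reprK.
  move/weylP => E x k Fx Ex.
  by rewrite -E //; exact: fP.
have f_inj : injective f.
  move=> v w Evw; rewrite -(reprK v) -(reprK w); apply/weylP => x Fx.
  have /FP[k Kk Ex] := Fx.
  apply: (@eigen_inj _ _ (k \o act (f v))); first exact: fP.
  by rewrite Evw; exact: fP.
exists f; split=> [|v w k Kk].
  have /choice[f' f'P] t : exists w, f w = t.
    have [g Ng gt] := acts_exists t.
    have Pg : in_norm F g by apply/asboolP.
    exists (\pi_(weyl F) (exist _ g Pg : normG F)).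
    by apply: (acts_unique (g := g)) => //; exact: (pi_acts (exist _ g Pg)).
  by exists f' => w; [apply: f_inj|]; rewrite f'P.
have [x Ex] := realK Kk; have Fx := eigenP Kk Ex.
have Fv : F (x ^ val (repr v))%g by apply: normJ => //; have /asboolP := valP (repr v).
have := fP w _ _ Fv (fP v _ _ Fx Ex); rewrite -conjgM => E l.
have Evw := pi_acts (repr v * repr w)%g x k Fx Ex.
exact: (congr1 (fun k => k l) (eigen_unique Evw E)).
Qed.

Lemma card_weyl : [set: weyl F] #= `I_#|T|.
Proof.
have [f [f_bij _]] := weyl_actions.
rewrite (card_eqr card_II); apply: (@card_eq_trans _ _ _ _ [set: T]).
  by apply/pcard_eq; have /PbijTT[h _] := f_bij; exact: h.
by apply/pcard_eq; have /PbijTT[h _] := @enum_rank_bij T; exact: h.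
Qed.

End WeylAction.

(** * Groups of diagonalizable matrices *)

Section Diagonal.
Variables (R : realType) (A B : finType) (iota : A * bool + B -> 'I_8).
Hypothesis iota_bij : bijective iota.
Local Notation C := R[i].
Local Notation G := (lie_aut (@so_bracket R 8)).
Local Notation I := ('i%C : C).
Local Notation P := (A * bool + B)%type.
Local Notation cplx X := (map_mx (real_complex R) X).

Lemma mulII : I * I = -1. Proof. by rewrite -expr2 sqr_i. Qed.

(** The complex numbers of modulus one. *)
Definition unitc (z : C) : Prop := complex.Re z ^+ 2 + complex.Im z ^+ 2 = 1.

Definition bvec (p : P) : 'cV[C]_8 := delta_mx (iota p) 0.

(** The isotropic vectors of the planes indexed by A, and the coordinate
    vectors indexed by B; these are the common eigenvectors of F. *)
Definition vec (p : P) : 'cV[C]_8 :=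
  match p with
  | inl (a, s) => bvec (inl (a, false)) + ((-1) ^+ (~~ s) * I) *: bvec (inl (a, true))
  | inr b => bvec (inr b)
  end.

Lemma unitc1 : unitc 1.
Proof. by rewrite /unitc /=; ring. Qed.

Lemma unitcV z : unitc z -> unitc z^-1.
Proof.
case: z => [a b]; rewrite /unitc /= => u.
by rewrite u !divr1 sqrrN.
Qed.

Definition bar (p : P) : P :=
  match p with inl (a, s) => inl (a, ~~ s) | inr b => inr b end.

(** A character of F evaluated at the eigenvectors: inverse values on the two
    isotropic lines of a plane, a sign on a coordinate vector. *)
Definition char (z : A -> C) (eps : B -> bool) (p : P) : C :=
  match p with
  | inl (a, s) => if s then (z a)^-1 else z a
  | inr b => (-1) ^+ eps b
  end.

(** The condition on the signs expresses that the determinant is one. *)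
Definition dgood (d : P -> C) : Prop := exists z eps,
  [/\ forall a, unitc (z a), \big[addb/false]_b eps b = false & d = char z eps].

Let iota_inj : injective iota := bij_inj iota_bij.

Lemma barK : involutive bar. Proof. by case=> [[a []]|b]. Qed.

Lemma char_bar d p : dgood d -> d (bar p) = (d p)^-1.
Proof.
move=> [z [eps [_ _ ->]]]; case: p => [[a []]|b] //=; first by rewrite invrK.
by rewrite invr_sign.
Qed.

Lemma unitc_neq0 z : unitc z -> z != 0.
Proof.
apply: contra_eqN => /eqP -> /=.
by rewrite expr0n addr0 eq_sym oner_eq0.
Qed.

Lemma dgood_neq0 d p : dgood d -> d p != 0.
Proof.
move=> [z [eps [uz _ ->]]]; case: p => [[a []]|b] /=; last by rewrite signr_eq0.
  by rewrite invr_eq0 unitc_neq0.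
exact: unitc_neq0.
Qed.

Lemma dgood_inr d b : dgood d -> d (inr b) * d (inr b) = 1.
Proof. by move=> [z [eps [_ _ ->]]] /=; rewrite -expr2 sqrr_sign. Qed.

Lemma bvecM p q : (bvec p)^T *m bvec q = (p == q)%:R%:M.
Proof.
rewrite /bvec trmx_delta mul_delta_mx_cond (inj_eq iota_inj).
by apply/matrixP => i j; rewrite !ord1 !mxE; case: (p == q); rewrite !mxE ?eqxx.
Qed.

Lemma vecM p q : (vec p)^T *m vec q =
  ((q == bar p)%:R * (if p is inl _ then 2 else 1))%:M.
Proof.
have E m n : (bvec m)^T *m bvec n = ((m == n)%:R : C)%:M := bvecM m n.
have D (u w x : 'cV[C]_8) (k : C) : (u + k *: w)^T *m x = u^T *m x + k *: (w^T *m x).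
  by rewrite linearD linearZ /= mulmxDl scalemxAl.
have D' (u w x : 'cV[C]_8) (k : C) : x^T *m (u + k *: w) = x^T *m u + k *: (x^T *m w).
  by rewrite mulmxDr scalemxAr.
have El (x y : A * bool) : (inl x == inl y :> P) = (x == y) by [].
have Er (x y : B) : (inr x == inr y :> P) = (x == y) by [].
have := mulII.
case: p q => [[a s]|b] [[c t]|e]; rewrite /vec ?D ?D' !E ?Er ?El ?xpair_eqE /=;
  set i' := 'i%C => ii; apply/matrixP => i j; rewrite !ord1 !mxE ?eqxx ?mulr1n /=.
- rewrite ?El ?xpair_eqE [c == a]eq_sym; case: (a == c); case: s; case: t => //=;
    rewrite /= ?expr1 ?expr0; ring: ii.
- ring.
- ring.
- by rewrite [e == b]eq_sym mulr1.
Qed.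

Definition wedge (p q : P) : 'M[C]_8 := vec p *m (vec q)^T - vec q *m (vec p)^T.

Lemma wedge_linear (u w r : 'cV[C]_8) (k m n : C) :
  let x := k *: (m *: u + n *: w) in
  x *m r^T - r *m x^T =
  (k * m) *: (u *m r^T - r *m u^T) + (k * n) *: (w *m r^T - r *m w^T).
Proof.
rewrite /= scalerDr !scalerA mulmxDl [(_ + _)^T]linearD mulmxDr /=.
rewrite -!scalemxAl ![(_ *: _)^T]linearZ /= -!scalemxAr !scalerBr opprD.
by rewrite addrACA.
Qed.

Lemma wedge_skew p q : (wedge p q)^T = - wedge p q.
Proof. by rewrite /wedge linearB /= !trmx_mul !trmxK opprB. Qed.

Lemma pair_neq0 (p : P) : (if p is inl _ then 2 else 1 : C) != 0.
Proof. by case: p => _; rewrite ?oner_eq0 ?pnatr_eq0. Qed.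

Lemma vec_neq0 p : vec p != 0.
Proof.
apply/eqP => v0; have := vecM (bar p) p; rewrite v0 mulmx0 barK eqxx mul1r.
move/matrixP/(_ 0 0); rewrite !mxE eqxx mulr1n => /esym/eqP.
by case: p {v0} => [[a s]|b] /=; rewrite ?oner_eq0 ?pnatr_eq0.
Qed.

Lemma wedge_neq0 p q : p != q -> wedge p q != 0.
Proof.
move=> pq; apply: contra_neq (vec_neq0 p) => w0.
have : wedge p q *m vec (bar q) = 0 by rewrite w0 mul0mx.
rewrite /wedge mulmxBl -!mulmxA !vecM !(inj_eq (inv_inj barK)) eqxx.
rewrite [q == p]eq_sym (negPf pq) mul0r mul1r !mul_mx_scalar scale0r subr0.
by move/eqP; rewrite scaler_eq0 (negPf (pair_neq0 q)) => /eqP.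
Qed.

Definition Mdiag (M : orthG R 8) (d : P -> C) : Prop :=
  forall p, cplx (val M) *m vec p = d p *: vec p.

Lemma wedge_act M d p q : Mdiag M d ->
  xact (Ad M) (wedge p q) = (d p * d q) *: wedge p q.
Proof.
move=> Md; rewrite xactAd ?wedge_skew // /wedge mulmxBr mulmxBl.
have E u w : cplx (val M) *m (vec u *m (vec w)^T) *m (cplx (val M))^T =
    (d u * d w) *: (vec u *m (vec w)^T).
  rewrite mulmxA -(mulmxA _ (vec w)^T) -trmx_mul !Md linearZ /=.
  by rewrite -scalemxAl -scalemxAr scalerA.
by rewrite !E [d q * _]mulrC scalerBr.
Qed.

Lemma bvec_vec a (t : bool) : bvec (inl (a, t)) =
  2^-1 *: (((- I) ^+ t) *: vec (inl (a, true)) + (I ^+ t) *: vec (inl (a, false))).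
Proof.
rewrite /vec /= expr0 expr1; set u := bvec (inl (a, false)).
set w := bvec (inl (a, true)); set x := bvec (inl (a, t)).
have := mulII; set i' := 'i%C => ii; apply: (@scalerI _ _ (2 : C)).
  by rewrite pnatr_eq0.
rewrite scalerA mulfV ?pnatr_eq0 // scale1r !scalerDr !scalerA addrACA -!scalerDl.
rewrite {}/x {}/u {}/w; case: t; rewrite ?expr0 ?expr1.
  rewrite addNr scale0r add0r; congr (_ *: _); ring: ii.
have -> : 1 * (1 * i') + 1 * (-1 * i') = 0 by ring.
by rewrite scale0r addr0.
Qed.

(** The isotropic vectors of a plane span it. *)
Lemma vec_total m (W : 'M[C]_(m, 8)) : (forall p, W *m vec p = 0) -> W = 0.
Proof.
move=> W0; have [io ioK Kio] := iota_bij.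
have Wb p : W *m bvec p = 0.
  case: p => [[a t]|b]; last exact: (W0 (inr b)).
  have Z k (u : 'cV[C]_8) : W *m (k *: u) = k *: (W *m u) by rewrite scalemxAr.
  rewrite bvec_vec; move: (W0 (inl (a, true))) (W0 (inl (a, false))).
  by move: (vec _) (vec _) => u w Eu Ew; rewrite Z mulmxDr !Z Eu Ew !scaler0 addr0 scaler0.
apply/matrixP => i j; have := Wb (io j); rewrite /bvec Kio -colE.
by move/matrixP/(_ i 0); rewrite !mxE.
Qed.

(** The products of two eigenvectors span the skew matrices, and the trace
    form is nondegenerate. *)
Lemma wedge_dual V : V^T = - V ->
  (forall p q, p != q -> \tr (V *m (wedge p q)^T) = 0) -> V = 0.
Proof.
move=> sV V0.
have trE p q : \tr (V *m (wedge p q)^T) = 2 * ((vec p)^T *m V *m vec q) 0 0.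
  rewrite /wedge linearB /= !trmx_mul !trmxK mulmxBr linearB /= !mulmxA.
  rewrite mxtrace_mulC [X in _ - X]mxtrace_mulC !mulmxA /mxtrace !big_ord1.
  have -> : ((vec q)^T *m V *m vec p) 0 0 = - ((vec p)^T *m V *m vec q) 0 0.
    rewrite -[(_ *m vec p)]trmxK mxE !trmx_mul trmxK sV mulmxA mulmxN mulNmx.
    by rewrite mxE.
  ring.
have Vpq p q : (vec p)^T *m V *m vec q = 0.
  apply/matrixP => i j; rewrite !ord1 [RHS]mxE.
  have := trE p q; have [<-|pq] := eqVneq p q.
    by rewrite {1}/wedge subrr linear0 mulmx0 mxtrace0 => /esym/eqP; rewrite mulf_eq0 pnatr_eq0 => /eqP.
  by rewrite V0 // => /esym/eqP; rewrite mulf_eq0 pnatr_eq0 => /eqP.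
apply: vec_total => p; apply: trmx_inj; rewrite trmx0 trmx_mul sV mulmxN.
by rewrite (@vec_total _ ((vec p)^T *m V)) ?oppr0.
Qed.

Lemma Mdiag_mul M N d e : Mdiag M d -> Mdiag N e ->
  Mdiag (M * N)%g (fun p => d p * e p).
Proof.
move=> Md Ne p; rewrite /= map_mxM -mulmxA Ne -scalemxAr Md scalerA.
by rewrite mulrC.
Qed.

Lemma Mdiag_inv M d : dgood d -> Mdiag M d -> Mdiag M^-1%g (fun p => (d p)^-1).
Proof.
move=> dg Md p; have d0 := dgood_neq0 p dg.
have -> : vec p = (d p)^-1 *: (cplx (val M) *m vec p).
  by rewrite Md scalerA mulVf ?scale1r.
rewrite -scalemxAr mulmxA /= -map_mxM orthG_Tmul map_mx1 mul1mx.
by rewrite Md !scalerA -mulrA mulVf ?mulr1.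
Qed.

Lemma unitcM z w : unitc z -> unitc w -> unitc (z * w).
Proof.
case: z w => [a b] [c d]; rewrite /unitc /= => E1 E2.
transitivity ((a ^+ 2 + b ^+ 2) * (c ^+ 2 + d ^+ 2)); first by ring.
by rewrite E1 E2 mulr1.
Qed.

Lemma dgood_mul d e : dgood d -> dgood e -> dgood (fun p => d p * e p).
Proof.
move=> [z [eps [uz eps0 ->]]] [w [eta [uw eta0 ->]]].
exists (fun a => z a * w a), (fun b => eps b (+) eta b); split.
- by move=> a; exact: unitcM.
- by rewrite big_split /= eps0 eta0.
by apply/funext => -[[a []]|b] //=; rewrite ?invfM ?signr_addb.
Qed.

Lemma dgood_inv d : dgood d -> dgood (fun p => (d p)^-1).
Proof.
move=> [z [eps [uz eps0 ->]]].
exists (fun a => (z a)^-1), eps; split=> // [a|]; first exact: unitcV.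
by apply/funext => -[[a []]|b] //=; rewrite invr_sign.
Qed.

(** The form in which membership in F is used: diagonal with good eigenvalues. *)
Definition torlike (x : G) : Prop :=
  exists M d, [/\ dgood d, x = Ad M & Mdiag M d].

Lemma torlike1 : torlike 1%g.
Proof.
exists 1%g, (char (fun _ => 1) (fun _ => false)); split.
- exists (fun _ => 1), (fun _ => false); split=> [a||//]; first exact: unitc1.
  exact: big1.
- apply: lie_aut_ext => X; apply/val_inj.
  by rewrite /= trmx1 mulmx1 mul1mx.
by move=> [[a []]|b]; rewrite /= map_mx1 mul1mx ?invr1 ?expr0 scale1r.
Qed.

Lemma torlike_div x y : torlike x -> torlike y -> torlike (x * y^-1)%g.
Proof.
move=> [M [d [dg -> Md]]] [N [e [eg -> Ne]]].
exists (M * N^-1)%g, (fun p => d p * (e p)^-1); split.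
- by apply: dgood_mul => //; exact: dgood_inv.
- rewrite Ad_morphism; congr (_ * _)%g; apply: (mulIg (Ad N)).
  by rewrite mulVg -Ad_morphism mulVg; apply: lie_aut_ext => X; apply/val_inj;
     rewrite /= trmx1 mulmx1 mul1mx.
- by apply: Mdiag_mul => //; exact: Mdiag_inv.
Qed.

(** A rotation by an angle t of the plane with basis e, e' has the isotropic
    vectors e + i e' and e - i e' as eigenvectors, with eigenvalues exp(i t)
    and exp(- i t). *)
Lemma Mdiag_rot (M : orthG R 8) (x y : A -> R) (eps : B -> bool) :
  let e p : 'cV[R]_8 := delta_mx (iota p) 0 in
  (forall a, val M *m e (inl (a, false)) =
     x a *: e (inl (a, false)) + y a *: e (inl (a, true))) ->
  (forall a, val M *m e (inl (a, true)) =
     - y a *: e (inl (a, false)) + x a *: e (inl (a, true))) ->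
  (forall b, val M *m e (inr b) = (-1) ^+ eps b *: e (inr b)) ->
  (forall a, x a ^+ 2 + y a ^+ 2 = 1) ->
  Mdiag M (char (fun a => Complex (x a) (y a)) eps).
Proof.
move=> e M0 M1 Mb xy1.
have be p : bvec p = cplx (e p) by rewrite /bvec /e map_delta_mx.
case=> [[a s]|b]; last first.
  by rewrite /vec /= !be -map_mxM Mb map_mxZ rmorphXn rmorphN rmorph1.
rewrite /vec !be mulmxDr -scalemxAr -!map_mxM M0 M1 !map_mxD !map_mxZ.
have xyV : (Complex (x a) (y a))^-1 = Complex (x a) (- y a) :> C.
  by rewrite /GRing.inv /= xy1 !divr1.
have -> : char (fun a => Complex (x a) (y a)) eps (inl (a, s)) =
    (x a)%:C%C + (-1) ^+ s * (I * (y a)%:C%C) :> C.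
  by case: s; rewrite /= ?xyV ?expr0 ?expr1; apply/eqP; rewrite eq_complex /=;
     apply/andP; split; apply/eqP; ring.
move: (cplx (e _)) (cplx (e _)) => u w.
have := mulII; set i' := 'i%C => ii.
have sN : (-1) ^+ (~~ s) = - (-1) ^+ s :> C by case: s; rewrite !(expr0, expr1) ?opprK.
have ss : (-1) ^+ s * (-1) ^+ s = 1 :> C by rewrite -expr2 sqrr_sign.
rewrite sN rmorphN; move: ss {sN xyV}; set c := (-1) ^+ s => ss.
apply/matrixP => i j; rewrite !mxE; ring: ii ss.
Qed.

Variable F : set (autso8 R).
Hypothesis FD : forall x : G, F x -> torlike x.
Hypothesis DF : forall d, dgood d -> exists2 M, F (Ad M) & Mdiag M d.

(** A nonzero skew matrix pairs nontrivially with some product of two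
    eigenvectors, whose eigenvalue is then the inverse of the weight; hence
    all weights are products of two distinct eigenvalues. *)
Lemma weightP lam : weight F lam -> exists p q, p != q /\
  forall M d, dgood d -> F (Ad M) -> Mdiag M d -> lam (Ad M) = d p * d q.
Proof.
move=> [V [sV V0 EV]].
have [p [q [pq t0]]] : exists p q, p != q /\ \tr (V *m (wedge p q)^T) != 0.
  apply: contrapT => H; case/eqP: V0; apply: wedge_dual => // p q pq.
  by apply: contrapT => /eqP t0; apply: H; exists p, q.
exists (bar p), (bar q); split; first by rewrite (inj_eq (inv_inj barK)).
move=> M d dg FM Md.
have E := weight_dual sV (wedge_skew p q) (EV _ FM) (wedge_act p q Md) t0.
rewrite !char_bar // -invfM.
have dn0 : d p * d q != 0 by rewrite mulf_neq0 ?dgood_neq0.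
by apply: (mulIf dn0); rewrite E mulVf.
Qed.

Lemma weight_wedge lam p q : p != q ->
  (forall M d, dgood d -> F (Ad M) -> Mdiag M d -> lam (Ad M) = d p * d q) ->
  weight F lam.
Proof.
move=> pq lamE; exists (wedge p q); split; [exact: wedge_skew|exact: wedge_neq0|].
by move=> x Fx; have [M [d [dg E Md]]] := FD Fx; subst x; rewrite (wedge_act _ _ Md) (lamE M d).
Qed.

Local Notation L := (A * bool * B)%type.

(** The core eigenvectors: products of an isotropic vector by a coordinate
    vector. *)
Definition dlab (l : L) : 'M[C]_8 := wedge (inl l.1) (inr l.2).

Definition dK : set (L -> C) :=
  [set k | exists2 d, dgood d & k = fun l => d (inl l.1) * d (inr l.2)].

Lemma dlab_skew l : (dlab l)^T = - dlab l. Proof. exact: wedge_skew. Qed.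

Lemma dlab_neq0 l : dlab l != 0. Proof. exact: wedge_neq0. Qed.

Lemma dlab_eigen M d : Mdiag M d ->
  eigen dlab (Ad M) (fun l => d (inl l.1) * d (inr l.2)).
Proof. by move=> Md l; exact: wedge_act. Qed.

Lemma dlab_real k : dK k -> exists x, eigen dlab x k.
Proof.
by move=> [d dg ->]; have [M _ Md] := DF dg; exists (Ad M); exact: dlab_eigen.
Qed.

Variable a0 : A.
Hypothesis B3 : (2 < #|B|)%N.

Lemma dlab_gen (x : G) : (forall l, xact x (dlab l) = dlab l) -> x = 1%g.
Proof.
move=> fx; have [io ioK Kio] := iota_bij.
apply: (@lie_aut_rot1 _ (fun m => if io m is inl _ then true else false)).
- by exists (iota (inl (a0, true))); rewrite ioK.
- have /card_gt0P[b _] : (0 < #|B|)%N by apply: leq_trans B3.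
  by exists (iota (inr b)); rewrite ioK.
move=> m n; case Em: (io m) => [[a t]|] // _; case En: (io n) => [|b] // _.
have Ew : cplx (val (rot R m n)) = bvec (inl (a, t)) *m (bvec (inr b))^T -
    bvec (inr b) *m (bvec (inl (a, t)))^T.
  rewrite /bvec -Em -En !Kio !trmx_delta !mul_delta_mx /=.
  by rewrite /rot_mx map_mxB !map_delta_mx.
apply/val_inj/matrixP => i j.
suff /matrixP/(_ i j) : cplx (val (x (rot R m n))) = cplx (val (rot R m n)).
  by rewrite !mxE => /complexI.
rewrite -xact_so Ew bvec_vec wedge_linear.
pose wd u := u *m (bvec (inr b))^T - bvec (inr b) *m u^T.
have fx' s : xact x (wd (vec (inl (a, s)))) = wd (vec (inl (a, s))) := fx (a, s, b).
move: (fx' true) (fx' false); rewrite {fx'}/wd.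
move: (vec _) (vec _) (bvec _) => u w r fu fw.
by rewrite xact_comb fu fw.
Qed.

Lemma dlabP (x : G) : F x <-> exists2 k, dK k & eigen dlab x k.
Proof.
split=> [/FD[M [d [dg -> Md]]]|[k [d dg ->] Ex]].
  by eexists; [exists d|exact: dlab_eigen].
have [M FM Md] := DF dg.
by rewrite (eigen_inj dlab_skew dlab_gen Ex (dlab_eigen Md)).
Qed.

(** An explicit complex number of modulus one whose first few powers are
    distinct, so that it separates the small powers of a torus character. *)
Definition om : C := Complex (3 / 5) (4 / 5).

Lemma unitc_om : unitc om.
Proof. by rewrite /unitc /=; field. Qed.

Lemma unitcI : unitc I.
Proof. by rewrite /unitc /=; ring. Qed.

Lemma omV : om^-1 = Complex (3 / 5) (- (4 / 5)).
Proof.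
have om0 := unitc_neq0 unitc_om.
apply: (mulIf om0); rewrite mulVf //.
by apply/eqP; rewrite eq_complex /=; apply/andP; split; apply/eqP; field.
Qed.

Lemma om_sqr (s t : bool) :
  ((if s then om^-1 else om) ^+ 2 == (if t then om^-1 else om) ^+ 2) = (s == t).
Proof.
have h : (Complex (3 / 5) (4 / 5) : C) ^+ 2 != Complex (3 / 5) (- (4 / 5)) ^+ 2.
  rewrite !expr2 eq_complex /= negb_and; apply/orP; right.
  rewrite -subr_eq0; set y := (X in X != 0).
  have -> : y = 48 / 25 by rewrite /y; field.
  by rewrite mulf_neq0 ?invr_eq0 ?pnatr_eq0.
have h' := h; rewrite eq_sym in h'.
by rewrite omV /om; case: s; case: t; rewrite ?eqxx // ?(negPf h) ?(negPf h').
Qed.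

Lemma om_sqr1 (s : bool) : (if s then om^-1 else om) ^+ 2 != 1.
Proof.
rewrite omV /om; case: s; rewrite expr2 eq_complex /= negb_and; apply/orP; right;
  set y := (X in X != 0).
- have -> : y = - (24 / 25) by rewrite /y; field.
  by rewrite oppr_eq0 mulf_neq0 ?invr_eq0 ?pnatr_eq0.
- have -> : y = 24 / 25 by rewrite /y; field.
  by rewrite mulf_neq0 ?invr_eq0 ?pnatr_eq0.
Qed.

(** The test character supported on one plane. *)
Definition dz (a : A) (c : C) : P -> C :=
  char (fun b => if b == a then c else 1) (fun _ => false).

(** The test character with two signs -1. *)
Definition de (i j : B) : P -> C :=
  char (fun _ => 1) (fun b => (b == i) || (b == j)).

Lemma dgood_dz a c : unitc c -> dgood (dz a c).
Proof.
move=> uc; exists (fun b => if b == a then c else 1), (fun _ => false); split=> //.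
- by move=> b; case: eqP => // _; exact: unitc1.
- exact: big1.
Qed.

Lemma dgood_de i j : i != j -> dgood (de i j).
Proof.
move=> ij; exists (fun _ => 1), (fun b => (b == i) || (b == j)); split=> //.
  by move=> b; exact: unitc1.
have E1 m : \big[addb/false]_(b : B) (b == m) = true.
  rewrite (bigD1 m) //= eqxx big1 // => b /negPf -> //.
rewrite (eq_bigr (fun b => (b == i) (+) (b == j))).
  by rewrite big_split /= !E1.
move=> b _; have [->|] := eqVneq b i; last by case: (b == j).
by rewrite (negPf ij).
Qed.

Lemma third i j : exists l : B, l != i /\ l != j.
Proof.
apply: contrapT => H; move: B3; rewrite ltnNge => /negP; apply.
have -> : #|B| = #|pred2 i j|.
  apply: eq_card => l; rewrite !inE.
  apply/esym/negPn/negP; rewrite negb_or => /andP[li lj]; apply: H; exists l.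
  by split.
by rewrite card2; case: (_ != _).
Qed.

Lemma dK_dlab d : dgood d -> dK (fun l => d (inl l.1) * d (inr l.2)).
Proof. by move=> dg; exists d. Qed.

(** Squaring kills the signs and keeps the torus part of a label. *)
Lemma dK_sep2 (l m : L) : (forall k, dK k -> k l ^+ 2 = k m ^+ 2) -> l.1 = m.1.
Proof.
case: l m => [[a s] i] [[b t] j] H /=.
have {H} := H _ (dK_dlab (dgood_dz a unitc_om)).
rewrite /dz /= eqxx expr0 !mulr1; have [->|_] := eqVneq b a.
  by move/eqP; rewrite om_sqr => /eqP ->.
have -> : (if t then (1 : C)^-1 else 1) = 1 by case: t; rewrite ?invr1.
by move/eqP; rewrite expr1n (negPf (om_sqr1 s)).
Qed.

Lemma de_sep i j : (forall d, dgood d -> d (inr i) * d (inr j) = 1) -> i = j.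
Proof.
move=> H; apply/eqP/negPn/negP => ij; have [l [li lj]] := third i j.
rewrite eq_sym in li.
have := H _ (dgood_de li); rewrite /de /= eqxx /= eq_sym (negPf ij) eq_sym (negPf lj).
rewrite expr0 expr1 mulr1 => /eqP; rewrite -subr_eq0 -opprD oppr_eq0.
by rewrite -(natrD _ 1 1) pnatr_eq0.
Qed.

Lemma dK_sep (l m : L) : (forall k, dK k -> k l = k m) -> l = m.
Proof.
move=> H; have E : l.1 = m.1 by apply: dK_sep2 => k Kk; rewrite H.
case: l m E H => [p i] [q j] /= <- H; congr pair; apply: de_sep => d dg.
have := H _ (dK_dlab dg) => /= /(mulfI (dgood_neq0 _ dg)) ->.
exact: dgood_inr.
Qed.

(** A product of torus characters of two different planes determines the two
    characters, even after squaring. *)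
Lemma plane_pair a b s t (p q : P) : a != b ->
  (forall d, dgood d -> (d (inl (a, s)) * d (inl (b, t))) ^+ 2 = (d p * d q) ^+ 2) ->
  (p = inl (a, s) /\ q = inl (b, t)) \/ (p = inl (b, t) /\ q = inl (a, s)).
Proof.
move=> ab H; pose inpl c (r : P) := if r is inl (b', _) then b' == c else false.
have neq1 : (-1 : C) != 1.
  by rewrite -subr_eq0 -opprD oppr_eq0 -(natrD _ 1 1) pnatr_eq0.
have dzI c r : dz c I r ^+ 2 = (-1) ^+ inpl c r.
  case: r => [[a' u]|b'] /=; last by rewrite expr0 expr1n.
  case: eqP => _; last by case: u; rewrite ?invr1 expr1n.
  by case: u; rewrite ?exprVn sqr_i ?invrN1.
have odd_in c : (inpl c (inl (a, s))) (+) (inpl c (inl (b, t))) ->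
    inpl c p (+) inpl c q.
  move=> Hc; have := H _ (dgood_dz c unitcI); rewrite !exprMn !dzI.
  by rewrite -!signr_addb Hc; case: (inpl c p (+) inpl c q) => // /eqP;
    rewrite expr1 expr0 (negPf neq1).
have Ia : inpl a p (+) inpl a q by apply: odd_in; rewrite /= eqxx eq_sym (negPf ab).
have Ib : inpl b p (+) inpl b q by apply: odd_in; rewrite /= eqxx (negPf ab).
have key c e u v : c != e -> (forall d, dgood d ->
    (d (inl (c, s)) * d (inl (e, t))) ^+ 2 = (d (inl (c, u)) * d (inl (e, v))) ^+ 2) ->
    s = u /\ t = v.
  move=> ce E; split; apply/eqP.
    have {E} := E _ (dgood_dz c unitc_om); rewrite /dz /= eqxx [e == c]eq_sym (negPf ce).
    by case: (t); case: (v); rewrite ?invr1 !mulr1 => /eqP; rewrite om_sqr.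
  have {E} := E _ (dgood_dz e unitc_om); rewrite /dz /= eqxx (negPf ce).
  by case: (s); case: (u); rewrite ?invr1 !mul1r => /eqP; rewrite om_sqr.
clear odd_in; case: p q H Ia Ib => [[c u]|c] [[e v]|e] H //=; rewrite ?addbF ?addFb.
- have [Ec|ca] := eqVneq c a.
    subst c; rewrite (negPf ab) /= => _ /eqP eb; subst e; left.
    by have [-> ->] := key _ _ _ _ ab H.
  rewrite addFb => /eqP ea; subst e.
  rewrite (negPf ab) addbF => /eqP cb; subst c; right.
  suff [-> ->] : s = v /\ t = u by [].
  by apply: (key a b) => // d dg; rewrite H // mulrC.
- by move=> /eqP -> /eqP ba; rewrite ba eqxx in ab.
- by move=> /eqP -> /eqP ba; rewrite ba eqxx in ab.
Qed.

Lemma labels_weight lam l : (forall x, F x -> lam x = ev dlab x l) -> weight F lam.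
Proof.
move=> lamE; apply: (@weight_wedge lam (inl l.1) (inr l.2)) => // M d dg FM Md.
by rewrite lamE // (evP dlab_neq0 (dlab_eigen Md)).
Qed.

(** The weights are z_a^(+-1) eps_i, eps_i eps_j, z_a^(+-1) z_b^(+-1) and 1.
    The first ones are core, since z_a^(+-1) eps_j has the same square.  Those
    of the second and last kind have trivial square, and those of the third
    kind are determined by their square. *)
Lemma dlab_core lam :
  core F lam <-> exists l, forall x, F x -> lam x = ev dlab x l.
Proof.
have evd M d p i : Mdiag M d -> ev dlab (Ad M) (p, i) = d (inl p) * d (inr i).
  by move=> Md; rewrite (evP dlab_neq0 (dlab_eigen Md)).
split; last first.
  move=> [[[a s] i] lamE]; split; first exact: (labels_weight lamE).
    have [M FM Md] := DF (dgood_dz a unitcI); exists (Ad M) => //.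
    rewrite (lamE _ FM) (evd _ _ _ _ Md) /dz /= eqxx expr0 mulr1.
    by case: s {lamE}; rewrite ?exprVn sqr_i ?invrN1 -subr_eq0 -opprD oppr_eq0
      -(natrD _ 1 1) pnatr_eq0.
  have [j [ji _]] := third i i; have [l [li lj]] := third i j.
  exists (fun x => ev dlab x (a, s, j)); split.
  - exact: (labels_weight (l := (a, s, j)) (fun x _ => erefl)).
  - rewrite eq_sym in li; have [M FM Md] := DF (dgood_de li); exists (Ad M) => //.
    rewrite (lamE _ FM) !(evd _ _ _ _ Md) /de /= eqxx (negPf ji) [j == l]eq_sym (negPf lj) /=.
    rewrite expr1 expr0 -subr_eq0 -mulrBr mulf_neq0 //.
      by case: s {lamE}; rewrite ?invr1 oner_eq0.
    by rewrite opprK -(natrD _ 1 1) pnatr_eq0.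
  - move=> x Fx; rewrite (lamE x Fx); have [M [d [dg -> Md]]] := FD Fx.
    rewrite !(evd _ _ _ _ Md) 2!exprMn (expr2 (d (inr i))) (expr2 (d (inr j))).
    by rewrite (dgood_inr i dg) (dgood_inr j dg).
move=> [wl [x Fx lx1] [mu [wm [y Fy my] ml]]].
have [p [q [pq lamE]]] := weightP wl.
have FE l : (forall d, dgood d -> d p * d q = d (inl l.1) * d (inr l.2)) ->
    exists l, forall x, F x -> lam x = ev dlab x l.
  case: l => r i E; exists (r, i) => z Fz; have [M [d [dg zE Md]]] := FD Fz; subst z.
  by rewrite (lamE M d) // (evd _ _ _ _ Md) E.
have lam1 : (forall d, dgood d -> (d p * d q) ^+ 2 = 1) ->
    exists l, forall x, F x -> lam x = ev dlab x l.
  move=> E; case/eqP: lx1; have [M [d [dg xE Md]]] := FD Fx; subst x.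
  by rewrite (lamE M d) // E.
case: p q pq lamE FE lam1 => [[a s]|i] [[b t]|j] pq lamE FE lam1.
- have [Eab|ab] := eqVneq a b.
    apply: lam1 => d dg; suff -> : inl (b, t) = bar (inl (a, s)).
      by rewrite char_bar // mulfV ?expr1n ?dgood_neq0.
    subst b; congr (inl (_, _)); move: pq; clear.
    by case: s; case: t; rewrite ?eqxx.
  have [p' [q' [pq' muE]]] := weightP wm.
  have E d : dgood d -> (d (inl (a, s)) * d (inl (b, t))) ^+ 2 = (d p' * d q') ^+ 2.
    move=> dg; have [M FM Md] := DF dg.
    by rewrite -(lamE M d) // -(muE M d) // ml.
  case/eqP: my; have [M [d [dg yE Md]]] := FD Fy; subst y.
  rewrite (lamE M d) // (muE M d) //.
  by case: (plane_pair ab E) => -[-> ->] //; rewrite mulrC.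
- by apply: (FE (a, s, j)).
- by apply: (FE (b, t, i)) => d dg; rewrite mulrC.
- by apply: lam1 => d dg; rewrite exprMn !expr2 (dgood_inr i dg) (dgood_inr j dg) mulr1.
Qed.

Definition dT : Type := ({perm A} * {ffun A -> bool} * {perm B})%type.

Definition dact (t : dT) (l : L) : L :=
  (t.1.1 l.1.1, l.1.2 (+) t.1.2 l.1.1, t.2 l.2).

Lemma dact_inj t : injective (dact t).
Proof.
move=> [[a s] i] [[b u] j] [/perm_inj -> /addIb -> /perm_inj ->].
by [].
Qed.

(** The set of good characters is stable because the product of the signs is
    symmetric. *)
Lemma dgood_act t d : dgood d -> exists2 d', dgood d' &
  forall l : L, d (inl (dact t l).1) * d (inr (dact t l).2) = d' (inl l.1) * d' (inr l.2).
Proof.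
move=> [z [eps [uz eps0 ->]]].
exists (char (fun a => if t.1.2 a then (z (t.1.1 a))^-1 else z (t.1.1 a))
             (fun b => eps (t.2 b))).
  exists (fun a => if t.1.2 a then (z (t.1.1 a))^-1 else z (t.1.1 a)),
     (fun b => eps (t.2 b)); split=> //.
    move=> a; case: (t.1.2 a); last exact: uz.
    exact: unitcV.
  rewrite -[RHS]eps0 [RHS](reindex_inj (@perm_inj _ t.2)).
  by apply: eq_bigl.
by move=> [[a s] i] /=; case: s; case: (t.1.2 a); rewrite /= ?invrK.
Qed.

Definition dinv (t : dT) : dT :=
  ((t.1.1)^-1%g, [ffun a => t.1.2 ((t.1.1)^-1%g a)], (t.2)^-1%g).

Lemma dactKV t l : dact t (dact (dinv t) l) = l.
Proof. by case: l => [[a s] i]; rewrite /dact /= ffunE !permKV addbK. Qed.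

Lemma dK_act t k : dK (k \o dact t) <-> dK k.
Proof.
have act u m : dK m -> dK (m \o dact u).
  move=> [d dg ->]; have [d' dg' E] := dgood_act u dg; exists d' => //.
  by apply/funext => l /=; rewrite -E.
split=> [/(act (dinv t))|]; last exact: act.
by rewrite (_ : _ \o _ = k) //; apply/funext => l /=; rewrite dactKV.
Qed.

Lemma dact_faithful t u :
  (forall k, dK k -> k \o dact t =1 k \o dact u) -> t = u.
Proof.
move=> H; have E l : dact t l = dact u l by apply: dK_sep => k Kk; exact: H.
have /card_gt0P[b0 _] : (0 < #|B|)%N by apply: leq_trans B3.
case: t u E {H} => [[f e] g] [[f' e'] g'] E; congr (_, _, _).
- by apply/permP => a; have [] := E (a, false, b0).
- by apply/ffunP => a; have [] := E (a, false, b0).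
- by apply/permP => b; have [] := E (a0, false, b).
Qed.

(** A permutation of the planes and of the coordinate vectors is realised by a
    permutation matrix, and the inversion of z_a by the reflection of the
    plane a. *)
Lemma dact_onto t : exists g : G, forall l, exists c,
  xact g (dlab l) = c *: dlab (dact t l).
Proof.
have [io ioK Kio] := iota_bij.
pose psi (p : P) : P := match p with
  | inl (a, s) => inl (t.1.1 a, s) | inr b => inr (t.2 b) end.
have psi_inj : injective psi.
  by move=> [[a s]|b] [[c u]|e] //= [] => [/perm_inj -> ->|/perm_inj ->].
pose sg (p : P) : bool := if p is inl (a, true) then t.1.2 a else false.
pose N : 'M[R]_8 := \matrix_(m, n) ((-1) ^+ sg (io n) * (m == iota (psi (io n)))%:R).
have NN : orth N.
  apply/eqP/mulmx1C/matrixP => m n; rewrite !mxE.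
  rewrite (bigD1 (iota (psi (io m)))) //= big1 => [|i im]; last first.
    by rewrite !mxE (negPf im) mulr0 mul0r.
  rewrite !mxE eqxx mulr1 addr0 (inj_eq iota_inj) (inj_eq psi_inj).
  rewrite (can_eq Kio); have [<-|_] := eqVneq m n; last by rewrite !mulr0.
  by rewrite mulr1 -expr2 sqrr_sign.
have Nb p : cplx N *m bvec p = (-1) ^+ sg p *: bvec (psi p).
  rewrite -colE; apply/matrixP => i j; rewrite !ord1 !mxE ioK.
  by rewrite rmorphM rmorphXn rmorphN rmorph1 rmorph_nat andbT.
pose bact (p : P) : P := match p with
  | inl (a, s) => inl (t.1.1 a, s (+) t.1.2 a) | inr b => inr (t.2 b) end.
have Nv p : cplx N *m vec p = vec (bact p).
  case: p => [[a s]|b]; last by rewrite /vec Nb /= expr0 scale1r.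
  rewrite /vec mulmxDr -scalemxAr !Nb /= expr0 scale1r scalerA; congr (_ + _ *: _).
  by case: s; case: (t.1.2 a); rewrite /= ?expr0 ?expr1; ring.
exists (Ad (Sub N NN : orthG R 8)) => -[p i]; exists 1; rewrite scale1r.
rewrite xactAd ?dlab_skew // /dlab /wedge mulmxBr mulmxBl.
have E u w : cplx N *m (vec u *m (vec w)^T) *m (cplx N)^T =
    vec (bact u) *m (vec (bact w))^T.
  by rewrite mulmxA -(mulmxA _ (vec w)^T) -trmx_mul !Nv.
by rewrite !E; case: p.
Qed.

(** The permutation phi preserves the equality of squares of labels, and so
    acts on the pairs (plane, sign of the exponent); it preserves inverses,
    and so acts on the planes.  If a and b are different planes, then z_a^s
    eps_i and z_b^t eps_i have a product z_a^s z_b^t that is a weight; since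
    the product of their images is a weight as well, the images involve the
    same sign, so that the permutation of the index i does not depend on the
    plane. *)
Lemma dlab_label (phi : L -> L) :
  (forall k, dK k -> dK (k \o phi)) ->
  (forall k, dK k -> exists2 k', dK k' & k = k' \o phi) ->
  (forall l m, weight F (fun x => ev dlab x l * ev dlab x m) ->
     weight F (fun x => ev dlab x (phi l) * ev dlab x (phi m))) ->
  exists t, phi =1 dact t.
Proof.
move=> phiK Kphi phiW.
have evd M d p i : Mdiag M d -> ev dlab (Ad M) (p, i) = d (inl p) * d (inr i).
  by move=> Md; rewrite (evP dlab_neq0 (dlab_eigen Md)).
have /card_gt0P[b0 _] : (0 < #|B|)%N by apply: leq_trans B3.
pose bl (p : A * bool) := (p.1, ~~ p.2).
have Ksq k p i j : dK k -> k (p, i) ^+ 2 = k (p, j) ^+ 2.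
  by move=> [d dg ->] /=; rewrite !exprMn !(expr2 (d (inr _)))
    (dgood_inr i dg) (dgood_inr j dg).
have Kbar k p i : dK k -> k (bl p, i) = (k (p, i))^-1.
  move=> [d dg ->] /=; rewrite invfM -!(char_bar _ dg).
  by case: p.
have phi_sq p i j : (phi (p, i)).1 = (phi (p, j)).1.
  by apply: dK_sep2 => k /phiK Kk; exact: (Ksq _ _ _ _ Kk).
have phi_inj : injective phi.
  move=> l m E; apply: dK_sep => k /Kphi[k' _ ->].
  by rewrite /= E.
have phi1_inj p q i j : (phi (p, i)).1 = (phi (q, j)).1 -> p = q.
  move=> E; apply: (dK_sep2 (l := (p, i)) (m := (q, j))) => k /Kphi[k' Kk' ->] /=.
  case: (phi (p, i)) (phi (q, j)) E => [p' i'] [q' j'] /= <-; exact: Ksq.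
have phi_bar p i : phi (bl p, i) = (bl (phi (p, i)).1, (phi (p, i)).2).
  apply: dK_sep => k Kk; rewrite (Kbar _ _ _ Kk) -surjective_pairing.
  exact: (Kbar _ _ _ (phiK _ Kk)).
pose al a := (phi (a, false, b0)).1.1; pose e a := (phi (a, false, b0)).1.2.
have phi1 a s i : (phi (a, s, i)).1 = (al a, s (+) e a).
  case: s; last by rewrite (phi_sq _ _ b0) addFb -surjective_pairing.
  by rewrite (phi_bar (a, false)) /= (phi_sq _ _ b0).
have al_inj : injective al.
  move=> a b E; suff [] : (a, e a) = (b, e b) by [].
  apply: (phi1_inj _ _ b0 b0); by rewrite !phi1 !addbb E.
have phi2 p q i : (phi (p, i)).2 = (phi (q, i)).2.
  case: p q => [a s] [b t]; have [<-|ab] := eqVneq a b.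
    by case: s; case: t => //; rewrite (phi_bar (a, false)).
  have w1 : weight F (fun x => ev dlab x (a, s, i) * ev dlab x (b, t, i)).
    apply: (@weight_wedge _ (inl (a, s)) (inl (b, t))).
      by apply: contraNneq ab => -[->].
    move=> M d dg FM Md; rewrite !(evd _ _ _ _ Md) mulrACA (dgood_inr i dg).
    by rewrite mulr1.
  have [p' [q' [_ phiE]]] := weightP (phiW _ _ w1).
  have {}phiE d : dgood d -> d (inl (al a, s (+) e a)) * d (inl (al b, t (+) e b)) *
      (d (inr (phi (a, s, i)).2) * d (inr (phi (b, t, i)).2)) = d p' * d q'.
    move=> dg; have [M FM Md] := DF dg; rewrite -(phiE M d) //.
    have E l : ev dlab (Ad M) l = d (inl l.1) * d (inr l.2).
      by case: l => p j; exact: evd.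
    by rewrite !E !phi1 mulrACA.
  have albN : al a != al b by rewrite (inj_eq al_inj).
  have := plane_pair albN (p := p') (q := q') (s := s (+) e a) (t := t (+) e b).
  case=> [d dg|pq|pq].
  - rewrite -phiE // !exprMn !(expr2 (d (inr _))).
    by rewrite (dgood_inr (phi (a, s, i)).2 dg) (dgood_inr (phi (b, t, i)).2 dg) !mulr1.
  - apply: de_sep => d dg; have := phiE d dg; rewrite pq.1 pq.2.
    move/eqP; rewrite -subr_eq0 -[X in _ - X]mulr1 -mulrBr !mulf_eq0.
    by rewrite !(negPf (dgood_neq0 _ dg)) subr_eq0 => /eqP.
  - apply: de_sep => d dg; have := phiE d dg; rewrite pq.1 pq.2.
    move/eqP; rewrite [X in _ == X]mulrC -subr_eq0 -[X in _ - X]mulr1 -mulrBr !mulf_eq0.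
    by rewrite !(negPf (dgood_neq0 _ dg)) subr_eq0 => /eqP.
pose pi i := (phi (a0, false, i)).2.
have pi_inj : injective pi.
  move=> i j E; have [] // : (a0, false, i) = (a0, false, j).
  apply: phi_inj; rewrite [LHS]surjective_pairing [RHS]surjective_pairing !phi1.
  by congr (_, _).
exists (perm al_inj, [ffun a => e a], perm pi_inj) => -[[a s] i].
rewrite [LHS]surjective_pairing phi1 (phi2 _ (a0, false)) /dact /=.
by rewrite !permE ffunE.
Qed.

Lemma diagonal_weyl :
  exists f : weyl F -> {perm A} * {ffun A -> bool} * {perm B}, bijective f /\
  forall v w, dact (f (v * w)%g) =1 dact (f v) \o dact (f w).
Proof.
have [f [f_bij fM]] := weyl_actions (T := ({perm A} * {ffun A -> bool} * {perm B})%type)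
  dlab_skew dlab_neq0 dlab_gen dlabP dlab_real dact_inj dK_act dact_faithful
  dact_onto dlab_core dlab_label.
exists f; split=> // v w l; apply: dK_sep => k Kk.
exact: (fM v w k Kk l).
Qed.

Lemma diagonal_card : [set: weyl F] #= `I_(factorial #|A| * 2 ^ #|A| * factorial #|B|)%N.
Proof.
have := card_weyl (T := ({perm A} * {ffun A -> bool} * {perm B})%type)
  dlab_skew dlab_neq0 dlab_gen dlabP dlab_real dact_inj dK_act dact_faithful
  dact_onto dlab_core dlab_label.
have cperm (D : finType) : #|{perm D}| = factorial #|D|.
  rewrite -[#|D|]cardsT -card_perm; apply/esym/eq_card => s; rewrite [RHS]inE.
  by apply/fintype.subsetP => d _; rewrite inE.
by rewrite !card_prod card_ffun card_bool !cperm.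
Qed.

End Diagonal.

(** * Generated subgroups and sign matrices *)

Section Gen.
Local Open Scope group_scope.
Variable G : groupType.

Lemma gen_min (S H : set G) : is_subgroup H -> S `<=` H -> gen S `<=` H.
Proof. by move=> sH SH x; apply. Qed.

Lemma sub_gen (S : set G) : S `<=` gen S.
Proof. by move=> x Sx H [_ SH]; exact: SH. Qed.

Lemma gen_subgroup (S : set G) : is_subgroup (gen S).
Proof.
split=> [H [[H1 _] _] //|x y gx gy H HP].
by have [[_ sH] _] := HP; apply: sH; [exact: gx|exact: gy].
Qed.

Lemma gen1 (S : set G) : gen S 1. Proof. by have [] := gen_subgroup S. Qed.

Lemma genV (S : set G) x : gen S x -> gen S x^-1.
Proof.
by move=> gx; have [g1 gV] := gen_subgroup S; rewrite -[x^-1]mul1g; exact: gV.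
Qed.

Lemma genM (S : set G) x y : gen S x -> gen S y -> gen S (x * y).
Proof.
by move=> gx /genV gy; have [g1 gV] := gen_subgroup S; rewrite -[y]invgK; exact: gV.
Qed.

Definition opt (c : bool) (x : G) : G := if c then x else 1.

Lemma gen_opt (S : set G) c x : gen S x -> gen S (opt c x).
Proof. by move=> gx; case: c => //; exact: gen1. Qed.

End Gen.

Section Signs.
Variable R : realType.

Definition sgn n (B : orthG R n) (eps : 'I_n -> bool) : Prop :=
  forall i, val B *m delta_mx i 0 = (-1) ^+ eps i *: (delta_mx i 0 : 'cV[R]_n).

Lemma sgn1 n : sgn (1%g : orthG R n) (fun _ => false).
Proof. by move=> i; rewrite mul1mx expr0 scale1r. Qed.

Lemma sgn_oneg n : sgn (oneg R n) (fun _ => true).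
Proof. by move=> i; rewrite /= mulNmx mul1mx expr1 scaleN1r. Qed.

Lemma sgnM n (B B' : orthG R n) e e' : sgn B e -> sgn B' e' ->
  sgn (B * B')%g (fun i => e i (+) e' i).
Proof.
move=> Be Be' i; rewrite /= -mulmxA Be' -scalemxAr Be scalerA.
by rewrite signr_addb mulrC.
Qed.

Lemma sgnV n (B : orthG R n) e : sgn B e -> sgn B^-1%g e.
Proof.
move=> Be i; have E : delta_mx i 0 = (-1) ^+ e i *: (val B *m (delta_mx i 0 : 'cV[R]_n)).
  by rewrite Be scalerA -expr2 sqrr_sign scale1r.
by rewrite {1}E -scalemxAr mulmxA /= orthG_Tmul mul1mx.
Qed.

Lemma sgn_opt n (B : orthG R n) c e : sgn B e -> sgn (opt c B) (fun i => c && e i).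
Proof. by case: c => // _; exact: sgn1. Qed.

Lemma oblock_l m n (P : orthG R m) (Q : orthG R n) i :
  val (oblock P Q) *m (delta_mx (lshift n i) 0 : 'cV_(m + n)) =
  col_mx (val P *m delta_mx i 0) 0.
Proof. by rewrite delta_mx_ushift /= mul_block_col !mul0mx mulmx0 !addr0. Qed.

Lemma oblock_r m n (P : orthG R m) (Q : orthG R n) i :
  val (oblock P Q) *m (delta_mx (rshift m i) 0 : 'cV_(m + n)) =
  col_mx 0 (val Q *m delta_mx i 0).
Proof. by rewrite delta_mx_dshift /= mul_block_col !mul0mx mulmx0 !add0r. Qed.

Lemma oblock_rot m n (P : orthG R m) (Q : orthG R n) i j k x y :
  val P *m (delta_mx i 0 : 'cV_m) = x *: delta_mx j 0 + y *: delta_mx k 0 ->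
  val (oblock P Q) *m (delta_mx (lshift n i) 0 : 'cV_(m + n)) =
  x *: delta_mx (lshift n j) 0 + y *: delta_mx (lshift n k) 0.
Proof.
move=> E; rewrite oblock_l E !delta_mx_ushift !scale_col_mx add_col_mx.
by rewrite !scaler0 addr0.
Qed.

Lemma oblock_sgn m n (P : orthG R m) (Q : orthG R n) e i : sgn Q e ->
  val (oblock P Q) *m (delta_mx (rshift m i) 0 : 'cV_(m + n)) =
  (-1) ^+ e i *: delta_mx (rshift m i) 0.
Proof. by move=> Qe; rewrite oblock_r Qe delta_mx_dshift scale_col_mx scaler0. Qed.

Lemma sgn_oblock m n (P : orthG R m) (Q : orthG R n) e f (h : 'I_(m + n) -> bool) :
  sgn P e -> sgn Q f -> (forall i, h (lshift n i) = e i) ->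
  (forall i, h (rshift m i) = f i) -> sgn (oblock P Q) h.
Proof.
move=> Pe Qf he hf i; case: (split_ordP i) => j ->.
  rewrite oblock_l Pe he delta_mx_ushift scale_col_mx scaler0.
  by [].
by rewrite oblock_r Qf hf delta_mx_dshift scale_col_mx scaler0.
Qed.

Lemma lr_col (p q : quat R) i :
  lr_mx p q *m delta_mx i 0 = qvec (qmul (qmul p (qbasis R i)) (qconj q)).
Proof. by rewrite -qvec_basis lr_mxE. Qed.

Lemma sgn_lr_ii : sgn (lr (Sp1_i R) (Sp1_i R)) (fun i => 1 < i)%N.
Proof.
move=> i; rewrite /= lr_col -qvec_basis; apply/colP => j; rewrite !mxE.
by case: i => [[|[|[|[|]]]]] //= _; case: j => [[|[|[|[|]]]]] //= _;
  rewrite ?expr0 ?expr1; ring.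
Qed.

Lemma sgn_lr_jj : sgn (lr (Sp1_j R) (Sp1_j R)) (fun i => odd i).
Proof.
move=> i; rewrite /= lr_col -qvec_basis; apply/colP => j; rewrite !mxE.
by case: i => [[|[|[|[|]]]]] //= _; case: j => [[|[|[|[|]]]]] //= _;
  rewrite ?expr0 ?expr1; ring.
Qed.

Lemma sgn_lr_neg : sgn (lr (1%g : Sp1 R) (Sp1_neg R)) (fun _ => true).
Proof.
move=> i; rewrite /= lr_col -qvec_basis; apply/colP => j; rewrite !mxE.
by case: i => [[|[|[|[|]]]]] //= _; case: j => [[|[|[|[|]]]]] //= _;
  rewrite ?expr0 ?expr1; ring.
Qed.

Lemma sgn_lr_neg' : sgn (lr (Sp1_neg R) (1%g : Sp1 R)) (fun _ => true).
Proof.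
move=> i; rewrite /= lr_col -qvec_basis; apply/colP => j; rewrite !mxE.
by case: i => [[|[|[|[|]]]]] //= _; case: j => [[|[|[|[|]]]]] //= _;
  rewrite ?expr0 ?expr1; ring.
Qed.

Lemma lr1 : lr (1%g : Sp1 R) 1%g = 1%g.
Proof. by apply: (mulgI (lr (1%g : Sp1 R) 1%g)); rewrite -lr_morphism !mulg1. Qed.

End Signs.

(** * The group F_10 *)

Section F10.
Variable R : realType.
Local Notation C := R[i].

(** The two planes (1, i) and (j, k) of the first block, and the four
    coordinate vectors of the second block. *)
Definition iota10 (p : bool * bool + 'I_4) : 'I_8 :=
  match p with
  | inl (a, s) => lshift 4 (inord (a.*2 + s) : 'I_4)
  | inr b => rshift 4 b
  end.

Lemma iota10_bij : bijective iota10.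
Proof.
have B4 (x y : bool) : (x.*2 + y < 4)%N by case: x; case: y.
apply: inj_card_bij; last by rewrite card_sum card_prod !card_bool !card_ord.
move=> [[a s]|b] [[c t]|e] /=.
- move=> E; have {E} := congr1 val (@lshift_inj 4 4 _ _ E); rewrite /= !inordK ?B4 //.
  by case: a; case: c; case: s; case: t.
- by move=> /eqP; rewrite (@eq_lrshift 4 4).
- by move=> /eqP; rewrite (@eq_rlshift 4 4).
by move=> E; rewrite (@rshift_inj 4 4 _ _ E).
Qed.

(** The angles by which left multiplication by a and right multiplication by
    the conjugate of b rotate the planes (1, i) and (j, k). *)
Definition rot_c (a b : Sp1 R) (t : bool) : C :=
  let x := val a in let y := val b in
  if t then Complex (q_re x * q_re y - q_i x * q_i y) (q_i x * q_re y + q_re x * q_i y)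
  else Complex (q_re x * q_re y + q_i x * q_i y) (q_i x * q_re y - q_re x * q_i y).

Lemma Mdiag10 (a b : Sp1 R) (Q : orthG R 4) eps : U1 a -> U1 b -> sgn Q eps ->
  Mdiag iota10 (oblock (lr a b) Q : orthG R 8) (char (rot_c a b) eps) /\
  forall t, unitc (rot_c a b t).
Proof.
move=> Ua Ub Qe.
have na := Sp1_norm a; have nb := Sp1_norm b.
have ur t : unitc (rot_c a b t).
  move: na nb Ua Ub; rewrite /rot_c /unitc /U1 /=.
  case: (val a) => a0 a1 a2 a3; case: (val b) => b0 b1 b2 b3 /= na nb [a20 a30] [b20 b30].
  subst; have : (a0 ^+ 2 + a1 ^+ 2) * (b0 ^+ 2 + b1 ^+ 2) = 1.
    have -> : a0 ^+ 2 + a1 ^+ 2 = 1 by rewrite -na; ring.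
    have -> : b0 ^+ 2 + b1 ^+ 2 = 1 by rewrite -nb; ring.
    exact: mulr1.
  by move=> <-; case: t => /=; ring.
split=> //.
have -> : char (rot_c a b) eps = char (fun t => Complex (complex.Re (rot_c a b t)) (complex.Im (rot_c a b t))) eps.
  by congr (char _ _); apply/funext => t; rewrite /rot_c; case: t.
apply: Mdiag_rot => [t|t|e|t]; last exact: ur.
- apply: (@oblock_rot R 4 4); move: Ua Ub; rewrite /= lr_col /rot_c /U1 /=.
  case: (val a) => a0 a1 a2 a3; case: (val b) => b0 b1 b2 b3 /= [-> ->] [-> ->].
  by apply/colP => j; rewrite !mxE -!val_eqE /= !inordK; case: t => //=;
    case: j => [[|[|[|[|]]]]] //= _; ring.
- apply: (@oblock_rot R 4 4); move: Ua Ub; rewrite /= lr_col /rot_c /U1 /=.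
  case: (val a) => a0 a1 a2 a3; case: (val b) => b0 b1 b2 b3 /= [-> ->] [-> ->].
  by apply/colP => j; rewrite !mxE -!val_eqE /= !inordK; case: t => //=;
    case: j => [[|[|[|[|]]]]] //= _; ring.
exact: (@oblock_sgn R 4 4).
Qed.

Local Notation m := (Sp1_neg R).
Local Notation e := (1%g : Sp1 R).
Local Notation i := (Sp1_i R).
Local Notation j := (Sp1_j R).

Lemma U1e : U1 e. Proof. by []. Qed.
Lemma U1m : U1 m. Proof. by []. Qed.

Lemma U1M (a b : Sp1 R) : U1 a -> U1 b -> U1 (a * b)%g.
Proof.
rewrite /U1 /=; case: (val a) => a0 a1 a2 a3; case: (val b) => b0 b1 b2 b3 /=.
by move=> [-> ->] [-> ->]; split; ring.
Qed.

Lemma torlike10 (a b c d : Sp1 R) eps : U1 a -> U1 b -> sgn (lr d c) eps ->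
  \big[addb/false]_k eps k = false -> torlike iota10 (spin4 (a, b, c, d)).
Proof.
move=> Ua Ub Qe e0; have [Md ur] := Mdiag10 Ua Ub Qe.
exists (oblock (lr a b) (lr d c) : orthG R 8), (char (rot_c a b) eps); split=> //.
by exists (rot_c a b), eps.
Qed.

Lemma torlike10_subgroup :
  is_subgroup [set y : Sp1_4 R | torlike iota10 (spin4 y)].
Proof.
have s1 : spin4 1%g = 1%g :> autso8 R.
  by apply: (mulgI (spin4 (1%g : Sp1_4 R))); rewrite -spin4_morphism !mulg1.
split=> [|x y tx ty].
  have := @torlike1 R _ _ iota10; rewrite -s1.
  by [].
rewrite /mkset.
have -> : spin4 (x * y^-1)%g = (spin4 x * (spin4 y)^-1)%g.
  rewrite spin4_morphism; congr (_ * _)%g; apply: (mulIg (spin4 y)).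
  by rewrite mulVg -spin4_morphism mulVg.
exact: torlike_div.
Qed.

Lemma big_ord4 (f : 'I_4 -> bool) : \big[addb/false]_k f k =
  f (inord 0) (+) f (inord 1) (+) f (inord 2) (+) f (inord 3).
Proof.
rewrite !big_ord_recl big_ord0 addbF !addbA.
by do ![congr (_ (+) _) || congr f]; apply/val_inj; rewrite /= ?inordK.
Qed.

Lemma sgn_eq n (B : orthG R n) eps eps' : sgn B eps -> eps =1 eps' -> sgn B eps'.
Proof. by move=> Be E k; rewrite Be E. Qed.

Lemma F10_torlike x : F10 R x -> torlike iota10 x.
Proof.
move=> [y gy <-]; move: y gy; apply: gen_min; first exact: torlike10_subgroup.
have Q1 : sgn (lr e e) (fun=> false) by rewrite lr1; exact: sgn1.
have Qm1 : sgn (lr m e) (fun=> true) by exact: sgn_lr_neg'.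
have Q1m : sgn (lr e m) (fun=> true) by exact: sgn_lr_neg.
move=> y [[[a Ua [b Ub <-]]|[->|->]]|]; last first.
- move: y; apply: gen_min; first exact: torlike10_subgroup.
  move=> y [[->|->]|->].
  + by apply: (torlike10 U1m U1m Q1); rewrite big1.
  + by apply: (torlike10 U1m U1e Q1m); rewrite big_ord4.
  + by apply: (torlike10 U1m U1e Qm1); rewrite big_ord4.
- apply: (torlike10 U1e U1e (@sgn_lr_jj R)).
  by rewrite big_ord4 !inordK.
- apply: (torlike10 U1e U1e (@sgn_lr_ii R)).
  by rewrite big_ord4 !inordK.
- by apply: (torlike10 Ua Ub Q1); rewrite big1.
Qed.

Lemma unit_sqrt (w : C) : unitc (w ^+ 2) -> unitc w.
Proof.
case: w => x y; rewrite /unitc expr2 /= => E.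
have {}E : (x ^+ 2 + y ^+ 2) ^+ 2 = 1 by rewrite -E; ring.
have n0 : 0 <= x ^+ 2 + y ^+ 2 by rewrite addr_ge0 ?sqr_ge0.
by apply/eqP; rewrite -(@pexpr_eq1 _ _ 2) // E.
Qed.

(** The two angles are the difference and the sum of the arguments of a and b,
    so that a is a square root of the product of the prescribed values. *)
Lemma rot_c_onto (z : bool -> C) : (forall t, unitc (z t)) ->
  exists a b : Sp1 R, [/\ U1 a, U1 b & rot_c a b = z].
Proof.
move=> uz; pose w := sqrtc (z false * z true).
have ww : w ^+ 2 = z false * z true by rewrite /w sqr_sqrtc.
have uw : unitc w by apply: unit_sqrt; rewrite ww; apply: unitcM.
have ub := unitcM (unitcV (uz false)) uw.
have mkU (u : C) : unitc u -> unit_quat (Quat (complex.Re u) (complex.Im u) 0 0).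
  by move=> uu; apply/eqP; rewrite -[RHS]uu /=; ring.
exists (Sub _ (mkU _ uw)), (Sub _ (mkU _ ub)); split=> //.
have uf := uz false; have zf0 := unitc_neq0 uf.
apply/funext => t.
have E1 : (z false)^-1 = Complex (complex.Re (z false)) (- complex.Im (z false)).
  by case: (z false) uf => x y u; rewrite /GRing.inv /= u !divr1.
case: t; last first.
  rewrite /rot_c /= E1; move: uw uf; rewrite /unitc.
  case: w {ww ub} => x y; case: (z false) {E1} => p q /= uw uf.
  have E3 := uw; congr Complex.
    transitivity (p * (x ^+ 2 + y ^+ 2)); last by rewrite uw mulr1.
    ring.
  transitivity (q * (x ^+ 2 + y ^+ 2)); last by rewrite uw mulr1.
  ring.
have -> : z true = w * ((z false)^-1 * w).
  by rewrite mulrCA -expr2 ww mulKf.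
rewrite /rot_c /=; case: w {uw ww ub} => x y; case: (_^-1) => p q.
by apply/eqP; rewrite eq_complex /=; apply/andP; split; apply/eqP; ring.
Qed.

Lemma Sp1_4M (a b c d a' b' c' d' : Sp1 R) :
  ((a, b, c, d) * (a', b', c', d') : Sp1_4 R)%g =
  (a * a', b * b', c * c', d * d')%g.
Proof. by []. Qed.

(** The matrices of x -> i x i^-1, x -> j x j^-1 and -1 generate all diagonal
    sign matrices of determinant one on the quaternions; -1 on the second
    block alone is obtained from an element of Z, which changes the sign of a. *)
Lemma F10_real d : dgood d -> exists2 M, F10 R (Ad M) & Mdiag iota10 M d.
Proof.
move=> [z [eps [uz e0 ->]]]; have [a [b [Ua Ub <-]]] := rot_c_onto uz.
pose dl := eps (inord 0).
pose e1 := eps (inord 0) (+) eps (inord 1); pose e2 := eps (inord 0) (+) eps (inord 2).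
pose q := (opt e2 i * (opt e1 j * 1))%g; pose md := opt dl m.
have Q : sgn (lr q (opt e2 i * (opt e1 j * md))%g) eps.
  rewrite !lr_morphism.
  have Qi := sgn_opt e2 (@sgn_lr_ii R); have Qj := sgn_opt e1 (@sgn_lr_jj R).
  have Qd := sgn_opt dl (@sgn_lr_neg R).
  have optlr c (x y : Sp1 R) : lr (opt c x) (opt c y) = opt c (lr x y).
    by case: c => //=; rewrite lr1.
  have -> : lr 1%g md = opt dl (lr e m) by rewrite /md; case: (dl) => //=; rewrite lr1.
  rewrite !optlr; apply: sgn_eq (sgnM Qi (sgnM Qj Qd)) _ => k.
  move: e0; rewrite big_ord4 /dl /e1 /e2 -(inord_val k).
  by case: k => [[|[|[|[|]]]]] //= k4; rewrite !inordK //=;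
    case: (eps (inord 0)); case: (eps (inord 1)); case: (eps (inord 2));
    case: (eps (inord 3)).
have mm : (m * m)%g = e by apply/val_inj => /=; congr Quat; ring.
have mdmd : (md * md)%g = e by rewrite /md; case: (dl) => /=; rewrite ?mulg1.
have Umd : U1 md by rewrite /md; case: (dl).
have [Md _] := Mdiag10 Ua Ub Q.
exists (oblock (lr a b) (lr q (opt e2 i * (opt e1 j * md))%g) : orthG R 8) => //.
exists (a, b, opt e2 i * (opt e1 j * md), q)%g => //.
have -> : (a, b, opt e2 i * (opt e1 j * md), q)%g =
  ((a * md, b, e, e) * ((e, e, opt e2 i, opt e2 i) *
   ((e, e, opt e1 j, opt e1 j) * (md, e, md, e))) : Sp1_4 R)%g.
  rewrite !Sp1_4M !mul1g !mulg1 -?mulgA mdmd ?mulg1.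
  by rewrite /q mulg1.
apply: genM; last apply: genM; last apply: genM.
- by apply: sub_gen; left; left; exists (a * md)%g; [exact: U1M|exists b].
- have -> : (e, e, opt e2 i, opt e2 i) = opt e2 ((e, e, i, i) : Sp1_4 R) by case: (e2).
  by apply: gen_opt; apply: sub_gen; left; right; left.
- have -> : (e, e, opt e1 j, opt e1 j) = opt e1 ((e, e, j, j) : Sp1_4 R) by case: (e1).
  by apply: gen_opt; apply: sub_gen; left; right; right.
have -> : (md, e, md, e) = opt dl ((m, e, m, e) : Sp1_4 R) by rewrite /md; case: (dl).
by apply: gen_opt; apply: sub_gen; right; apply: sub_gen; left; right.
Qed.

Lemma F10_card : [set: weyl (F10 R)] #= `I_(3 * 2 ^ 6)%N.
Proof.
have := diagonal_card iota10_bij F10_torlike F10_real true.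
by rewrite !card_bool !card_ord; exact.
Qed.

End F10.

(** * The group F_12 *)

Section F12.
Variable R : realType.

(** The plane of the first block, and the six coordinate vectors of the second
    one. *)
Definition iota12 (p : unit * bool + 'I_6) : 'I_8 :=
  match p with
  | inl (_, s) => lshift 6 (if s then inord 1 else inord 0 : 'I_2)
  | inr b => rshift 2 b
  end.

Lemma iota12_bij : bijective iota12.
Proof.
apply: inj_card_bij; last by rewrite card_sum card_prod card_unit !card_bool !card_ord.
move=> [[[] s]|b] [[[] t]|e] /=.
- move=> E; have {E} := congr1 val (@lshift_inj 2 6 _ _ E).
  by case: s; case: t; rewrite /= ?inordK.
- by move=> /eqP; rewrite (@eq_lrshift 2 6).
- by move=> /eqP; rewrite (@eq_rlshift 2 6).
by move=> E; rewrite (@rshift_inj 2 6 _ _ E).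
Qed.

Lemma det2E (A : 'M[R]_2) : \det A = A 0 0 * A 1 1 - A 0 1 * A 1 0.
Proof.
rewrite (expand_det_row _ 0) !big_ord_recl big_ord0 /cofactor !det_mx11 !mxE /=.
rewrite expr0 expr1 mul1r addr0 mulN1r mulrN.
by congr (_ * A _ _ - A _ _ * A _ _); apply/val_inj.
Qed.

Lemma SO2_col (A : orthG R 2) : SO A ->
  exists x y : R, [/\ x ^+ 2 + y ^+ 2 = 1,
    val A *m delta_mx (inord 0) 0 =
      x *: delta_mx (inord 0) 0 + y *: (delta_mx (inord 1) 0 : 'cV[R]_2)
  & val A *m delta_mx (inord 1) 0 =
      - y *: delta_mx (inord 0) 0 + x *: (delta_mx (inord 1) 0 : 'cV[R]_2)].
Proof.
have e0 : inord 0 = 0 :> 'I_2 by apply/val_inj; rewrite /= inordK.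
have e1 : inord 1 = 1 :> 'I_2 by apply/val_inj; rewrite /= inordK.
rewrite /SO /mkset det2E => det1; have /matrixP AA := orthG_mulT A.
have := AA 0 0; have := AA 0 1; have := AA 1 1.
rewrite !mxE !big_ord_recl !big_ord0 !mxE /= mulr1n mulr0n !addr0.
have -> : lift ord0 ord0 = 1 :> 'I_2 by apply/val_inj.
move: det1; have E2 i j : val A i j = sval A i j by [].
have colE i : val A *m delta_mx i 0 =
    val A 0 i *: delta_mx 0 0 + val A 1 i *: (delta_mx 1 0 : 'cV[R]_2).
  apply/colP => j; rewrite -colE !mxE !andbT.
  by case: j => [[|[|]]] //= j2; rewrite ?mulr1 ?mulr0 ?addr0 ?add0r; congr (sval A _ _); apply/val_inj.
rewrite e0 e1 !colE !E2; move: (sval A 0 0) (sval A 0 1) (sval A 1 0) (sval A 1 1).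
move=> a b c d det1 cd ac ab.
have ad : d = a.
  transitivity (d * (a * a + b * b)); first by rewrite ab mulr1.
  transitivity (a * (a * d - b * c) + b * (a * c + b * d)); first by ring.
  by rewrite det1 ac mulr1 mulr0 addr0.
have cb : b = - c.
  transitivity (- (c * (a * a + b * b))); last by rewrite ab mulr1.
  transitivity (b * (a * d - b * c) - a * (a * c + b * d)); last by ring.
  by rewrite det1 ac mulr1 mulr0 subr0.
exists a, c; split=> //; last by rewrite ad cb.
by rewrite -ab cb; ring.
Qed.

Lemma torlike12 (A : orthG R 2) (Q : orthG R 6) eps : SO A -> sgn Q eps ->
  exists2 z, unitc z & Mdiag iota12 (oblock A Q : orthG R 8) (char (fun _ => z) eps).
Proof.
move=> /SO2_col[x [y [xy1 A0 A1]]] Qe; exists (Complex x y) => //.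
apply: (Mdiag_rot (x := fun=> x) (y := fun=> y)) => [t|t|e|t] //.
- exact: (@oblock_rot R 2 6).
- exact: (@oblock_rot R 2 6).
exact: (@oblock_sgn R 2 6).
Qed.

Definition even_sgn (Q : orthG R 6) : Prop :=
  exists2 eps, sgn Q eps & \big[addb/false]_k eps k = false.

Lemma even_sgn_subgroup : is_subgroup even_sgn.
Proof.
split=> [|B B' [e Be e0] [e' Be' e0']].
  by exists (fun=> false); [exact: sgn1|rewrite big1].
exists (fun k => e k (+) e' k); first exact: sgnM (sgnV Be').
by rewrite big_split /= e0 e0'.
Qed.

Lemma big_ord6 (f : 'I_6 -> bool) : \big[addb/false]_k f k =
  f (inord 0) (+) f (inord 1) (+) f (inord 2) (+) f (inord 3) (+) f (inord 4) (+) f (inord 5).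
Proof.
rewrite !big_ord_recl big_ord0 addbF !addbA.
by do ![congr (_ (+) _) || congr f]; apply/val_inj; rewrite /= ?inordK.
Qed.

Lemma sgn_Ipq p q (h : 'I_(p + q) -> bool) :
  (forall k : 'I_(p + q), h k = (k < p)%N) -> sgn (Ipq R p q) h.
Proof.
move=> hE; apply: sgn_oblock (@sgn_oneg R p) (@sgn1 R q) _ _ => k.
  by rewrite hE /= ltn_ord.
by rewrite hE /= ltnNge leq_addr.
Qed.

Lemma sgn_g1 : sgn (Ipq R 2 4 : orthG R 6) (fun k : 'I_6 => (k < 2)%N).
Proof. exact: (@sgn_Ipq 2 4). Qed.

Lemma sgn_g2 : sgn (Ipq R 4 2 : orthG R 6) (fun k : 'I_6 => (k < 4)%N).
Proof. exact: (@sgn_Ipq 4 2). Qed.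

Lemma sgn_g3 :
  sgn (oblock (Ipq R 1 1) (oblock (Ipq R 1 1) (1%g : orthG R 2)) : orthG R 6)
    (fun k : 'I_6 => (k == 0 :> nat) || (k == 2 :> nat)).
Proof.
have S := @sgn_Ipq 1 1 (fun k => (k < 1)%N) (fun=> erefl).
apply: (@sgn_oblock R 2 4 _ _ _ _ _ S) => [|k|k].
- by apply: (@sgn_oblock R 2 2 _ _ _ _ (fun k => k == 0 :> nat) S (@sgn1 R 2)) => -[[|[|]]].
- by case: k => [[|[|]]].
by [].
Qed.

Lemma sgn_g4 :
  sgn (oblock (1%g : orthG R 2) (oblock (Ipq R 1 1) (Ipq R 1 1)) : orthG R 6)
    (fun k : 'I_6 => (k == 2 :> nat) || (k == 4 :> nat)).
Proof.
have S := @sgn_Ipq 1 1 (fun k => (k < 1)%N) (fun=> erefl).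
apply: (@sgn_oblock R 2 4 _ _ _ _ _ (@sgn1 R 2)) => [|k|k].
- by apply: (@sgn_oblock R 2 2 _ _ _ _ (fun k => (k == 0 :> nat) || (k == 2 :> nat)) S S) => -[[|[|]]].
- by case: k => [[|[|]]].
by [].
Qed.

Lemma F12_gen_even : gen (@F12_gen R) `<=` even_sgn.
Proof.
apply: gen_min; first exact: even_sgn_subgroup.
move=> B [[[->|->]|->]|->].
- by exists (fun k : 'I_6 => (k < 2)%N); [exact: sgn_g1|rewrite big_ord6 !inordK].
- by exists (fun k : 'I_6 => (k < 4)%N); [exact: sgn_g2|rewrite big_ord6 !inordK].
- by exists (fun k : 'I_6 => (k == 0 :> nat) || (k == 2 :> nat));
    [exact: sgn_g3|rewrite big_ord6 !inordK].
- by exists (fun k : 'I_6 => (k == 2 :> nat) || (k == 4 :> nat));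
    [exact: sgn_g4|rewrite big_ord6 !inordK].
Qed.

Lemma F12_torlike x : F12 R x -> torlike iota12 x.
Proof.
move=> [A SA [B /F12_gen_even[eps Be e0] <-]].
have [z uz Md] := torlike12 SA Be.
exists (oblock A B : orthG R 8), (char (fun=> z) eps); split=> //.
by exists (fun=> z), eps.
Qed.

Lemma Ad_oneg (M : orthG R 8) : Ad (M * oneg R 8)%g = Ad M.
Proof.
apply: lie_aut_ext => X; apply/val_inj; rewrite /=.
by rewrite mulmxN mulmx1 linearN /= mulNmx mulmxN mulNmx opprK.
Qed.

(** The four generators span the even sign matrices with last sign 1, which
    have index two among all even ones; the others are obtained from these by
    multiplying with -1 on the whole space, which acts trivially on so(8). *)
Lemma F12_onto (eps : 'I_6 -> bool) : \big[addb/false]_k eps k = false ->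
  eps (inord 5) = false -> exists2 B, gen (@F12_gen R) B & sgn B eps.
Proof.
move=> e0 e5.
pose c4 := eps (inord 4); pose c3 := eps (inord 0) (+) eps (inord 1).
pose c1 := eps (inord 1) (+) eps (inord 3); pose c2 := eps (inord 3).
have S := sgnM (sgn_opt c1 sgn_g1) (sgnM (sgn_opt c2 sgn_g2)
  (sgnM (sgn_opt c3 sgn_g3) (sgn_opt c4 sgn_g4))).
eexists; last first.
  apply: sgn_eq S _ => k; move: e0 e5; rewrite big_ord6 /c1 /c2 /c3 /c4 -(inord_val k).
  by case: k => [[|[|[|[|[|[|]]]]]]] //= k6; rewrite !inordK //=;
    case: (eps (inord 0)); case: (eps (inord 1)); case: (eps (inord 2));
    case: (eps (inord 3)); case: (eps (inord 4)); case: (eps (inord 5)).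
apply: genM; last apply: genM; last apply: genM; apply: gen_opt; apply: sub_gen.
- by left; left; left.
- by left; left; right.
- by left; right.
by right.
Qed.

Definition rot2_mx (x y : R) : 'M[R]_2 :=
  \matrix_(i, j) (if i == j then x else if i == 0 then - y else y).

Lemma rot2_SO (x y : R) : x ^+ 2 + y ^+ 2 = 1 ->
  exists2 A : orthG R 2, SO A & val A = rot2_mx x y.
Proof.
move=> xy1.
have oA : orth (rot2_mx x y).
  apply/eqP/matrixP => i j; rewrite !mxE !big_ord_recl big_ord0 !mxE.
  by case: i => [[|[|]]] //= ?; case: j => [[|[|]]] //= ?; rewrite -?xy1; ring.
exists (Sub _ oA) => //; rewrite /SO /mkset /=.
rewrite det2E !mxE /=.
by rewrite -xy1; ring.
Qed.

Lemma F12_real d : dgood d -> exists2 M, F12 R (Ad M) & Mdiag iota12 M d.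
Proof.
move=> [z [eps [uz e0 ->]]].
pose s := eps (inord 5).
have [|B gB Be] := @F12_onto (fun k => eps k (+) s) _ (addbb s).
  by move: e0; rewrite !big_ord6; case: s; case: (eps (inord 0));
    case: (eps (inord 1)); case: (eps (inord 2)); case: (eps (inord 3));
    case: (eps (inord 4)); case: (eps (inord 5)).
pose w := (-1) ^+ s * z tt.
have uw : unitc w.
  rewrite /w; apply: unitcM; last exact: uz.
  by case: (s); rewrite /unitc ?expr0 ?expr1 /=; ring.
have [A SA EA] := rot2_SO uw.
have [x [y [xy1 A0 A1]]] := SO2_col SA.
have M0d : Mdiag iota12 (oblock A B : orthG R 8) (char (fun=> w) (fun k => eps k (+) s)).
  have Ew : (fun _ : unit => w) = (fun=> Complex (complex.Re w) (complex.Im w)).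
    by apply/funext => _; case: (w).
  rewrite Ew.
  apply: (Mdiag_rot (x := fun=> complex.Re w) (y := fun=> complex.Im w)) => [t|t|e|t] //.
  - apply: (@oblock_rot R 2 6); rewrite EA; apply/colP => k.
    rewrite -colE !mxE -!val_eqE /= !inordK //.
    by case: k => [[|[|]]] //= _; ring.
  - apply: (@oblock_rot R 2 6); rewrite EA; apply/colP => k.
    rewrite -colE !mxE -!val_eqE /= !inordK //.
    by case: k => [[|[|]]] //= _; ring.
  exact: (@oblock_sgn R 2 6 _ _ (fun k => eps k (+) s)).
have Nd : Mdiag iota12 (oneg R 8) (fun=> -1).
  by move=> p; rewrite /= map_mxN map_mx1 mulNmx mul1mx scaleN1r.
have -> : char z eps = (fun p => char (fun=> w) (fun k => eps k (+) s) p * (-1) ^+ s).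
  apply/funext => -[[[] u]|b]; rewrite /= /w; last first.
    by rewrite signr_addb -mulrA -expr2 sqrr_sign mulr1.
  by case: u; rewrite ?invfM ?invr_sign mulrAC -expr2 sqrr_sign mul1r.
move: M0d; case: (s) => M0d.
  exists (oblock A B * oneg R 8 : orthG R 8)%g; last exact: Mdiag_mul.
  by rewrite Ad_oneg; exists A => //; exists B.
exists (oblock A B : orthG R 8); first by exists A => //; exists B.
by move=> p; rewrite M0d expr0 mulr1.
Qed.

(** Permutations are multiplied from left to right and automorphisms from
    right to left, whence the inverse. *)
Lemma F12_iso : isomorphic (weyl (F12 R)) ('S_6 * pm1)%type.
Proof.
have B3 : (2 < #|'I_6|)%N by rewrite card_ord.
have [f [f_bij fM]] := diagonal_weyl iota12_bij F12_torlike F12_real tt B3.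
pose sg (b : bool) : pm1 := if b then Sub (-1) isT else Sub 1 isT.
pose h (t : {perm unit} * {ffun unit -> bool} * {perm 'I_6}) : 'S_6 * pm1 :=
  ((t.2)^-1%g, sg (t.1.2 tt)).
exists (h \o f).
  apply: bij_comp => //.
  exists (fun u : 'S_6 * pm1 =>
    (1%g, [ffun=> val u.2 == -1], (u.1)^-1%g) : {perm unit} * {ffun unit -> bool} * {perm 'I_6}).
  - move=> [[al e] p]; rewrite /h /= invgK; congr (_, _, _).
      by apply/permP => -[]; case: (al tt); rewrite perm1.
    by apply/ffunP => -[]; rewrite ffunE; case: (e tt).
  - move=> [p s]; rewrite /h /= invgK ffunE; congr (_, _).
    by apply/val_inj; case: s => s /= /orP[] /eqP ->.
move=> v w; have E := fM v w; rewrite /h /=; congr (_, _).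
  rewrite -[RHS]invMg; congr (_^-1)%g; apply/permP => k; rewrite permM.
  by have [] := E (tt, false, k).
have [_] := E (tt, false, ord0); case: (f _) (f _) (f _) => [[a e] p] [[a1 e1] p1] [[a2 e2] p2] /=.
move=> -> _; case: (a1 tt); rewrite /sg.
by case: (e tt); case: (e1 tt); apply/val_inj; rewrite /= ?mulr1 ?mul1r ?mulrNN ?mulr1.
Qed.

End F12.

(** * The outer automorphism exchanging the second and third copies of sp(1) *)

Section Triality.
Variable R : realType.

(** Right multiplication by the conjugate of a on the quaternions. *)
Definition right_mx (a : quat R) : 'M[R]_4 := lr_mx (Quat 1 0 0 0) a.

(** The sum of the conjugations by the right multiplications by i, j, k.  On
    so(4) = sp(1) + sp(1) it acts by 3 on the left factor and by -1 on the
    right one, so that the projections onto the two factors are polynomials in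
    it. *)
Definition Phi (S : 'M[R]_4) : 'M[R]_4 := locked (
  right_mx (Quat 0 1 0 0) *m S *m (right_mx (Quat 0 1 0 0))^T +
  right_mx (Quat 0 0 1 0) *m S *m (right_mx (Quat 0 0 1 0))^T +
  right_mx (Quat 0 0 0 1) *m S *m (right_mx (Quat 0 0 0 1))^T).

Lemma Phi_sum S : Phi S =
  right_mx (Quat 0 1 0 0) *m S *m (right_mx (Quat 0 1 0 0))^T +
  right_mx (Quat 0 0 1 0) *m S *m (right_mx (Quat 0 0 1 0))^T +
  right_mx (Quat 0 0 0 1) *m S *m (right_mx (Quat 0 0 0 1))^T.
Proof. by rewrite /Phi -lock. Qed.

Lemma Phi_is_linear : linear Phi.
Proof.
have L a c S T : right_mx a *m (c *: S + T) *m (right_mx a)^T =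
    c *: (right_mx a *m S *m (right_mx a)^T) + right_mx a *m T *m (right_mx a)^T.
  by rewrite mulmxDr mulmxDl -scalemxAr -scalemxAl.
by move=> c S T; rewrite !Phi_sum !L !scalerDr; apply/matrixP => i j; rewrite !mxE; ring.
Qed.
HB.instance Definition _ := GRing.isLinear.Build R 'M[R]_4 'M[R]_4 _ Phi Phi_is_linear.

Definition phi (s : nat -> nat -> R) (m n : nat) : R :=
  let sg (l : seq R) := l`_m * l`_n in
  let nx (l : seq nat) := s (nth 0 l m)%N (nth 0 l n)%N in
  sg [:: 1; -1; -1; 1] * nx [:: 1; 0; 3; 2]%N +
  sg [:: 1; 1; -1; -1] * nx [:: 2; 3; 0; 1]%N +
  sg [:: 1; -1; 1; -1] * nx [:: 3; 2; 1; 0]%N.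

Lemma PhiE (s : nat -> nat -> R) :
  Phi (\matrix_(i, j) s i j) = \matrix_(i, j) phi s i j.
Proof.
apply/matrixP => i j; rewrite Phi_sum /phi !mxE.
rewrite !big_ord_recl !big_ord0 !mxE !big_ord_recl !big_ord0 !mxE /=.
case: i => [[|[|[|[|]]]]] //= ?; case: j => [[|[|[|[|]]]]] //= ?; rewrite /bump /=; ring.
Qed.

Lemma PhiD S T : Phi (S + T) = Phi S + Phi T. Proof. exact: linearD. Qed.
Lemma PhiN S : Phi (- S) = - Phi S. Proof. exact: linearN. Qed.
Lemma PhiZ c S : Phi (c *: S) = c *: Phi S. Proof. exact: linearZ. Qed.

Lemma Phi_tr S : (Phi S)^T = Phi S^T.
Proof. by rewrite !Phi_sum !linearD /= !trmx_mul !trmxK !mulmxA. Qed.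

Lemma mat4P (S : 'M[R]_4) : exists s : nat -> nat -> R, S = \matrix_(i, j) s i j.
Proof.
exists (fun i j => S (inord i) (inord j)).
by apply/matrixP => i j; rewrite !mxE !inord_val.
Qed.

(** The eigenvalues of Phi are 3 and -1. *)
Lemma PhiPhi S : Phi (Phi S) = 3 *: S + 2 *: Phi S.
Proof.
have [s ->] := mat4P S; rewrite !PhiE.
apply/matrixP => i j; rewrite !mxE /phi.
by case: i => [[|[|[|[|]]]]] //= ?; case: j => [[|[|[|[|]]]]] //= ?; ring.
Qed.

Definition lpart (S : 'M[R]_4) : 'M[R]_4 := locked (4^-1 *: (S + Phi S)).
Lemma lpartE S : lpart S = 4^-1 *: (S + Phi S).
Proof. by rewrite /lpart -lock. Qed.

Definition rpart (S : 'M[R]_4) : 'M[R]_4 := locked (4^-1 *: (3 *: S - Phi S)).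
Lemma rpartE S : rpart S = 4^-1 *: (3 *: S - Phi S).
Proof. by rewrite /rpart -lock. Qed.

(** On the off-diagonal block the four copies of sp(1) act through the
    quaternions tensored with the quaternions.  As a representation of four
    copies of SU(2) its complexification is the tensor product of the standard
    ones, and this involution exchanges the second and third tensor factors. *)
Definition swap23 (S : 'M[R]_4) : 'M[R]_4 := locked (2^-1 *: (S - Phi S)).
Lemma swap23E S : swap23 S = 2^-1 *: (S - Phi S).
Proof. by rewrite /swap23 -lock. Qed.

Lemma lpart_tr S : (lpart S)^T = lpart S^T.
Proof. by rewrite !lpartE linearZ /= linearD /= Phi_tr. Qed.

Lemma rpart_tr S : (rpart S)^T = rpart S^T.
Proof. by rewrite !rpartE linearZ /= linearB /= linearZ /= Phi_tr. Qed.

Lemma lpartN S : lpart (- S) = - lpart S.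
Proof. by rewrite !lpartE PhiN -opprD scalerN. Qed.

Lemma rpartN S : rpart (- S) = - rpart S.
Proof. by rewrite !rpartE PhiN scalerN -opprD scalerN. Qed.

Lemma swap23K S : swap23 (swap23 S) = S.
Proof.
rewrite !swap23E PhiZ PhiD PhiN PhiPhi.
by apply/matrixP => i j; rewrite !mxE; field.
Qed.

Lemma lrpart S T : lpart (lpart S + rpart T) + rpart (lpart T + rpart S) = S.
Proof.
rewrite !(lpartE, rpartE) !(PhiD, PhiN, PhiZ, PhiPhi).
by apply/matrixP => i j; rewrite !mxE; field.
Qed.

(** On the diagonal blocks the right factor of the first block is exchanged
    with the right factor of the second block. *)
Definition sigma_mx (X : 'M[R]_(4 + 4)) : 'M[R]_(4 + 4) :=
  block_mx (lpart (ulsubmx X) + rpart (drsubmx X)) (swap23 (ursubmx X))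
    (- (swap23 (ursubmx X))^T) (lpart (drsubmx X) + rpart (ulsubmx X)).

Lemma skew_blocks (X : so R 8) :
  let Y : 'M[R]_(4 + 4) := val X in
  [/\ (ulsubmx Y)^T = - ulsubmx Y, (drsubmx Y)^T = - drsubmx Y
    & dlsubmx Y = - (ursubmx Y)^T].
Proof.
have /eqP EX := valP X; move=> Y; have {}EX : Y^T = - Y := EX.
rewrite trmx_ulsub trmx_drsub trmx_ursub EX.
by split; apply/matrixP => i j; rewrite !mxE ?opprK.
Qed.

Lemma sigma_skew (X : so R 8) : skew (sigma_mx (val X)).
Proof.
have [EA ED _] := skew_blocks X.
apply/eqP; rewrite /sigma_mx tr_block_mx opp_block_mx linearN /= trmxK opprK.
by congr block_mx; rewrite linearD /= lpart_tr rpart_tr EA ED lpartN rpartN -opprD.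
Qed.

Definition sigma_fun (X : so R 8) : so R 8 := Sub _ (sigma_skew X).

Lemma sigma_mxK (Y : 'M[R]_(4 + 4)) :
  dlsubmx Y = - (ursubmx Y)^T -> sigma_mx (sigma_mx Y) = Y.
Proof.
move=> EY; rewrite -[RHS]submxK EY /sigma_mx block_mxKul block_mxKur block_mxKdr.
congr block_mx; [exact: lrpart|exact: swap23K| |exact: lrpart].
by congr (- _^T); exact: swap23K.
Qed.

Lemma sigmaK : involutive sigma_fun.
Proof.
by move=> X; apply/val_inj; have [_ _ EX] := skew_blocks X; exact: sigma_mxK.
Qed.

End Triality.

Section TrialityBracket.
Variable R : realType.
Implicit Types S T B : 'M[R]_4.

Local Notation Ri := (right_mx (Quat 0 1 0 0 : quat R)).
Local Notation Rj := (right_mx (Quat 0 0 1 0 : quat R)).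
Local Notation Rk := (right_mx (Quat 0 0 0 1 : quat R)).
(** The Frobenius inner product, used to turn identities for the part of the
    bracket of two off-diagonal matrices into identities for the action of the
    diagonal part. *)
Definition fm (S T : 'M[R]_4) : R := \tr (S *m T^T).

Lemma right_mxM a b : right_mx a *m right_mx b = right_mx (qmul a b) :> 'M[R]_4.
Proof. by rewrite /right_mx lr_mxM qmul1. Qed.

Lemma right_mxN (a b c : R) : right_mx (Quat 0 (- a) (- b) (- c)) = - right_mx (Quat 0 a b c).
Proof.
apply/matrixP => i j; rewrite !mxE.
by case: i => [[|[|[|[|]]]]] //= _; ring.
Qed.

Lemma right_mxT a b c : (right_mx (Quat 0 a b c))^T = - right_mx (Quat 0 a b c) :> 'M[R]_4.
Proof.
apply/matrixP => i j; rewrite !mxE.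
by case: i => [[|[|[|[|]]]]] //= _; case: j => [[|[|[|[|]]]]] //= _; ring.
Qed.

Lemma right_mx1 : right_mx (Quat (-1) 0 0 0) = - 1%:M :> 'M[R]_4.
Proof.
apply/matrixP => i j; rewrite !mxE -!val_eqE.
by case: i => [[|[|[|[|]]]]] //= _; case: j => [[|[|[|[|]]]]] //= _; ring.
Qed.

Lemma right_rel : [/\ [/\ Ri *m Ri = - 1%:M, Rj *m Rj = - 1%:M & Rk *m Rk = - 1%:M],
  [/\ Ri *m Rj = Rk, Rj *m Rk = Ri & Rk *m Ri = Rj] &
  [/\ Rj *m Ri = - Rk, Rk *m Rj = - Ri & Ri *m Rk = - Rj]].
Proof.
split; split; rewrite right_mxM -?right_mx1 -?right_mxN /=; congr right_mx; congr Quat; ring.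
Qed.

Lemma PhiEN S : Phi S = - (Ri *m S *m Ri) - Rj *m S *m Rj - Rk *m S *m Rk.
Proof. by rewrite Phi_sum !right_mxT !mulmxN. Qed.

Lemma Phi_right S :
  [/\ Phi (Ri *m S) = S *m Ri + Rk *m S *m Rj - Rj *m S *m Rk,
      Phi (Rj *m S) = S *m Rj + Ri *m S *m Rk - Rk *m S *m Ri
    & Phi (Rk *m S) = S *m Rk + Rj *m S *m Ri - Ri *m S *m Rj].
Proof.
have [[ii jj kk] [ij jk ki] [ji kj ik]] := right_rel.
split; rewrite PhiEN !mulmxA ?ii ?jj ?kk ?ij ?jk ?ki ?ji ?kj ?ik ?mulNmx ?mul1mx ?opprK;
  apply/matrixP => a b; rewrite !mxE; ring.
Qed.

(** The Lie algebra of right multiplications by imaginary quaternions. *)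
Definition Rspan (S : 'M[R]_4) : Prop :=
  exists r s t : R, S = r *: Ri + s *: Rj + t *: Rk.

Lemma swap_Ri B : swap23 (Ri *m B) = - (swap23 B *m Ri).
Proof.
have [[ii jj kk] [ij jk ki] [ji kj ik]] := right_rel.
have [E _ _] := Phi_right B; rewrite !swap23E E -scalemxAl mulmxBl PhiEN !mulmxDl !mulNmx.
rewrite -!mulmxA ii ji ki !(mulmxN, mulmx1) !mulmxA.
apply/matrixP => a b; rewrite !mxE; ring.
Qed.

Lemma swap_Rj B : swap23 (Rj *m B) = - (swap23 B *m Rj).
Proof.
have [[ii jj kk] [ij jk ki] [ji kj ik]] := right_rel.
have [_ E _] := Phi_right B; rewrite !swap23E E -scalemxAl mulmxBl PhiEN !mulmxDl !mulNmx.
rewrite -!mulmxA jj ij kj !(mulmxN, mulmx1) !mulmxA.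
apply/matrixP => a b; rewrite !mxE; ring.
Qed.

Lemma swap_Rk B : swap23 (Rk *m B) = - (swap23 B *m Rk).
Proof.
have [[ii jj kk] [ij jk ki] [ji kj ik]] := right_rel.
have [_ _ E] := Phi_right B; rewrite !swap23E E -scalemxAl mulmxBl PhiEN !mulmxDl !mulNmx.
rewrite -!mulmxA kk ik jk !(mulmxN, mulmx1) !mulmxA.
apply/matrixP => a b; rewrite !mxE; ring.
Qed.

Lemma swapD S T : swap23 (S + T) = swap23 S + swap23 T.
Proof. by rewrite !swap23E PhiD opprD addrACA scalerDr. Qed.

Lemma swapN S : swap23 (- S) = - swap23 S.
Proof. by rewrite !swap23E PhiN -opprD scalerN. Qed.

Lemma swapZ c S : swap23 (c *: S) = c *: swap23 S.
Proof. by rewrite !swap23E PhiZ -scalerBr !scalerA mulrC. Qed.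

Lemma swap_tr S : (swap23 S)^T = swap23 S^T.
Proof. by rewrite !swap23E linearZ /= linearB /= Phi_tr. Qed.

(** The involution of the off-diagonal part intertwines the two right actions. *)
Lemma swap_span S B : Rspan S -> swap23 (S *m B) = - (swap23 B *m S).
Proof.
move=> [r [s [t ->]]].
have -> : swap23 ((r *: Ri + s *: Rj + t *: Rk) *m B) =
    - (r *: (swap23 B *m Ri) + s *: (swap23 B *m Rj) + t *: (swap23 B *m Rk)).
  rewrite !mulmxDl -!scalemxAl !swapD !swapZ swap_Ri swap_Rj swap_Rk.
  by rewrite !scalerN !opprD.
by move: (swap23 B) => W; rewrite !mulmxDr -!scalemxAr.
Qed.

Lemma swap_span' S B : Rspan S -> swap23 (B *m S) = - (S *m swap23 B).
Proof.
move=> RS; have := congr1 (@swap23 _) (swap_span (swap23 B) RS).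
rewrite !swap23K swapN => ->.
by rewrite opprK.
Qed.

(** The commutant of the right multiplications, that is the left
    multiplications. *)
Definition Lcomm (S : 'M[R]_4) : Prop :=
  [/\ S *m Ri = Ri *m S, S *m Rj = Rj *m S & S *m Rk = Rk *m S].

Lemma Lcomm_span S T : Lcomm S -> Rspan T -> S *m T = T *m S.
Proof.
move=> [Si Sj Sk] [r [s [t ->]]].
by rewrite !mulmxDl !mulmxDr -!scalemxAl -!scalemxAr Si Sj Sk.
Qed.

Lemma LcommM S T : Lcomm S -> Lcomm T -> Lcomm (S *m T).
Proof.
move=> [Si Sj Sk] [Ti Tj Tk].
by split; rewrite -mulmxA ?Ti ?Tj ?Tk mulmxA ?Si ?Sj ?Sk mulmxA.
Qed.

Lemma LcommB S T : Lcomm S -> Lcomm T -> Lcomm (S - T).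
Proof.
move=> [Si Sj Sk] [Ti Tj Tk].
by split; rewrite mulmxBl mulmxBr ?Si ?Sj ?Sk ?Ti ?Tj ?Tk.
Qed.

Lemma lpart_Lcomm S : Lcomm (lpart S).
Proof.
have [[ii jj kk] [ij jk ki] [ji kj ik]] := right_rel.
rewrite !lpartE; split; rewrite -scalemxAl -scalemxAr; congr (_ *: _);
  rewrite PhiEN !(mulmxDl, mulmxDr, mulNmx, mulmxN) -!mulmxA ?(ii, jj, kk, ij, jk, ki, ji, kj, ik)
    !mulmxA ?(ii, jj, kk, ij, jk, ki, ji, kj, ik) !(mulmxN, mulNmx, mulmx1, mul1mx);
  apply/matrixP => a b; rewrite !mxE; ring.
Qed.

Lemma PhiL S : Lcomm S -> Phi S = 3 *: S.
Proof.
have [[ii jj kk] _ _] := right_rel; move=> [Si Sj Sk].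
rewrite PhiEN -!mulmxA Si Sj Sk !mulmxA ii jj kk !mulNmx !mul1mx.
apply/matrixP => a b; rewrite !mxE; ring.
Qed.

Lemma PhiR S : Rspan S -> Phi S = - S.
Proof.
have [[ii jj kk] [ij jk ki] [ji kj ik]] := right_rel.
move=> [r [s [t ->]]]; rewrite !PhiD !PhiZ !PhiEN.
rewrite ?(ii, jj, kk, ij, jk, ki, ji, kj, ik) !mulNmx !mul1mx ?(ii, jj, kk, ij, jk, ki, ji, kj, ik).
apply/matrixP => a b; rewrite !mxE; ring.
Qed.

Lemma lpartL S : Lcomm S -> lpart S = S.
Proof.
by move=> /PhiL E; rewrite !lpartE E; apply/matrixP => a b; rewrite !mxE; field.
Qed.

Lemma rpartR S : Rspan S -> rpart S = S.
Proof.
by move=> /PhiR E; rewrite !rpartE E; apply/matrixP => a b; rewrite !mxE; field.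
Qed.

Lemma rpartL S : Lcomm S -> rpart S = 0.
Proof. by move=> /PhiL E; rewrite !rpartE E subrr scaler0. Qed.

Lemma lpartR S : Rspan S -> lpart S = 0.
Proof. by move=> /PhiR E; rewrite !lpartE E subrr scaler0. Qed.

Lemma lr_part S : S = lpart S + rpart S.
Proof. by rewrite !(lpartE, rpartE); apply/matrixP => a b; rewrite !mxE; field. Qed.

Lemma lpartD S T : lpart (S + T) = lpart S + lpart T.
Proof. by rewrite !lpartE PhiD addrACA scalerDr. Qed.

Lemma rpartD S T : rpart (S + T) = rpart S + rpart T.
Proof. by rewrite !rpartE PhiD [3 *: (_ + _)]scalerDr opprD addrACA scalerDr. Qed.

Lemma lpartB S T : lpart (S - T) = lpart S - lpart T.
Proof. by rewrite lpartD lpartN. Qed.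

Lemma rpartB S T : rpart (S - T) = rpart S - rpart T.
Proof. by rewrite rpartD rpartN. Qed.

Lemma Rspan_bracket S T : Rspan S -> Rspan T -> Rspan (S *m T - T *m S).
Proof.
have [[ii jj kk] [ij jk ki] [ji kj ik]] := right_rel.
move=> [r [s [t ->]]] [r' [s' [t' ->]]].
exists (2 * (s * t' - t * s')), (2 * (t * r' - r * t')), (2 * (r * s' - s * r')).
rewrite !(mulmxDl, mulmxDr) -!scalemxAl -!scalemxAr ?(ii, jj, kk, ij, jk, ki, ji, kj, ik).
apply/matrixP => a b; rewrite !mxE; ring.
Qed.

Lemma rpart_span S : S^T = - S -> Rspan (rpart S).
Proof.
move=> ES; pose s i j := S (inord i) (inord j).
have sE : S = \matrix_(i, j) s i j by apply/matrixP => i j; rewrite mxE /s !inord_val.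
have sN i j : s i j = - s j i by have /matrixP/(_ (inord j) (inord i)) := ES; rewrite !mxE.
have s0 i : s i i = 0.
  by apply/eqP; rewrite -[_ == 0](mulrn_eq0 _ 2) mulr2n {1}sN addNr.
exists (2^-1 * (s 0%N 1%N - s 2%N 3%N)), (2^-1 * (s 0%N 2%N + s 1%N 3%N)),
  (2^-1 * (s 0%N 3%N - s 1%N 2%N)).
rewrite !rpartE sE PhiE; apply/matrixP => i j; rewrite !mxE /phi.
by case: i => [[|[|[|[|]]]]] //= ?; case: j => [[|[|[|[|]]]]] //= ?;
  rewrite ?s0 ?(sN 1%N 0%N) ?(sN 2%N 0%N) ?(sN 3%N 0%N) ?(sN 2%N 1%N) ?(sN 3%N 1%N) ?(sN 3%N 2%N); field.
Qed.

Lemma swapL S B : Lcomm S -> swap23 (S *m B) = S *m swap23 B.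
Proof.
move=> [Si Sj Sk]; rewrite !swap23E -scalemxAr; congr (_ *: _).
rewrite mulmxBr; congr (_ - _); rewrite !PhiEN !mulmxBr !mulmxN !mulmxA.
by rewrite Si Sj Sk.
Qed.

Lemma swapL' S B : Lcomm S -> swap23 (B *m S) = swap23 B *m S.
Proof.
move=> [Si Sj Sk]; rewrite !swap23E -scalemxAl; congr (_ *: _).
rewrite mulmxBl; congr (_ - _); rewrite !PhiEN !mulmxBl !mulNmx -!mulmxA.
by rewrite Si Sj Sk.
Qed.

Lemma fmC S T : fm S T = fm T S.
Proof. by rewrite /fm -mxtrace_tr trmx_mul trmxK. Qed.

Lemma fmD S T B : fm (S + T) B = fm S B + fm T B.
Proof. by rewrite /fm mulmxDl linearD. Qed.

Lemma fmN S B : fm (- S) B = - fm S B.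
Proof. by rewrite /fm mulNmx linearN. Qed.

Lemma fmZ c S B : fm (c *: S) B = c * fm S B.
Proof. by rewrite /fm -scalemxAl linearZ. Qed.

Lemma fmB S T B : fm (S - T) B = fm S B - fm T B.
Proof. by rewrite fmD fmN. Qed.

Lemma fm_mull S T B : fm (S *m T) B = fm T (S^T *m B).
Proof. by rewrite /fm -mulmxA mxtrace_mulC trmx_mul trmxK mulmxA. Qed.

Lemma fm_mulr S T B : fm (T *m S) B = fm T (B *m S^T).
Proof. by rewrite /fm trmx_mul trmxK mulmxA. Qed.

Lemma Phi_adj S T : fm (Phi S) T = fm S (Phi T).
Proof.
have E a b c : fm (right_mx (Quat 0 a b c) *m S *m right_mx (Quat 0 a b c)) T =
    fm (right_mx (Quat 0 a b c) *m T *m right_mx (Quat 0 a b c)) S.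
  by rewrite fm_mulr fm_mull right_mxT mulmxN mulNmx mulmxN opprK fmC mulmxA.
by rewrite [RHS]fmC !PhiEN !fmB !fmN !E.
Qed.

Lemma lpart_adj S T : fm (lpart S) T = fm S (lpart T).
Proof. by rewrite [RHS]fmC !lpartE !fmZ !fmD Phi_adj [fm T S]fmC [fm (Phi T) S]fmC. Qed.

Lemma rpart_adj S T : fm (rpart S) T = fm S (rpart T).
Proof.
by rewrite [RHS]fmC !rpartE !fmZ !fmB !fmZ Phi_adj [fm T S]fmC [fm (Phi T) S]fmC.
Qed.

Lemma swap_adj S T : fm (swap23 S) T = fm S (swap23 T).
Proof. by rewrite [RHS]fmC !swap23E !fmZ !fmB Phi_adj [fm T S]fmC [fm (Phi T) S]fmC. Qed.

Lemma fm_eq0 S : fm S S = 0 -> S = 0.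
Proof.
move=> E; apply/matrixP => i j; rewrite [RHS]mxE.
have sq_ge0 a b : 0 <= S a b ^+ 2 by exact: sqr_ge0.
have E' : \sum_a \sum_b S a b ^+ 2 = 0.
  rewrite -[RHS]E /fm /mxtrace; apply: eq_bigr => a _; rewrite mxE; apply: eq_bigr => b _.
  by rewrite mxE expr2.
have Hi : \sum_b S i b ^+ 2 = 0.
  by apply: (psumr_eq0P _ E') => // a _; apply: sumr_ge0 => b _.
have : S i j ^+ 2 = 0 by apply: (psumr_eq0P _ Hi).
by move/eqP; rewrite sqrf_eq0 => /eqP.
Qed.

(** The first diagonal block of the bracket of two off-diagonal matrices. *)
Definition mom (B T : 'M[R]_4) : 'M[R]_4 := T *m B^T - B *m T^T.

Lemma mom_skew B T : (mom B T)^T = - mom B T.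
Proof. by rewrite /mom linearB /= !trmx_mul !trmxK opprB. Qed.

(** By invariance of the inner product the bracket of off-diagonal matrices is
    adjoint to the action of the diagonal block, so that it inherits its
    compatibility with the involution. *)
Lemma fm_mom B T S : S^T = - S -> fm (mom B T) S = - 2 * fm B (S *m T).
Proof.
move=> ES; rewrite /mom fmB !fm_mulr !trmxK.
have -> : fm T (S *m B) = - fm B (S *m T).
  by rewrite fmC fm_mull ES mulNmx fmC fmN fmC.
ring.
Qed.

(** The involution is self-adjoint and commutes with the left multiplications
    on the first block; by adjunction the bracket inherits this. *)
Lemma lpart_mom B T : lpart (mom (swap23 B) (swap23 T)) = lpart (mom B T).
Proof.
apply/eqP; rewrite -subr_eq0 -lpartB; apply/eqP/fm_eq0; set X := _ - _.
rewrite lpart_adj; have LX := lpart_Lcomm X; rewrite (lpartL LX).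
have sX : (lpart X)^T = - lpart X.
  by rewrite lpart_tr /X linearB /= !mom_skew -opprD lpartN.
by rewrite {1}/X fmB !fm_mom // swap_adj swapL // swap23K subrr.
Qed.

(** The involution is self-adjoint and exchanges the right multiplications on
    the two blocks; by adjunction the bracket inherits this. *)
Lemma rpart_mom B T : rpart (mom (swap23 B) (swap23 T)) = rpart (mom B^T T^T).
Proof.
apply/eqP; rewrite -subr_eq0 -rpartB; apply/eqP/fm_eq0; set X := _ - _.
have EX : X^T = - X by rewrite /X linearB /= !mom_skew -opprD.
rewrite rpart_adj; have RX := rpart_span EX; rewrite (rpartR RX).
have sX : (rpart X)^T = - rpart X by rewrite rpart_tr EX rpartN.
rewrite {1}/X fmB !fm_mom // -[rpart X *m swap23 T]opprK -swap_span' //.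
rewrite swap_adj swapN swap23K.
have -> : fm B^T (rpart X *m T^T) = fm B (T *m (rpart X)^T).
  by rewrite /fm !trmx_mul !trmxK -mxtrace_tr !trmx_mul !trmxK mulmxA mxtrace_mulC mulmxA.
rewrite sX mulmxN /fm linearN /= mulmxN linearN /=.
ring.
Qed.

(** The two factors of so(4) commute, so that the projections are morphisms. *)
Lemma part_bracket S T : S^T = - S -> T^T = - T ->
  lpart (S *m T - T *m S) = lpart S *m lpart T - lpart T *m lpart S /\
  rpart (S *m T - T *m S) = rpart S *m rpart T - rpart T *m rpart S.
Proof.
move=> sS sT; have LS := lpart_Lcomm S; have LT := lpart_Lcomm T.
have RS := rpart_span sS; have RT := rpart_span sT.
have -> : S *m T - T *m S = (lpart S *m lpart T - lpart T *m lpart S) +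
    (rpart S *m rpart T - rpart T *m rpart S).
  rewrite {1 2}(lr_part S) {1 2}(lr_part T) !mulmxDl !mulmxDr.
  rewrite (Lcomm_span LS RT) (Lcomm_span LT RS).
  move: (lpart S) (lpart T) (rpart S) (rpart T) => a b c d.
  by apply/matrixP => e f; rewrite ![in LHS]mxE ![in RHS]mxE; ring.
have LL := LcommB (LcommM LS LT) (LcommM LT LS).
have RR := Rspan_bracket RS RT.
by rewrite lpartD rpartD (lpartL LL) (rpartL LL) (lpartR RR) (rpartR RR) addr0 add0r.
Qed.

Lemma sigma_diag A D A' D' B B' :
  A^T = - A -> D^T = - D -> A'^T = - A' -> D'^T = - D' ->
  lpart (A *m A' - A' *m A + mom B B') + rpart (D *m D' - D' *m D + mom B^T B'^T) =
  (lpart A + rpart D) *m (lpart A' + rpart D') -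
  (lpart A' + rpart D') *m (lpart A + rpart D) + mom (swap23 B) (swap23 B').
Proof.
move=> sA sD sA' sD'; rewrite lpartD rpartD.
have [-> _] := part_bracket sA sA'; have [_ ->] := part_bracket sD sD'.
rewrite (lr_part (mom (swap23 B) _)) lpart_mom rpart_mom.
rewrite !mulmxDl !mulmxDr (Lcomm_span (lpart_Lcomm A) (rpart_span sD')).
rewrite (Lcomm_span (lpart_Lcomm A') (rpart_span sD)).
move: (lpart A) (lpart A') (rpart D) (rpart D') => a a' d d'.
move: (lpart (mom _ _)) (rpart (mom _ _)) => m n.
by apply/matrixP => e f; rewrite ![in LHS]mxE ![in RHS]mxE; ring.
Qed.

Lemma sigma_offdiag A D A' D' B B' :
  A^T = - A -> D^T = - D -> A'^T = - A' -> D'^T = - D' ->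
  swap23 (A *m B' + B *m D' - (A' *m B + B' *m D)) =
  (lpart A + rpart D) *m swap23 B' + swap23 B *m (lpart D' + rpart A') -
  ((lpart A' + rpart D') *m swap23 B + swap23 B' *m (lpart D + rpart A)).
Proof.
move=> sA sD sA' sD'.
have swl S T : S^T = - S -> swap23 (S *m T) = lpart S *m swap23 T - swap23 T *m rpart S.
  move=> sS; rewrite {1}(lr_part S) mulmxDl swapD (swap_span T (rpart_span sS)).
  by rewrite swapL //; exact: lpart_Lcomm.
have swr S T : S^T = - S -> swap23 (T *m S) = swap23 T *m lpart S - rpart S *m swap23 T.
  move=> sS; rewrite {1}(lr_part S) mulmxDr swapD (swap_span' T (rpart_span sS)).
  by rewrite swapL' //; exact: lpart_Lcomm.
rewrite swapD swapN !swapD (swl A B' sA) (swl A' B sA') (swr D' B sD') (swr D B' sD).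
rewrite !mulmxDl !mulmxDr.
move: (swap23 B) (swap23 B') => b b'.
move: (lpart A) (lpart A') (rpart D) (rpart D') => a a' d d'.
move: (rpart A) (rpart A') (lpart D) (lpart D') => e e' f f'.
by apply/matrixP => g h; rewrite ![in LHS]mxE ![in RHS]mxE; ring.
Qed.

Lemma sigma_mx_block (A B C D : 'M[R]_4) : sigma_mx (block_mx A B C D) =
  block_mx (lpart A + rpart D) (swap23 B) (- (swap23 B)^T) (lpart D + rpart A).
Proof. by rewrite /sigma_mx block_mxKul block_mxKur block_mxKdr. Qed.

Lemma sigma_mx_bracket (A B D A' B' D' : 'M[R]_4) :
  A^T = - A -> D^T = - D -> A'^T = - A' -> D'^T = - D' ->
  let X := block_mx A B (- B^T) D in let Y := block_mx A' B' (- B'^T) D' in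
  sigma_mx (X *m Y - Y *m X) = sigma_mx X *m sigma_mx Y - sigma_mx Y *m sigma_mx X.
Proof.
move=> sA sD sA' sD'.
rewrite /= !sigma_mx_block !mulmx_block !opp_block_mx !add_block_mx sigma_mx_block.
have off := sigma_offdiag B B' sA sD sA' sD'.
have EA (S T V W : 'M[R]_4) : S *m T + V *m - W^T - (T *m S + W *m - V^T) =
    S *m T - T *m S + mom V W.
  by apply/matrixP => g h; rewrite /mom !mulmxN ![in LHS]mxE ![in RHS]mxE; ring.
have ED (S T V W : 'M[R]_4) : - V^T *m W + S *m T - (- W^T *m V + T *m S) =
    S *m T - T *m S + mom V^T W^T.
  by apply/matrixP => g h; rewrite /mom !trmxK !mulNmx ![in LHS]mxE ![in RHS]mxE; ring.
have trp S T : S^T = - S -> T^T = - T -> (lpart S + rpart T)^T = - (lpart S + rpart T).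
  by move=> sS sT; rewrite linearD /= lpart_tr rpart_tr sS sT lpartN rpartN opprD.
congr block_mx.
- by rewrite !EA ED sigma_diag.
- exact: off.
- rewrite off; move: (trp A D sA sD) (trp A' D' sA' sD') (trp D A sD sA) (trp D' A' sD' sA').
  move: (lpart A + _) (lpart D + _) (lpart A' + _) (lpart D' + _) (swap23 B) (swap23 B').
  move=> a d a' d' b b' Ta Ta' Td Td'.
  rewrite linearB /= !linearD /= !trmx_mul Ta Ta' Td Td' !(mulmxN, mulNmx).
  by apply/matrixP => g h; rewrite ![in LHS]mxE ![in RHS]mxE; ring.
rewrite EA !ED; have := sigma_diag B^T B'^T sD sA sD' sA'.
rewrite !trmxK -!swap_tr.
by [].
Qed.

(** The three types of brackets (diagonal, mixed and off-diagonal) reduce to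
    the facts that the projections onto the factors of so(4) are morphisms and
    that the involution of the off-diagonal part intertwines the actions of
    the exchanged factors. *)
Lemma sigma_bracket : {morph (@sigma_fun R) : X Y / so_bracket X Y}.
Proof.
move=> X Y; apply/val_inj.
have [AX DX EX] := skew_blocks X; have [AY DY EY] := skew_blocks Y.
have := sigma_mx_bracket (ursubmx (val X : 'M_(4 + 4))) (ursubmx (val Y : 'M_(4 + 4)))
  AX DX AY DY.
by rewrite -EX -EY !submxK.
Qed.

End TrialityBracket.

(** * The group F_11: core eigenvectors and realised permutations *)

Section F11vectors.
Variable R : realType.
Local Notation C := R[i].
Local Notation G := (lie_aut (@so_bracket R 8)).
Local Notation I := ('i%C : C).
Local Notation cplx X := (map_mx (real_complex R) X).
Local Notation q1 := (Quat 1 0 0 0 : quat R).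
Local Notation qi := (Quat 0 1 0 0 : quat R).
Local Notation qj := (Quat 0 0 1 0 : quat R).
Local Notation qk := (Quat 0 0 0 1 : quat R).

Definition off_mx (B : 'M[R]_4) : 'M[R]_(4 + 4) := block_mx 0 B (- B^T) 0.

Lemma off_mxD B B' : off_mx (B + B') = off_mx B + off_mx B'.
Proof. by rewrite /off_mx add_block_mx !addr0 linearD /= opprD. Qed.

Lemma off_mxZ a B : off_mx (a *: B) = a *: off_mx B.
Proof. by rewrite /off_mx scale_block_mx !scaler0 linearZ /= scalerN. Qed.

(** The off-diagonal matrix p tensor q; the four copies of Sp(1) act by p -> a
    p b^* and q -> d q c^*. *)
Definition W (p q : quat R) : 'M[C]_8 := cplx (off_mx (qvec p *m (qvec q)^T)).

Lemma off_skew B : skew (off_mx B : 'M[R]_8).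
Proof.
apply/eqP; rewrite /off_mx (@tr_block_mx _ 4 4 4 4) (@opp_block_mx _ 4 4 4 4).
by rewrite !trmx0 linearN /= trmxK opprK !oppr0.
Qed.

Lemma W_skew p q : (W p q)^T = - W p q.
Proof. exact: (skew_cplx (Sub _ (off_skew _))). Qed.

Lemma off_conj (P Q B : 'M[R]_4) :
  block_mx P 0 0 Q *m off_mx B *m (block_mx P 0 0 Q)^T = off_mx (P *m B *m Q^T).
Proof.
rewrite /off_mx tr_block_mx !trmx0 !mulmx_block.
rewrite !(mulmx0, mul0mx, addr0, add0r) mulmxN mulNmx.
by rewrite !trmx_mul trmxK !mulmxA.
Qed.

Lemma W_Ad (M N : orthG R 4) p q p' q' :
  val M *m qvec p = qvec p' -> val N *m qvec q = qvec q' ->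
  xact (Ad (oblock M N : orthG R 8)) (W p q) = W p' q'.
Proof.
move=> Mp Nq; rewrite xactAd ?W_skew // /W map_trmx -!map_mxM; congr (cplx _).
etransitivity; first exact: off_conj.
by rewrite -Mp -Nq trmx_mul !mulmxA.
Qed.

Lemma W_act (a b c d : Sp1 R) p q : xact (spin4 (a, b, c, d)) (W p q) =
  W (qmul (qmul (val a) p) (qconj (val b))) (qmul (qmul (val d) q) (qconj (val c))).
Proof. by apply: W_Ad; exact: lr_mxE. Qed.

Lemma W_Uone (c s : R) p q : W (qmul (Quat c s 0 0) p) q =
  c%:C%C *: W p q + s%:C%C *: W (qmul qi p) q.
Proof.
have E : qvec (qmul (Quat c s 0 0) p) = c *: qvec p + s *: qvec (qmul qi p).
  apply/colP => n; rewrite !mxE; case: p => [x y z t].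
  by case: n => [[|[|[|[|]]]]] //= _; ring.
rewrite /W E; move: (qvec p) (qvec (qmul qi p)) (qvec q) => u v z.
rewrite mulmxDl -!scalemxAl off_mxD !off_mxZ.
by rewrite !map_mxD !map_mxZ.
Qed.

Local Notation unit8 := (bool * (bool * bool))%type.

(** The eight units (+-1, +-i, +-j, +-k), encoded by a sign and two bits: 1,
    i, j, k are 00, 01, 10, 11.  The products are then given by explicit
    boolean formulas. *)
Definition sq (u : unit8) : quat R :=
  let: (s, (x, w)) := u in let e := (-1) ^+ s in
  match x, w with
  | false, false => Quat e 0 0 0 | true, false => Quat 0 0 e 0
  | false, true => Quat 0 e 0 0 | true, true => Quat 0 0 0 e
  end.

Definition mul8 (u v : unit8) : unit8 :=
  let: (s, (x, w)) := u in let: (s', (x', w')) := v in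
  (s (+) s' (+) (x && x') (+) (w && w') (+) (x && w'), (x (+) x', w (+) w')).

Definition conj8 (u : unit8) : unit8 :=
  let: (s, (x, w)) := u in (s (+) (x || w), (x, w)).

Lemma sqM u v : qmul (sq u) (sq v) = sq (mul8 u v).
Proof.
case: u => [s [x w]]; case: v => [s' [x' w']].
by case: x; case: w; case: x'; case: w'; case: s; case: s';
   rewrite /= ?expr0 ?expr1; congr Quat; ring.
Qed.

Lemma sq_conj u : qconj (sq u) = sq (conj8 u).
Proof.
by case: u => [s [x w]]; case: x; case: w; case: s;
   rewrite /= ?expr0 ?expr1; congr Quat; ring.
Qed.

Local Notation e8 := (false, (false, false)).
Local Notation i8 := (false, (false, true)).
Local Notation j8 := (false, (true, false)).
Local Notation k8 := (false, (true, true)).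

Definition w0 (u v : bool * bool) : 'M[C]_8 := W (sq (false, u)) (sq (false, v)).

Local Notation term := (nat * ((bool * bool) * (bool * bool)))%type.

(** Multiples by powers of the imaginary unit of the sixteen basis vectors;
    identities between sums of such terms become equalities of lists up to
    permutation, which are decided by computation. *)
Definition tval (t : term) : 'M[C]_8 := I ^+ t.1 *: w0 t.2.1 t.2.2.

Definition term8 (k : nat) (u v : unit8) : term :=
  (k + (u.1 (+) v.1).*2, (u.2, v.2))%N.

Lemma W_sq k u v : I ^+ k *: W (sq u) (sq v) = tval (term8 k u v).
Proof.
have sqE s x w : qvec (sq (s, (x, w))) = (-1) ^+ s *: qvec (sq (false, (x, w))).
  apply/colP => n; rewrite !mxE; case: x; case: w;
  by case: n => [[|[|[|[|]]]]] //= _; rewrite ?expr0; ring.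
have I2 (b : bool) : I ^+ b.*2 = (-1) ^+ b by case: b; rewrite ?expr0 //= sqr_i expr1.
case: u v => [s [x w]] [s' [x' w']]; rewrite /tval /w0 exprD I2 -scalerA.
congr (_ *: _); rewrite /W !(sqE s) !(sqE s').
rewrite linearZ /= -scalemxAl -scalemxAr scalerA off_mxZ map_mxZ -signr_addb.
by rewrite rmorphXn rmorphN rmorph1.
Qed.

Local Notation L := (bool * (bool * bool) * bool)%type.

(** The core eigenvector with label (s, (y, w), x), with f the unit with bits
    (x, w), is X(1) - (-1)^s I X(i), where X(p) = W(p, f) + (-1)^y W(p j, f
    j). *)
Definition frame (l : L) : seq (nat * (unit8 * unit8)) :=
  let: (s, (y, w), x) := l in let f := (false, (x, w)) in
  [:: (0, (e8, f)); (y.*2, (j8, mul8 f j8)); (s.*2 + 3, (i8, f));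
      ((s (+) y).*2 + 3, (k8, mul8 f j8))]%N.

Definition frame_vec (l : L) : 'M[C]_8 :=
  \sum_(t <- frame l) I ^+ t.1 *: W (sq t.2.1) (sq t.2.2).

Definition frame_act (k : nat) (P Q : unit8 -> unit8) (l : L) : seq term :=
  [seq let: (n, u) := term8 t.1 (P t.2.1) (Q t.2.2) in ((k + n) %% 4, u)%N | t <- frame l].

Lemma tval_mod k t : I ^+ k *: tval t = tval ((k + t.1) %% 4, t.2)%N.
Proof.
have I4 : I ^+ 4 = 1 by rewrite -[4%N]/(2 * 2)%N exprM sqr_i sqrrN expr1n.
rewrite /tval scalerA -exprD {1}(divn_eq (k + t.1) 4) exprD mulnC exprM I4.
by rewrite expr1n mul1r.
Qed.

Lemma frame_actE k (P Q : unit8 -> unit8) l :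
  I ^+ k *: \sum_(t <- frame l) I ^+ t.1 *: W (sq (P t.2.1)) (sq (Q t.2.2)) =
  \sum_(t <- frame_act k P Q l) tval t.
Proof.
rewrite big_map scaler_sumr; apply: eq_bigr => -[n [u v]] _.
by rewrite W_sq tval_mod.
Qed.

(** An automorphism which permutes the sixteen vectors W up to sign maps each
    core eigenvector to a multiple of another one as soon as the formal terms
    agree. *)
Lemma U11_act (x : G) (P Q : unit8 -> unit8) l m k :
  (forall u v, xact x (W (sq u) (sq v)) = W (sq (P u)) (sq (Q v))) ->
  perm_eq (frame_act 0 P Q l) (frame_act k id id m) ->
  xact x (frame_vec l) = I ^+ k *: frame_vec m.
Proof.
move=> xW E; rewrite /frame_vec (frame_actE k id id) -(perm_big _ E) -frame_actE expr0 scale1r.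
by rewrite linear_sum; apply: eq_bigr => t _; rewrite linearZ /= xW.
Qed.

Lemma U11_spin (a b c d : Sp1 R) (a' b' c' d' : unit8) l m k :
  val a = sq a' -> val b = sq b' -> val c = sq c' -> val d = sq d' ->
  perm_eq (frame_act 0 (fun u => mul8 (mul8 a' u) (conj8 b'))
             (fun v => mul8 (mul8 d' v) (conj8 c')) l) (frame_act k id id m) ->
  xact (spin4 (a, b, c, d)) (frame_vec l) = I ^+ k *: frame_vec m.
Proof.
move=> Ea Eb Ec Ed; apply: U11_act => u v.
by rewrite W_act Ea Eb Ec Ed !sq_conj !sqM.
Qed.

Local Notation e := (1%g : Sp1 R).
Local Notation m := (Sp1_neg R).
Local Notation i := (Sp1_i R).
Local Notation j := (Sp1_j R).

Lemma U11_iii s u x : xact (spin4 (e, i, i, i)) (frame_vec (s, u, x)) =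
  I ^+ ((s (+) x).*2 + 3) *: frame_vec (s, u, x).
Proof.
apply: (U11_spin (a' := e8) (b' := i8) (c' := i8) (d' := i8)) => //=.
by case: u => y w; case: s; case: x; case: y; case: w.
Qed.

Lemma U11_jj1 s u x : xact (spin4 (e, j, j, e)) (frame_vec (s, u, x)) =
  I ^+ u.1.*2 *: frame_vec (s, u, x).
Proof.
apply: (U11_spin (a' := e8) (b' := j8) (c' := j8) (d' := e8)) => //=.
by case: u => y w; case: s; case: x; case: y; case: w.
Qed.

Lemma U11_1jj s u x : xact (spin4 (e, e, j, j)) (frame_vec (s, u, x)) =
  I ^+ u.2.*2 *: frame_vec (s, u, x).
Proof.
apply: (U11_spin (a' := e8) (b' := e8) (c' := j8) (d' := j8)) => //=.
by case: u => y w; case: s; case: x; case: y; case: w.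
Qed.

Lemma U11_Uone (a : Sp1 R) s u x : U1 a -> xact (spin4 (a, e, e, e)) (frame_vec (s, u, x)) =
  Complex (q_re (val a)) ((-1) ^+ s * q_i (val a)) *: frame_vec (s, u, x).
Proof.
move=> Ua; set x' := spin4 _; pose c := q_re (val a); pose d := q_i (val a).
have xW v w : xact x' (W (sq v) (sq w)) =
    c%:C%C *: W (sq v) (sq w) + d%:C%C *: W (sq (mul8 i8 v)) (sq w).
  have Ea : val a = Quat c d 0 0.
    by move: Ua; rewrite /U1 /c /d /=; case: (val a) => a0 a1 a2 a3 /= [-> ->].
  have Eiv : qmul qi (sq v) = sq (mul8 i8 v) by rewrite -sqM.
  rewrite W_act Ea -Eiv -W_Uone (_ : val e = Quat 1 0 0 0) // qmul1.
  by rewrite (_ : qconj q1 = q1) ?q1mul //=; congr Quat; ring.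
have -> : Complex c ((-1) ^+ s * d) = c%:C%C + d%:C%C * I ^+ (s.*2 + 1) :> C.
  by apply/eqP; case: s; rewrite /= ?expr0 ?expr1 eq_complex /=; apply/andP; split; apply/eqP; ring.
rewrite scalerDl -scalerA {3}/frame_vec (frame_actE _ id id).
have E : perm_eq (frame_act 0 (mul8 i8) id (s, u, x))
    (frame_act (s.*2 + 1) id id (s, u, x)).
  by case: u => y w; case: s; case: x; case: y; case: w.
rewrite -(perm_big _ E) -(frame_actE 0 (mul8 i8) id) expr0 scale1r /frame_vec linear_sum !scaler_sumr -big_split.
apply: eq_bigr => t _; rewrite linearZ /= xW scalerDr !scalerA.
by rewrite [c%:C%C * _]mulrC [d%:C%C * _]mulrC.
Qed.

Definition realised (phi : L -> L) : Prop :=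
  exists g : G, forall l, exists c, xact g (frame_vec l) = c *: frame_vec (phi l).

Lemma realised_comp phi psi : realised phi -> realised psi -> realised (phi \o psi).
Proof.
move=> [g gP] [h hP]; exists (g * h)%g => l.
have [c hE] := hP l; have [d gE] := gP (psi l); exists (c * d).
by rewrite xactM hE linearZ /= gE scalerA.
Qed.

Lemma realised_eq phi psi : phi =1 psi -> realised phi -> realised psi.
Proof. by move=> E [g gP]; exists g => l; have [c Ec] := gP l; exists c; rewrite -E. Qed.

Lemma realised_sx : realised (fun l : L => (~~ l.1.1, l.1.2, ~~ l.2)).
Proof.
exists (spin4 (j, e, e, e)) => -[[s u] x]; exists (I ^+ (1 + u.1 + x).*2).
apply: (U11_spin (a' := j8) (b' := e8) (c' := e8) (d' := e8)) => //=.
by case: u => y w; case: s; case: x; case: y; case: w.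
Qed.

Lemma realised_x : realised (fun l : L => (l.1.1, l.1.2, ~~ l.2)).
Proof.
exists (spin4 (e, j, e, e)) => -[[s u] x]; exists (I ^+ (u.1 + x).*2).
apply: (U11_spin (a' := e8) (b' := j8) (c' := e8) (d' := e8)) => //=.
by case: u => y w; case: s; case: x; case: y; case: w.
Qed.

Lemma realised_w : realised (fun l : L => (l.1.1, (l.1.2.1, ~~ l.1.2.2), l.2)).
Proof.
exists (spin4 (e, e, e, i)) => -[[s u] x]; exists (I ^+ u.2.*2).
apply: (U11_spin (a' := e8) (b' := e8) (c' := e8) (d' := i8)) => //=.
by case: u => y w; case: s; case: x; case: y; case: w.
Qed.

(** Automorphisms of the form 1 + N, with N a signed permutation of the
    quaternion units. *)
Lemma U11_right (N : orthG R 4) (Q : unit8 -> unit8) l l' k :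
  (forall v, val N *m qvec (sq v) = qvec (sq (Q v))) ->
  perm_eq (frame_act 0 id Q l) (frame_act k id id l') ->
  xact (Ad (oblock (1%g : orthG R 4) N : orthG R 8)) (frame_vec l) = I ^+ k *: frame_vec l'.
Proof. by move=> NE; apply: U11_act => u v; apply: W_Ad; rewrite //= mul1mx. Qed.

(** Conjugation by (1 + j) / sqrt 2, written without a square root. *)
Definition quarter_mx : 'M[R]_4 := 2^-1 *: lr_mx (Quat 1 0 1 0) (Quat 1 0 1 0).

Lemma quarter_orth : orth quarter_mx.
Proof.
rewrite /orth /= /quarter_mx linearZ /= -scalemxAl -scalemxAr lr_mx_orth scalerA /=.
rewrite scale_scalar_mx; apply/eqP; congr scalar_mx; by field.
Qed.

Lemma realised_xw : realised (fun l : L => (l.1.1, l.1.2, l.2 (+) l.1.2.2)).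
Proof.
pose Q (v : unit8) := if v is (t, (x, true)) then (t (+) ~~ x, (~~ x, true)) else v.
exists (Ad (oblock (1%g : orthG R 4) (Sub _ quarter_orth) : orthG R 8)) => -[[s u] x].
exists (I ^+ (u.2 && ~~ x).*2); apply: (U11_right (Q := Q)) => [[t [y w]]|].
  rewrite /= /quarter_mx -scalemxAl lr_mxE; apply/colP => n; rewrite !mxE.
  by case: t; case: y; case: w; case: n => [[|[|[|[|]]]]] //= _;
    rewrite ?expr0 ?expr1; field.
by case: u => y w; case: s; case: x; case: y; case: w.
Qed.

(** Quaternion conjugation on the second block, which has determinant -1 and
    exchanges the third and fourth copies of sp(1). *)
Definition conj_mx : 'M[R]_4 := diag_mx (\row_i (-1) ^+ (i != 0)).

Lemma conj_orth : orth conj_mx.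
Proof.
rewrite /orth /= /conj_mx tr_diag_mx mulmx_diag; apply/eqP/matrixP => a b.
by rewrite !mxE -expr2 sqrr_sign.
Qed.

Lemma realised_yw : realised (fun l : L =>
  (l.1.1, (l.1.2.1 (+) ~~ l.1.2.2, l.1.2.2), l.2)).
Proof.
exists (Ad (oblock (1%g : orthG R 4) (Sub _ conj_orth) : orthG R 8)) => -[[s u] x].
exists (I ^+ (u.2 || x).*2); apply: (U11_right (Q := conj8)) => [v|].
  rewrite -sq_conj; apply/colP => n; rewrite mul_diag_mx !mxE -val_eqE.
  by case: (sq v) => p0 p1 p2 p3; case: n => [[|[|[|[|]]]]] //= _; rewrite ?expr0 ?expr1 ?mul1r ?mulN1r.
by case: u => y w; case: s; case: x; case: y; case: w.
Qed.

Lemma sigma_mx_linear : linear (@sigma_mx R).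
Proof.
have lpartL c (S T : 'M[R]_4) : lpart (c *: S + T) = c *: lpart S + lpart T.
  by rewrite !lpartE PhiD PhiZ; apply/matrixP => a b; rewrite !mxE; ring.
have rpartL c (S T : 'M[R]_4) : rpart (c *: S + T) = c *: rpart S + rpart T.
  by rewrite !rpartE PhiD PhiZ; apply/matrixP => a b; rewrite !mxE; ring.
have swapL c (S T : 'M[R]_4) : swap23 (c *: S + T) = c *: swap23 S + swap23 T.
  by rewrite !swap23E PhiD PhiZ; apply/matrixP => a b; rewrite !mxE; ring.
move=> c X Y; rewrite /sigma_mx scale_block_mx add_block_mx.
have ulL : ulsubmx (c *: X + Y) = c *: ulsubmx X + ulsubmx Y.
  by apply/matrixP => a b; rewrite !mxE.
have urL : ursubmx (c *: X + Y) = c *: ursubmx X + ursubmx Y.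
  by apply/matrixP => a b; rewrite !mxE.
have drL : drsubmx (c *: X + Y) = c *: drsubmx X + drsubmx Y.
  by apply/matrixP => a b; rewrite !mxE.
rewrite ulL urL drL !lpartL !rpartL !swapL.
congr block_mx; rewrite ?linearP /= ?opprD ?scalerN //.
  by rewrite scalerDr addrACA.
by rewrite scalerDr addrACA.
Qed.

Lemma sigma_is_aut : is_lie_aut (@so_bracket R 8) (@sigma_fun R).
Proof.
split=> [c X Y||]; [|exact: inv_bij (@sigmaK R)|exact: sigma_bracket].
by apply/val_inj; exact: sigma_mx_linear.
Qed.

Definition sigma : G := LieAut sigma_is_aut.

Lemma sigma_off (B : 'M[R]_4) :
  xact sigma (cplx (off_mx B)) = cplx (off_mx (swap23 B)).
Proof.
have E : sigma_mx (off_mx B) = off_mx (swap23 B).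
  rewrite /sigma_mx /off_mx block_mxKul block_mxKur block_mxKdr.
  have Phi0 : Phi (0 : 'M[R]_4) = 0 := linear0 _.
  have lp0 : lpart (0 : 'M[R]_4) = 0 by rewrite lpartE Phi0 addr0 scaler0.
  have rp0 : rpart (0 : 'M[R]_4) = 0 by rewrite rpartE Phi0 scaler0 subr0 scaler0.
  by rewrite lp0 rp0 addr0.
rewrite -E; exact: (xact_so sigma (Sub _ (off_skew B))).
Qed.

Lemma sigma_W u v : xact sigma (W (sq u) (sq v)) =
  2^-1 *: (W (sq u) (sq v) -
    \sum_(a <- [:: i8; j8; k8])
      W (sq (mul8 u (conj8 a))) (sq (mul8 v (conj8 a)))).
Proof.
have Ea a : qvec (sq (mul8 u (conj8 a))) *m (qvec (sq (mul8 v (conj8 a))))^T =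
    right_mx (sq a) *m (qvec (sq u) *m (qvec (sq v))^T) *m (right_mx (sq a))^T.
  rewrite -!sqM -!sq_conj -[sq u in LHS]qmul1 -[sq v in LHS]qmul1 -!lr_mxE.
  by rewrite trmx_mul !mulmxA.
rewrite {1}/W sigma_off swap23E Phi_sum !big_cons big_nil addr0 /W !Ea.
have -> : sq i8 = qi :> quat R by [].
have -> : sq j8 = qj :> quat R by [].
have -> : sq k8 = qk :> quat R by [].
move: (_ *m _^T) (_ *m _ *m _) (_ *m _ *m _) (_ *m _ *m _) => A A1 A2 A3.
rewrite off_mxZ map_mxZ off_mxD -[- (_ + _)]scaleN1r off_mxZ scaleN1r map_mxD map_mxN.
by rewrite !off_mxD !map_mxD -addrA fmorphV rmorph_nat.
Qed.

(** The three right multiplications send the eigenvector to multiples of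
    itself and of the one with w flipped.  For y = 1 the latter two cancel
    each other, and for y = 0 the multiples of the eigenvector itself cancel. *)
Lemma realised_sigma : realised (fun l : L =>
  (l.1.1, (l.1.2.1, l.1.2.2 (+) ~~ l.1.2.1), l.2)).
Proof.
exists sigma => l.
have E a k l' : perm_eq (frame_act 0 (fun u => mul8 u (conj8 a)) (fun v => mul8 v (conj8 a)) l)
      (frame_act k id id l') ->
    \sum_(t <- frame l) I ^+ t.1 *: W (sq (mul8 t.2.1 (conj8 a))) (sq (mul8 t.2.2 (conj8 a))) =
    I ^+ k *: frame_vec l'.
  move=> lP; rewrite /frame_vec (frame_actE k id id) -(perm_big _ lP).
  rewrite -(frame_actE 0 (fun u => mul8 u (conj8 a)) (fun v => mul8 v (conj8 a))).
  by rewrite expr0 scale1r.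
have S : xact sigma (frame_vec l) = 2^-1 *: (frame_vec l -
    \sum_(a <- [:: i8; j8; k8]) \sum_(t <- frame l)
      I ^+ t.1 *: W (sq (mul8 t.2.1 (conj8 a))) (sq (mul8 t.2.2 (conj8 a)))).
  rewrite exchange_big /frame_vec linear_sum -sumrB scaler_sumr; apply: eq_bigr => t _.
  by rewrite linearZ /= sigma_W -scaler_sumr -scalerBr !scalerA mulrC.
have three (f : unit8 -> 'M[C]_8) :
  \sum_(a <- [:: i8; j8; k8]) f a = f i8 + (f j8 + f k8) by rewrite 2!big_cons big_seq1.
rewrite three in S; case: l E S => [[s [y w]] x] E {three} S.
pose k := ((s (+) x (+) w).*2 + 1)%N.
rewrite (E i8 k (s, (y, ~~ w), x)) in S; last first.
  by rewrite {}/k {E}; case: s; case: x; case: y; case: w.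
rewrite (E j8 (y.*2)%N (s, (y, w), x)) in S; last first.
  by rewrite {}/k {E}; case: s; case: x; case: y; case: w.
rewrite (E k8 (k + y.*2)%N (s, (y, ~~ w), x)) in S; last first.
  by rewrite {}/k {E}; case: s; case: x; case: y; case: w.
rewrite {}S; move: k => k {E}; case: y; rewrite /= ?addn0 ?addbF ?addbT.
  have I2 : I ^+ 1.*2 = -1 :> C := sqr_i _.
  exists 1; rewrite exprD I2; move: (frame_vec _) (frame_vec _) (I ^+ k) => V V' c.
  by apply/matrixP => a b; rewrite !mxE; field.
exists (- I ^+ k); rewrite expr0; move: (frame_vec _) (frame_vec _) (I ^+ k) => V V' c.
by apply/matrixP => a b; rewrite !mxE; field.
Qed.

End F11vectors.

Section F11action.
Variable R : realType.
Local Notation L := (bool * (bool * bool) * bool)%type.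
Local Notation realised := (@realised R).

Lemma realised_id : realised id.
Proof. by apply: realised_eq (realised_comp (realised_x R) (realised_x R)) => -[[s u] []]. Qed.

(** Quaternion conjugation on the second block and the outer automorphism give
    the transpositions of (0, 0) with (1, 0) and (0, 1); the translation by
    (0, 1) gives the last one that is needed to generate the symmetric group. *)
Lemma realised_perm (p : {perm bool * bool}) :
  realised (fun l : L => (l.1.1, p l.1.2, l.2)).
Proof.
pose r (p : {perm bool * bool}) := realised (fun l : L => (l.1.1, p l.1.2, l.2)).
have r1 : r 1%g.
  by apply: realised_eq realised_id => -[[s z] x]; rewrite /= perm1.
have rM p1 p2 : r p1 -> r p2 -> r (p1 * p2)%g.
  move=> r1' r2; apply: realised_eq (realised_comp r2 r1') => -[[s z] x] /=.
  by rewrite permM.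
have tE a b u : tperm a b u = if u == a then b else if u == b then a else u.
  case: tpermP => [->|->|/eqP/negPf-> /eqP/negPf->] //; first by rewrite eqxx.
  by rewrite eqxx; case: eqP => // ->.
have ry : r (tperm (false, false) (true, false)).
  by apply: realised_eq (realised_yw R) => -[[s [[] []]] x]; rewrite tE.
have rw : r (tperm (false, false) (false, true)).
  by apply: realised_eq (realised_sigma R) => -[[s [[] []]] x]; rewrite tE.
have ryw : r (tperm (false, false) (true, true)).
  have rw' : r (tperm (true, true) (false, true)).
    have := realised_comp (realised_w R) (realised_comp ry (realised_w R)).
    by apply: realised_eq => -[[s [[] []]] x]; rewrite /= !tE.
  rewrite (_ : tperm _ _ = tperm (false, false) (false, true) *
    (tperm (true, true) (false, true) * tperm (false, false) (false, true)))%g.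
    by apply: (rM) => //; exact: rM.
  by apply/permP => -[[] []]; rewrite !permM !tE.
pose H := [set q | `[< r q >]]%SET.
have H_group : group_set H.
  apply/group_setP; split; first by rewrite !inE; exact: r1.
  by move=> a b; rewrite !inE => ra rb; exact: rM.
have : p \in [set: {perm bool * bool}]%SET by rewrite finset.inE.
(* The transpositions of one fixed point generate the symmetric group. *)
rewrite -(gen_tperm (false, false)) => pH.
suff : p \in group H_group by rewrite !inE.
apply: fintype.subsetP pH; rewrite gen_subG; apply/fintype.subsetP => _ /imsetP[u _ ->].
rewrite !inE; case: u => [[] []] //.
by rewrite tperm1.
Qed.

Definition T11 := (bool * {perm bool * bool} * (bool * bool * bool))%type.

Definition act11 (t : T11) (l : L) : L :=
  let: (e, p, (al, be, ga)) := t in let: (s, u, x) := l in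
  (s (+) e, p u, x (+) al (+) (be && u.1) (+) (ga && u.2)).

(** The transvection x -> x + y is conjugate to x -> x + w by the exchange of
    y and w. *)
Lemma realised_act t : realised (act11 t).
Proof.
case: t => [[e p] [[al be] ga]].
have opt (b : bool) f : realised f -> realised (fun l => if b then f l else l).
  by case: b => // _; exact: realised_id.
have rga := realised_xw R.
have rbe : realised (fun l : L => (l.1.1, l.1.2, l.2 (+) l.1.2.1)).
  pose sw := tperm (true, false) (false, true).
  have := realised_comp (realised_perm sw) (realised_comp rga (realised_perm sw)).
  apply: realised_eq => -[[s u] x]; rewrite /= tpermK; congr (_, _, _ (+) _).
  by case: u => [[] []] /=; rewrite /sw ?tpermL ?tpermR ?tpermD.
have rs := realised_comp (realised_x R) (realised_sx R).
have := realised_comp (realised_perm p) (realised_comp (opt e _ rs)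
  (realised_comp (opt al _ (realised_x R)) (realised_comp (opt be _ rbe) (opt ga _ rga)))).
apply: realised_eq => -[[s u] x] /=.
case: u => y w.
by case: e; case: al; case: be; case: ga; rewrite /= ?negbK ?addbT ?addbF ?andbT;
  congr (_, _, _); case: x; case: y; case: w.
Qed.

End F11action.

(** * The group F_11: the core eigenvectors generate so(8) *)

Section F11torus.
Variable R : realType.
Local Notation C := R[i].
Local Notation G := (lie_aut (@so_bracket R 8)).
Local Notation I := ('i%C : C).
Local Notation cplx X := (map_mx (real_complex R) X).
Local Notation unit8 := (bool * (bool * bool))%type.
Local Notation e8 := (false, (false, false)).
Local Notation i8 := (false, (false, true)).
Local Notation j8 := (false, (true, false)).
Local Notation k8 := (false, (true, true)).
Local Notation U11 := (@frame_vec R).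
Local Notation m := (Sp1_neg R).
Local Notation i := (Sp1_i R).

Lemma U11_skew l : (U11 l)^T = - U11 l.
Proof.
rewrite /frame_vec linear_sum -sumrN; apply: eq_bigr => t _.
by rewrite linearZ /= W_skew scalerN.
Qed.

Lemma W_entry (p q : quat R) (a b : 'I_4) :
  W p q (lshift 4 a) (rshift 4 b) = (qvec p a 0 * qvec q b 0)%:C%C.
Proof.
rewrite mxE /off_mx.
have -> : block_mx 0 (qvec p *m (qvec q)^T) (- (qvec p *m (qvec q)^T)^T) 0
   (lshift 4 a) (rshift 4 b) = (qvec p *m (qvec q)^T) a b by exact: block_mxEur.
by rewrite mxE big_ord1 [_^T _ _]mxE.
Qed.

Definition unit_index (u : bool * bool) : 'I_4 := inord (u.1.*2 + u.2).

Lemma qvec_unit u : qvec (sq R (false, u)) = delta_mx (unit_index u) 0.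
Proof.
apply/colP => n; rewrite !mxE andbT -val_eqE /= inordK; last by case: u => [[] []].
by case: u => [[] []]; case: n => [[|[|[|[|]]]]].
Qed.

Lemma U11_neq0 l : U11 l != 0.
Proof.
case: l => [[s [y w]] x]; apply/eqP.
move/matrixP/(_ (lshift 4 (unit_index (false, false))) (rshift 4 (unit_index (x, w)))).
rewrite summxE [RHS]mxE.
under eq_bigr => t _ do rewrite mxE W_entry.
have q0 u : qvec (sq R (false, u)) (unit_index (false, false)) 0 = (u == (false, false))%:R.
  rewrite qvec_unit mxE andbT -val_eqE /= !inordK //; last by case: u => [[] []].
  by case: u => [[] []].
rewrite !big_cons big_nil ![_.2.1]/= ![_.2.2]/= !q0 qvec_unit !mxE eqxx.
rewrite expr0 !mul0r !mulr0 !addr0 !mul1r => /eqP.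
by rewrite !eqxx eq_complex /= oner_eq0.
Qed.

(** Fourier inversion on the group of signs (s, y). *)
Lemma frame_span (Q : 'M[C]_8 -> Prop) (A B D E : 'M[C]_8) :
  (forall a b V W, Q V -> Q W -> Q (a *: V + b *: W)) ->
  (forall s y : bool, Q (A + I ^+ y.*2 *: B + I ^+ (s.*2 + 3) *: D +
                         I ^+ ((s (+) y).*2 + 3) *: E)) ->
  [/\ Q A, Q B, Q D & Q E].
Proof.
move=> Qc QU.
have Q4 a b c d V1 V2 V3 V4 : Q V1 -> Q V2 -> Q V3 -> Q V4 ->
    Q (a *: V1 + b *: V2 + (c *: V3 + d *: V4)).
  move=> Q1 Q2 Q3 Q4; have := Qc 1 1 _ _ (Qc a b _ _ Q1 Q2) (Qc c d _ _ Q3 Q4).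
  by rewrite !scale1r.
have H a b c d := Q4 a b c d _ _ _ _ (QU false false) (QU false true) (QU true false) (QU true true).
have I2 : I ^+ 2 = -1 :> C := sqr_i _.
have e0 : I ^+ false.*2 = 1 :> C by rewrite expr0.
have e2 : I ^+ true.*2 = -1 :> C by [].
have e3 : I ^+ (false.*2 + 3) = - I :> C by rewrite exprS I2 mulrN1.
have e5 : I ^+ (true.*2 + 3) = I :> C.
  by rewrite (_ : (_ + _)%N = (2 * 2).+1)%N // exprS exprM I2 sqrrN expr1n mulr1.
have {}H a b c d (X : 'M[C]_8) : (forall (n p : 'I_8), X n p =
    a * (A n p + B n p - I * D n p - I * E n p)
     + b * (A n p - B n p - I * D n p + I * E n p)
     + c * (A n p + B n p + I * D n p + I * E n p)
     + d * (A n p - B n p + I * D n p - I * E n p)) -> Q X.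
  have := H a b c d; rewrite ![_ (+) _]/= e0 e2 e3 e5.
  move: {+}I => i' {}H XE; refine (eq_rect _ Q H X _).
  apply/matrixP => n p.
  rewrite XE.
  rewrite !mxE.
  ring.
move: e0 e2 e3 e5 I2 => _ _ _ _ _.
have Q4V X : Q (4 *: X) -> Q X.
  move=> QX; have := Qc 4^-1 0 _ _ QX QX.
  by rewrite scale0r addr0 scalerA mulVf ?pnatr_eq0 // scale1r.
move: H (mulII R); move: {+}I => i' H ii; split; apply: Q4V.
- by apply: (H 1 1 1 1) => n p; rewrite mxE; ring.
- by apply: (H 1 (- 1) 1 (- 1)) => n p; rewrite mxE; ring.
- by apply: (H i' i' (- i') (- i')) => n p; rewrite mxE; ring: ii.
- by apply: (H i' (- i') (- i') i') => n p; rewrite mxE; ring: ii.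
Qed.

Lemma W_sq_w0 (u v : unit8) : exists k, W (sq R u) (sq R v) = I ^+ k *: w0 R u.2 v.2.
Proof.
have := @W_sq R 0 u v; rewrite expr0 scale1r /tval /term8 => ->.
by exists (0 + (u.1 (+) v.1).*2)%N.
Qed.

Lemma U11_span (Q : 'M[C]_8 -> Prop) :
  (forall a b V W, Q V -> Q W -> Q (a *: V + b *: W)) ->
  (forall l, Q (U11 l)) -> forall u v, Q (W (sq R u) (sq R v)).
Proof.
move=> Qc QU u v.
pose x := u.2.1 (+) v.2.1; pose w := v.2.2.
pose f : unit8 := (false, (x, w)); pose g := mul8 f j8.
have [||QA QB QD QE] := @frame_span Q (W (sq R e8) (sq R f)) (W (sq R j8) (sq R g))
   (W (sq R i8) (sq R f)) (W (sq R k8) (sq R g)).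
- exact: Qc.
- move=> s y; have := QU (s, (y, w), x); rewrite /frame_vec /frame !big_cons big_nil.
  rewrite addr0 expr0 scale1r; move: (W _ _) (W _ _) (W _ _) (W _ _) => A B D E.
  by rewrite !addrA.
have QZ c V : Q V -> Q (c *: V).
  by move=> QV; have := Qc c 0 _ _ QV QV; rewrite scale0r addr0.
have Q_sq u' v' : Q (W (sq R u') (sq R v')) <-> Q (w0 R u'.2 v'.2).
  have [k ->] := W_sq_w0 u' v'.
  split=> [/(QZ (I ^+ k)^-1)|]; last exact: QZ.
  by rewrite scalerA mulVf ?scale1r // expf_neq0 // (unitc_neq0 (@unitcI R)).
apply/Q_sq; move/Q_sq: QA; move/Q_sq: QB; move/Q_sq: QD; move/Q_sq: QE.
clear Q_sq QZ QU Qc.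
rewrite {}/g {}/f {}/x {}/w; move: (w0 R) => w.
by case: u v => [t [[] []]] [t' [[] []]].
Qed.

Lemma block_delta m' n' (a : 'I_m') (b : 'I_n') :
  block_mx 0 (delta_mx a b) (- (delta_mx a b)^T) 0 =
  delta_mx (lshift n' a) (rshift m' b) - delta_mx (rshift m' b) (lshift n' a)
  :> 'M[R]_(m' + n').
Proof.
rewrite trmx_delta; apply/matrixP => c d.
case: (split_ordP c) => c' -> {c}; case: (split_ordP d) => d' -> {d}.
- by rewrite block_mxEul !mxE !eq_lrshift andbF subr0.
- by rewrite block_mxEur !mxE eq_lshift eq_rshift eq_lrshift subr0.
- by rewrite block_mxEdl !mxE eq_lshift eq_rshift eq_rlshift sub0r.
- by rewrite block_mxEdr !mxE !eq_rlshift andbF subr0.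
Qed.

Lemma rot_W (a b : bool * bool) :
  W (sq R (false, a)) (sq R (false, b)) =
  cplx (val (rot R (lshift 4 (unit_index a)) (rshift 4 (unit_index b)))).
Proof.
rewrite /W !qvec_unit trmx_delta mul_delta_mx.
exact: (congr1 (fun X : 'M[R]_8 => cplx X) (@block_delta 4 4 _ _)).
Qed.

Lemma unit_index_onto (a : 'I_4) : exists u, a = unit_index u.
Proof.
exists (2 <= a, odd a)%N; apply/val_inj; case: a => [[|[|[|[|]]]]] //= ?;
  by rewrite inordK.
Qed.

(** The core eigenvectors span the off-diagonal part, whose brackets give the
    diagonal blocks. *)
Lemma U11_gen (x : G) : (forall l, xact x (U11 l) = U11 l) -> x = 1%g.
Proof.
move=> fx; have fW : forall u v, xact x (W (sq R u) (sq R v)) = W (sq R u) (sq R v).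
  apply: (U11_span (Q := fun V => xact x V = V)) => // a b V W fV fW.
  by rewrite xact_comb fV fW.
apply: (@lie_aut_rot1 _ (fun n => if @fintype.split 4 4 n is inl _ then true else false)).
- by exists (@lshift 4 4 ord0); rewrite (unsplitK (inl _)).
- by exists (@rshift 4 4 ord0); rewrite (unsplitK (inr _)).
move=> n p; case: (@splitP 4 4 n) => // a Ea; case: (@splitP 4 4 p) => // b Eb _ _.
have [u ua] := unit_index_onto a; have [v vb] := unit_index_onto b.
have -> : n = lshift 4 (unit_index u) by apply/val_inj; rewrite /= Ea ua.
have -> : p = rshift 4 (unit_index v) by apply/val_inj; rewrite /= Eb vb.
have := fW (false, u) (false, v); rewrite rot_W xact_so => E.
apply/val_inj/matrixP => c d.
by move/matrixP/(_ c d): E; rewrite !mxE => /complexI.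
Qed.

End F11torus.

(** * The group F_11: weights on the diagonal blocks *)

Section F11weights.
Variable R : realType.
Local Notation C := R[i].
Local Notation G := (lie_aut (@so_bracket R 8)).
Local Notation I := ('i%C : C).
Local Notation cplx X := (map_mx (real_complex R) X).
Local Notation L := (bool * (bool * bool) * bool)%type.
Local Notation unit8 := (bool * (bool * bool))%type.
Local Notation e8 := (false, (false, false)).
Local Notation i8 := (false, (false, true)).
Local Notation j8 := (false, (true, false)).
Local Notation k8 := (false, (true, true)).
Local Notation U11 := (@frame_vec R).
Local Notation e := (1%g : Sp1 R).
Local Notation m := (Sp1_neg R).
Local Notation i := (Sp1_i R).

(** The characters of F_11 evaluated at the labels, with z in the circle and
    three bits b. *)
Definition kap (z : C) (b : bool * bool * bool) (l : L) : C :=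
  (if l.1.1 then z^-1 else z) *
  (-1) ^+ ((b.1.1 && l.2) (+) (b.1.2 && l.1.2.1) (+) (b.2 && l.1.2.2)).

(** The four commuting copies of sp(1): for n = (block, side) the left (side
    false) or right (side true) factor of so(4) in that block. *)
Definition factor (n : bool * bool) (p : quat R) : 'M[R]_(4 + 4) :=
  let B := if n.2 then lr_mx (Quat 1 0 0 0) p else lr_mx p (Quat 1 0 0 0) in
  if n.1 then block_mx 0 0 0 B else block_mx B 0 0 0.

(** The order of the last two copies is exchanged, as in the covering by
    Sp(1)^4: c is the right factor and d the left factor of the second block. *)
Definition fcomp (n : bool * bool) (x : Sp1_4 R) : quat R :=
  let: (a, b, c, d) := x in
  val (if n.1 then if n.2 then c else d else if n.2 then b else a).

Definition T n u : 'M[C]_8 := cplx (factor n (sq R u)).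

Definition imag (o : option bool) : bool * bool :=
  match o with None => (false, true) | Some w => (true, w) end.

Lemma lr_mx_tr (p q : quat R) : (lr_mx p q)^T = lr_mx (qconj p) (qconj q).
Proof.
apply/matrixP => a b; rewrite !mxE; case: p q => [p0 p1 p2 p3] [r0 r1 r2 r3].
by case: a => [[|[|[|[|]]]]] //= ?; case: b => [[|[|[|[|]]]]] //= ?; ring.
Qed.

Lemma diag_conj (P Q A D : 'M[R]_4) :
  block_mx P 0 0 Q *m block_mx A 0 0 D *m (block_mx P 0 0 Q)^T =
  block_mx (P *m A *m P^T) 0 0 (Q *m D *m Q^T).
Proof.
rewrite tr_block_mx !trmx0 !mulmx_block.
by rewrite !(mulmx0, mul0mx, addr0, add0r).
Qed.

Lemma lr_conj (a b p q : quat R) : lr_mx a b *m lr_mx p q *m (lr_mx a b)^T =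
  lr_mx (qmul (qmul a p) (qconj a)) (qmul (qmul b q) (qconj b)).
Proof. by rewrite lr_mx_tr !lr_mxM. Qed.

Lemma factor_act n (x : Sp1_4 R) p :
  (cplx (factor n p))^T = - (cplx (factor n p) : 'M_8) ->
  xact (spin4 x) (cplx (factor n p)) =
  cplx (factor n (qmul (qmul (fcomp n x) p) (qconj (fcomp n x)))).
Proof.
case: x => [[[a b] c] d] sp.
rewrite /spin4 xactAd // map_trmx -!map_mxM; congr (map_mx _ _).
have N (s : Sp1 R) : qmul (qmul (val s) (Quat 1 0 0 0)) (qconj (val s)) = Quat 1 0 0 0.
  by rewrite q1mul qmulC Sp1_norm.
case: n sp => [[] []] _; rewrite /factor /fcomp /=;
  (etransitivity; first exact: diag_conj); rewrite mulmx0 mul0mx.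
- by rewrite lr_conj N.
- by rewrite lr_conj N.
- by rewrite lr_conj N.
- by rewrite lr_conj N.
Qed.

Lemma factor_skew n (a b c : R) : (factor n (Quat 0 a b c))^T = - factor n (Quat 0 a b c).
Proof.
have E1 : (lr_mx (Quat 0 a b c) (Quat 1 0 0 0))^T = - lr_mx (Quat 0 a b c) (Quat 1 0 0 0).
  rewrite lr_mx_tr; apply/matrixP => p q; rewrite !mxE.
  by case: p => [[|[|[|[|]]]]] //= ?; ring.
have E2 : (lr_mx (Quat 1 0 0 0) (Quat 0 a b c))^T = - lr_mx (Quat 1 0 0 0) (Quat 0 a b c).
  rewrite lr_mx_tr; apply/matrixP => p q; rewrite !mxE.
  by case: p => [[|[|[|[|]]]]] //= ?; ring.
by case: n => [[] []]; rewrite /factor /= tr_block_mx opp_block_mx !trmx0 !oppr0 ?E1 ?E2.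
Qed.

Lemma factor_comb n c d p q r : qvec r = c *: qvec p + d *: qvec q ->
  factor n r = c *: factor n p + d *: factor n q.
Proof.
case: p q r => [p0 p1 p2 p3] [q0 q1 q2 q3] [r0 r1 r2 r3] E.
have : Quat r0 r1 r2 r3 = Quat (c * p0 + d * q0) (c * p1 + d * q1) (c * p2 + d * q2) (c * p3 + d * q3).
  apply: qvec_inj; rewrite E; apply/colP => a; rewrite !mxE.
  by case: a => [[|[|[|[|]]]]].
move=> [-> -> -> ->].
have E1 : lr_mx (Quat (c * p0 + d * q0) (c * p1 + d * q1) (c * p2 + d * q2) (c * p3 + d * q3)) (Quat 1 0 0 0) =
   c *: lr_mx (Quat p0 p1 p2 p3) (Quat 1 0 0 0) + d *: lr_mx (Quat q0 q1 q2 q3) (Quat 1 0 0 0).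
  apply/matrixP => a b; rewrite !mxE; by case: a => [[|[|[|[|]]]]] //= ?; ring.
have E2 : lr_mx (Quat 1 0 0 0) (Quat (c * p0 + d * q0) (c * p1 + d * q1) (c * p2 + d * q2) (c * p3 + d * q3)) =
   c *: lr_mx (Quat 1 0 0 0) (Quat p0 p1 p2 p3) + d *: lr_mx (Quat 1 0 0 0) (Quat q0 q1 q2 q3).
  apply/matrixP => a b; rewrite !mxE; by case: a => [[|[|[|[|]]]]] //= ?; ring.
by case: n => [[] []]; rewrite /factor /= !scale_block_mx add_block_mx !scaler0 !addr0 ?E1 ?E2.
Qed.

Lemma T_skew n u : u.2 != (false, false) -> (T n u)^T = - T n u.
Proof.
case: u => s [x w] /= u0; have [a [b [c E]]] : exists a b c, sq R (s, (x, w)) = Quat 0 a b c.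
  by case: x w u0 => [] [] // _; do 3 eexists; reflexivity.
rewrite /T E map_trmx; etransitivity; first exact: (congr1 (fun X : 'M[R]_8 => cplx X) (factor_skew n a b c)).
by apply/matrixP => p q; rewrite !mxE rmorphN.
Qed.

Lemma T_sign n s u : T n (s, u) = (-1) ^+ s *: T n (false, u).
Proof.
have E : factor n (sq R (s, u)) =
    (-1) ^+ s *: factor n (sq R (false, u)) + 0 *: factor n (sq R (false, u)).
  apply: factor_comb; apply/colP => a; rewrite !mxE; case: u => [[] []];
  by case: a => [[|[|[|[|]]]]] //= _; rewrite ?expr0; ring.
rewrite /T E scale0r addr0; apply/matrixP => a b; rewrite !mxE rmorphM.
by rewrite rmorphXn rmorphN rmorph1.
Qed.

(** Conjugation by a quaternion unit changes another one at most by a sign. *)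
Lemma T_act n (x : Sp1_4 R) a u : fcomp n x = sq R a -> u.2 != (false, false) ->
  xact (spin4 x) (T n u) = (-1) ^+ (u.1 (+) (mul8 (mul8 a u) (conj8 a)).1) *: T n u.
Proof.
move=> Ea u0; have := @factor_act n x (sq R u) (T_skew n u0).
rewrite Ea sq_conj !sqM /T => ->.
case: u u0 => s u /= u0; have := T_sign n s u; rewrite /T => ->.
rewrite scalerA -signr_addb addbAC addbb addFb.
have {1}-> : mul8 (mul8 a (s, u)) (conj8 a) = ((mul8 (mul8 a (s, u)) (conj8 a)).1, u).
  by case: a u {Ea u0} => [t [[] []]] [[] []].
by have := T_sign n (mul8 (mul8 a (s, u)) (conj8 a)).1 u; rewrite /T => ->.
Qed.

(** The root vectors of the first copy of sp(1) with respect to its torus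
    U(1), of weights z^2 (-1)^b1 and z^-2 (-1)^b1. *)
Definition J s : 'M[C]_8 := T (false, false) j8 - ((-1) ^+ s * I) *: T (false, false) k8.

Local Notation X := (L + (bool + (bool * bool) * option bool))%type.

(** The vectors j, k of the first copy are replaced by i, since they are not
    eigenvectors; they are taken into account by J. *)
Definition rlab (r : (bool * bool) * option bool) : bool * bool :=
  imag (if r.1 == (false, false) then None else r.2).

(** A spanning family of eigenvectors of F_11: the core ones, the two root
    vectors, and imaginary units in the four copies of sp(1), on which F_11
    acts by signs. *)
Definition Vt (t : X) : 'M[C]_8 :=
  match t with
  | inl l => U11 l
  | inr (inl s) => J s
  | inr (inr r) => T r.1 (false, rlab r)
  end.

(** The eigenvalues on the spanning family; those of the last kind are only
    recorded as signs. *)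
Definition good (z : C) b (eps : (bool * bool) * option bool -> bool) (t : X) : C :=
  match t with
  | inl l => kap z b l
  | inr (inl s) => (if s then z^-1 else z) ^+ 2 * (-1) ^+ b.1.1
  | inr (inr r) => (-1) ^+ eps r
  end.

Lemma rlab_imag r : rlab r != (false, false).
Proof. by rewrite /rlab; case: (if _ then _ else _) => [[]|]. Qed.

Lemma Vt_skew t : (Vt t)^T = - Vt t.
Proof.
case: t => [l|[s|r]]; rewrite /Vt.
- by rewrite U11_skew.
- by rewrite /J linearB linearZ /= !T_skew // scalerN opprB addrC opprK.
by rewrite T_skew // rlab_imag.
Qed.

(** The common form of the elements of F_11. *)
Definition tor11 (x : autso8 R) : Prop := exists M z b eps,
  [/\ unitc z, x = Ad M & forall t, xact x (Vt t) = good z b eps t *: Vt t].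

Lemma good_neq0 z b eps t : unitc z -> good z b eps t != 0.
Proof.
move=> /unitc_neq0 z0; case: t => [[[s u] x]|[s|r]] /=; rewrite ?signr_eq0 // mulf_neq0 ?signr_eq0 //.
  by case: s; rewrite ?invr_eq0.
by rewrite expf_neq0 //; case: s; rewrite ?invr_eq0.
Qed.

Lemma goodM z b eps z' b' eps' t :
  good z b eps t * (good z' b' eps' t)^-1 =
  good (z * z'^-1) (b.1.1 (+) b'.1.1, b.1.2 (+) b'.1.2, b.2 (+) b'.2)
    (fun r => eps r (+) eps' r) t.
Proof.
case: t => [[[s [y w]] x]|[s|r]] /=; rewrite ?invr_sign ?signr_addb //.
- rewrite /kap /= invfM invr_sign mulrACA -signr_addb; congr (_ * (-1) ^+ _).
    by case: s; rewrite ?invfM.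
  by case: b b' => [[[] []] []] [[[] []] []]; case: x; case: y; case: w.
rewrite invfM invr_sign mulrACA -?signr_addb -exprVn -exprMn; congr (_ ^+ 2 * _).
by case: s; rewrite ?invfM.
Qed.

Lemma tor11_div x y : tor11 x -> tor11 y -> tor11 (x * y^-1)%g.
Proof.
move=> [M [z [b [eps [uz -> Vx]]]]] [N [z' [b' [eps' [uz' -> Vy]]]]].
exists (M * N^-1)%g, (z * z'^-1).
exists (b.1.1 (+) b'.1.1, b.1.2 (+) b'.1.2, b.2 (+) b'.2), (fun r => eps r (+) eps' r).
split; [exact: unitcM uz (unitcV uz')| |].
  rewrite Ad_morphism; congr (_ * _)%g; apply: (mulIg (Ad N)).
  by rewrite mulVg -Ad_morphism mulVg; apply: lie_aut_ext => Y; apply/val_inj;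
     rewrite /= trmx1 mulmx1 mul1mx.
move=> t; rewrite xactM -goodM.
have g0 := good_neq0 b' eps' t uz'.
have -> : xact (Ad N)^-1%g (Vt t) = (good z' b' eps' t)^-1 *: Vt t.
  rewrite -{2}(xactK (Ad N) (Vt_skew t)) Vy linearZ /= scalerA mulVf ?scale1r //.
by rewrite linearZ /= Vx scalerA mulrC.
Qed.

Lemma xact_sub (x : G) k V W : xact x (V - k *: W) = xact x V - k *: xact x W.
Proof. by rewrite -scaleNr xactD xactZ scaleNr. Qed.

(** The generators of F_11 and of Z that have quaternion units as components. *)
Lemma unit_tor11 (a b c d : Sp1 R) (a' b' c' d' : unit8) z (b0 : bool * bool * bool) : unitc z ->
  val a = sq R a' -> val b = sq R b' -> val c = sq R c' -> val d = sq R d' ->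
  a'.2 = (false, false) ->
  (forall s : bool, (if s then z^-1 else z) ^+ 2 * (-1) ^+ b0.1.1 = 1) ->
  (forall l, xact (spin4 (a, b, c, d)) (U11 l) = kap z b0 l *: U11 l) ->
  tor11 (spin4 (a, b, c, d)).
Proof.
move=> uz Ea Eb Ec Ed a0 z2 U.
pose a8 (n : bool * bool) := if n.1 then if n.2 then c' else d' else if n.2 then b' else a'.
pose ep (r : (bool * bool) * option bool) :=
  (mul8 (mul8 (a8 r.1) (false, rlab r)) (conj8 (a8 r.1))).1.
have Ef n : fcomp n (a, b, c, d) = sq R (a8 n) by case: n => [[] []].
exists (oblock (lr a b) (lr d c) : orthG R 8), z, b0, ep; split=> // t.
case: t => [l|[s|r]]; [exact: U| |]; rewrite /Vt /good.
  have fixT u : u != (false, false) ->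
      xact (spin4 (a, b, c, d)) (T (false, false) (false, u)) = T (false, false) (false, u).
    move=> u0; rewrite (@T_act (false, false) (a, b, c, d) _ (false, u) (Ef (false, false)) u0) (_ : _ (+) _ = false) ?expr0 ?scale1r //.
    by move: a0; rewrite /a8 /=; case: (a') u {u0} => [[] [x w]] [y v] /= [-> ->]; case: y; case: v.
  rewrite z2 scale1r /J xact_sub; by rewrite (fixT (true, false) isT) (fixT (true, true) isT).
by rewrite (T_act (Ef _)) ?rlab_imag.
Qed.

Lemma T_rotate (a : Sp1 R) (c d : R) (v w : bool * bool) (r s : R) :
  v != (false, false) -> val a = Quat c d 0 0 ->
  qmul (qmul (Quat c d 0 0) (sq R (false, v))) (Quat c (- d) 0 0) =
    Quat 0 (if v.1 then 0 else r) (if v.1 then if v.2 then s else r else 0)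
           (if v.1 then if v.2 then r else s else 0) ->
  w = (true, ~~ v.2) ->
  (~~ v.1 -> s = 0) ->
  xact (spin4 (a, e, e, e)) (T (false, false) (false, v)) =
  r%:C%C *: T (false, false) (false, v) + s%:C%C *: T (false, false) (false, w).
Proof.
move=> v0 Ea E -> s0; etransitivity.
  exact: (factor_act (a, e, e, e) (@T_skew (false, false) (false, v) v0)).
have E' : qvec (qmul (qmul (val a) (sq R (false, v))) (qconj (val a))) =
    r *: qvec (sq R (false, v)) + s *: qvec (sq R (false, (true, ~~ v.2))).
  have Ec : qconj (val a) = Quat c (- d) 0 0 by rewrite Ea /= oppr0.
  rewrite Ec Ea E; move: v0 s0 {E}; case: v => [[] []] // _ s0; rewrite ?(s0 isT) {s0};
  apply/colP => n; rewrite !mxE /=;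
  by case: n => [[|[|[|[|]]]]] //= _; rewrite ?expr0; ring.
rewrite (factor_comb (false, false) E').
by rewrite map_mxD !map_mxZ.
Qed.

(** The circle U(1) acts on j and k by the rotation of twice the angle. *)
Lemma Uone_tor11 (a : Sp1 R) : U1 a -> tor11 (spin4 (a, e, e, e)).
Proof.
move=> Ua; have [c [d Ea]] : exists c d, val a = Quat c d 0 0.
  by move: Ua; rewrite /U1 /=; case: (val a) => a0 a1 a2 a3 /= [-> ->]; exists a0, a1.
have cd : c ^+ 2 + d ^+ 2 = 1 by rewrite -(Sp1_norm a) Ea /=; ring.
have uz : unitc (Complex c d) := cd.
have zV (s : bool) : Complex c ((-1) ^+ s * d) = if s then (Complex c d)^-1 else Complex c d :> C.
  case: s; rewrite ?expr0 ?expr1 ?mul1r //.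
  by rewrite /GRing.inv /= cd !divr1 mulN1r.
have Ek : xact (spin4 (a, e, e, e)) (T (false, false) k8) =
    (c ^+ 2 - d ^+ 2)%:C%C *: T (false, false) k8 + (- (2 * c * d))%:C%C *: T (false, false) j8.
  refine (@T_rotate a c d (true, true) _ (c ^+ 2 - d ^+ 2) (- (2 * c * d)) isT Ea _ (erefl _) _); last by [].
  by rewrite /= expr0; congr Quat; ring.
have Ej : xact (spin4 (a, e, e, e)) (T (false, false) j8) =
    (c ^+ 2 - d ^+ 2)%:C%C *: T (false, false) j8 + (2 * c * d)%:C%C *: T (false, false) k8.
  refine (@T_rotate a c d (true, false) _ (c ^+ 2 - d ^+ 2) (2 * c * d) isT Ea _ (erefl _) _); last by [].
  by rewrite /= expr0; congr Quat; ring.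
have Ei : xact (spin4 (a, e, e, e)) (T (false, false) i8) = T (false, false) i8.
  rewrite (@T_rotate _ c d (false, true) _ 1 0 isT Ea _ (erefl _) (fun _ => erefl _)).
    by rewrite scale0r addr0 scale1r.
  rewrite /= expr0; congr Quat; try by ring.
  by rewrite -[RHS]cd; ring.
exists (oblock (lr a e) (lr e e) : orthG R 8), (Complex c d), (false, false, false), (fun=> false).
split; [exact: uz|by []|].
case=> [[[s u] y]|[s|[n o]]]; rewrite /Vt /good.
- rewrite (U11_Uone s u y Ua) Ea [q_re _]/= [q_i _]/= zV /kap.
  by rewrite [_.1.1]/= ![_.1.1]/= ![_.1.2]/= ![_.2]/= expr0 mulr1.
- have nB : (- (2 * c * d))%:C%C = - (2 * c * d)%:C%C :> C := rmorphN _ _.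
  rewrite /J xact_sub Ej Ek nB expr0 mulr1 -zV.
  have E2 : Complex c ((-1) ^+ s * d) ^+ 2 =
    (c ^+ 2 - d ^+ 2)%:C%C + ((-1) ^+ s * I) * (2 * c * d)%:C%C :> C.
    by rewrite expr2; apply/eqP; case: s; rewrite ?expr0 ?expr1 eq_complex /=;
      apply/andP; split; apply/eqP; ring.
  have ss : ((-1) ^+ s * I) * ((-1) ^+ s * I) = -1 :> C.
    by rewrite mulrACA -signr_addb addbb mul1r mulII.
  rewrite E2; move: (T _ _) (T _ _) ss => V V'.
  move: ((-1) ^+ s * I) (c ^+ 2 - d ^+ 2)%:C%C (2 * c * d)%:C%C => g A B ss.
  by apply/matrixP => p q; rewrite !mxE; ring: ss.
rewrite expr0 scale1r; have [->|n0] := eqVneq n (false, false); last first.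
  have Ef : fcomp n (a, e, e, e) = sq R e8 by case: n n0 => [[] []].
  rewrite (@T_act n (a, e, e, e) e8 (false, rlab (n, o)) Ef (rlab_imag _)).
  have -> : mul8 (mul8 e8 (false, rlab (n, o))) (conj8 e8) = (false, rlab (n, o)).
    by case: (rlab _) => [[] []].
  by rewrite addbb expr0 scale1r.
by rewrite /rlab eqxx Ei.
Qed.

End F11weights.

Section F11card.
Variable R : realType.
Local Notation C := R[i].
Local Notation I := ('i%C : C).
Local Notation i8 := (false, (false, true)).
Local Notation j8 := (false, (true, false)).
Local Notation e := (1%g : Sp1 R).
Local Notation m := (Sp1_neg R).
Local Notation i := (Sp1_i R).
Local Notation j := (Sp1_j R).

Lemma spin4_1 : spin4 1%g = 1%g :> autso8 R.
Proof. by apply: (mulgI (spin4 (1%g : Sp1_4 R))); rewrite -spin4_morphism !mulg1. Qed.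

Lemma spin4_V (y : Sp1_4 R) : spin4 y^-1%g = (spin4 y)^-1%g :> autso8 R.
Proof.
by apply: (mulIg (spin4 y)); rewrite -spin4_morphism !mulVg spin4_1.
Qed.

Lemma tor11_subgroup : is_subgroup [set y : Sp1_4 R | tor11 (spin4 y)].
Proof.
have t1 : tor11 (1%g : autso8 R).
  have := Uone_tor11 (@U1e R); rewrite (_ : (e, e, e, e) = 1%g :> Sp1_4 R) //.
  by rewrite spin4_1.
split=> [|x y tx ty]; rewrite /mkset; first by rewrite spin4_1.
by rewrite spin4_morphism spin4_V; exact: tor11_div.
Qed.

Lemma mI : unitc (- I : C).
Proof. by rewrite /unitc /=; ring. Qed.

Lemma kapI l : kap (- I) (true, false, false) l = I ^+ ((l.1.1 (+) l.2).*2 + 3).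
Proof.
have I2 : I ^+ 2 = -1 :> C := sqr_i _.
have I3 : I ^+ 3 = - I :> C by rewrite exprS I2 mulrN1.
have I5 : I ^+ 5 = I :> C by rewrite -[5%N]/(2 + 3)%N exprD I2 I3 mulN1r opprK.
have VI : (- I)^-1 = I :> C.
  apply: (mulfI (unitc_neq0 mI)); rewrite mulfV ?(unitc_neq0 mI) // mulNr mulII.
  by rewrite opprK.
rewrite /kap; case: l => [[s u] x] /=; case: s; case: x => /=;
  rewrite ?VI ?I3 ?I5 !(expr0, expr1) ?mulr1 ?mulrN1 ?opprK //.
Qed.

Lemma F11_tor11 g : F11 R g -> tor11 g.
Proof.
move=> [y gy <-]; move: y gy; apply: gen_min; first exact: tor11_subgroup.
have me : val m = sq R (true, (false, false)) by [].
have ee : val e = sq R (false, (false, false)) by [].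
have ie : val i = sq R i8 by [].
have je : val j = sq R j8 by [].
have u1 := unitc1 R.
have V1 (s : bool) : (if s then 1^-1 else 1 : C) = 1 by case: s; rewrite ?invr1.
have I2 (b : bool) : I ^+ b.*2 = (-1) ^+ b :> C by case: b; rewrite ?expr0 //= sqr_i expr1.
move=> y [[[a Ua <-]|[[->|->]|->]]|]; first exact: Uone_tor11.
- apply: (unit_tor11 (b0 := (true, false, false)) mI ee ie ie ie) => //= [s|[[s u] z]].
    have VI : (- I)^-1 = I :> C.
      apply: (mulfI (unitc_neq0 mI)); rewrite mulfV ?(unitc_neq0 mI) // mulNr mulII.
      by rewrite opprK.
    by case: s; rewrite ?VI ?sqrrN sqr_i expr1 mulrNN mulr1.
  by rewrite U11_iii kapI.
- apply: (unit_tor11 (b0 := (false, true, false)) u1 ee je je ee) => //= [s|[[s u] z]].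
    by rewrite V1 expr1n mulr1.
  by rewrite U11_jj1 I2 /kap /= V1 mul1r addbF.
- apply: (unit_tor11 (b0 := (false, false, true)) u1 ee ee je je) => //= [s|[[s u] z]].
    by rewrite V1 expr1n mulr1.
  by rewrite U11_1jj I2 /kap /= V1 mul1r.
move: y; apply: gen_min; first exact: tor11_subgroup.
have kap0 l : kap 1 (false, false, false) l = I ^+ 0 :> C by rewrite /kap V1 /= expr0 mulr1.
move=> y [[->|->]|->].
- apply: (unit_tor11 (b0 := (false, false, false)) u1 me me ee ee) => //= [s|l].
    by rewrite V1 expr1n mulr1.
  rewrite kap0; apply: (U11_spin me me ee ee).
  by case: l => [[s [y' w]] z]; case: s; case: z; case: y'; case: w.
- apply: (unit_tor11 (b0 := (false, false, false)) u1 me ee me ee) => //= [s|l].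
    by rewrite V1 expr1n mulr1.
  rewrite kap0; apply: (U11_spin me ee me ee).
  by case: l => [[s [y' w]] z]; case: s; case: z; case: y'; case: w.
- apply: (unit_tor11 (b0 := (false, false, false)) u1 me ee ee me) => //= [s|l].
    by rewrite V1 expr1n mulr1.
  rewrite kap0; apply: (U11_spin me ee ee me).
  by case: l => [[s [y' w]] z]; case: s; case: z; case: y'; case: w.
Qed.

End F11card.

(** * The group F_11: classification of weights *)

Section F11separation.
Variable R : realType.
Local Notation C := R[i].
Local Notation I := ('i%C : C).
Local Notation cplx X := (map_mx (real_complex R) X).
Local Notation L := (bool * (bool * bool) * bool)%type.
Local Notation U11 := (@frame_vec R).
Local Notation e := (1%g : Sp1 R).
Local Notation m := (Sp1_neg R).
Local Notation i := (Sp1_i R).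
Local Notation j := (Sp1_j R).

Local Notation X := (L + (bool + (bool * bool) * option bool))%type.
Lemma kapM z b z' b' l : kap z b l * kap z' b' l =
  kap (z * z') (b.1.1 (+) b'.1.1, b.1.2 (+) b'.1.2, b.2 (+) b'.2) l :> C.
Proof.
rewrite /kap /= mulrACA -signr_addb; congr (_ * (-1) ^+ _).
  by case: (l.1.1); rewrite ?invfM.
by case: b b' => [[[] []] []] [[[] []] []]; case: (l.2); case: (l.1.2.1); case: (l.1.2.2).
Qed.

(** The generator (1, i, i, i) has eigenvalues -+I (-1)^x, so that z has to be
    corrected by a factor I. *)
Lemma F11_real z b : unitc z -> exists2 x, F11 R x & eigen U11 x (kap z b).
Proof.
move=> uz; case: b => [[b1 b2] b3].
(* (1, i, i, i) contributes - I to z, which is compensated here. *)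
have [w wE] : exists w : C, w = z * (if b1 then I else 1) by eexists.
have uw : unitc w by rewrite wE; case: (b1); apply: unitcM => //; [exact: unitcI|exact: unitc1].
have ua : unit_quat (Quat (complex.Re w) (complex.Im w) 0 0).
  by apply/eqP; rewrite -[RHS]uw /=; ring.
pose a : Sp1 R := Sub _ ua.
have Ua : U1 a by [].
pose y : Sp1_4 R := ((a, e, e, e) * (opt b1 ((e, i, i, i) : Sp1_4 R) *
  (opt b2 ((e, j, j, e) : Sp1_4 R) * opt b3 ((e, e, j, j) : Sp1_4 R))))%g.
exists (spin4 y).
  exists y => //; apply: genM; last apply: genM; last apply: genM.
  - by apply: sub_gen; left; left; exists a.
  - by apply: gen_opt; apply: sub_gen; left; right; left; left.
  - by apply: gen_opt; apply: sub_gen; left; right; left; right.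
  - by apply: gen_opt; apply: sub_gen; left; right; right.
have u1 := unitc1 R.
have V1 (s : bool) : (if s then 1^-1 else 1 : C) = 1 by case: s; rewrite ?invr1.
have I2 (b : bool) : I ^+ b.*2 = (-1) ^+ b :> C by case: b; rewrite ?expr0 //= sqr_i expr1.
have K1 l : kap 1 (false, false, false) l = 1 :> C by rewrite /kap V1 /= expr0 mulr1.
have e1 V : V^T = - V -> xact (spin4 (1%g : Sp1_4 R)) V = V.
  by move=> sV; rewrite spin4_1 xact1.
move=> l; have sU := U11_skew R l.
have Ea : xact (spin4 (a, e, e, e)) (U11 l) = kap w (false, false, false) l *: U11 l.
  case: l {sU} => [[s u] x]; rewrite (U11_Uone s u x Ua) [q_re _]/= [q_i _]/= /kap /= expr0 mulr1.
  congr (_ *: _); move: uw; clear; case: w => p q; rewrite /unitc /= => pq.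
  by case: s; rewrite ?expr0 ?expr1 ?mul1r // /GRing.inv /= pq !divr1 mulN1r.
have Ei : xact (spin4 (opt b1 ((e, i, i, i) : Sp1_4 R))) (U11 l) =
    kap (if b1 then - I else 1) (b1, false, false) l *: U11 l.
  rewrite /opt; case: (b1); last by rewrite e1 // K1 scale1r.
  by rewrite kapI; case: l {sU Ea} => [[s u] x]; rewrite U11_iii.
have Ej : xact (spin4 (opt b2 ((e, j, j, e) : Sp1_4 R))) (U11 l) =
    kap 1 (false, b2, false) l *: U11 l.
  rewrite /opt; case: (b2); last by rewrite e1 // K1 scale1r.
  by case: l {sU Ea Ei} => [[s u] x]; rewrite U11_jj1 I2 /kap /= V1 mul1r addbF.
have Ek : xact (spin4 (opt b3 ((e, e, j, j) : Sp1_4 R))) (U11 l) =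
    kap 1 (false, false, b3) l *: U11 l.
  rewrite /opt; case: (b3); last by rewrite e1 // K1 scale1r.
  by case: l {sU Ea Ei Ej} => [[s u] x]; rewrite U11_1jj I2 /kap /= V1 mul1r.
rewrite /y !spin4_morphism !xactM Ek !xactZ Ej !xactZ Ei !xactZ Ea.
rewrite !scalerA !kapM; congr (kap _ _ l *: _).
  rewrite wE !mul1r; case: (b1); last by rewrite !mul1r mulr1.
  by rewrite mulrCA [- I * I]mulNr mulII opprK mulr1.
by rewrite /= !addbF.
Qed.

Definition rot4 (a b : 'I_4) : 'M[R]_4 := delta_mx a b - delta_mx b a.

(** The elementary rotations of the space of quaternions are half sums and
    half differences of left and right multiplications by units. *)
Lemma rot4_span (Q : 'M[R]_4 -> Prop) :
  (forall a b S S', Q S -> Q S' -> Q (a *: S + b *: S')) ->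
  (forall o, Q (lr_mx (sq R (false, imag o)) (Quat 1 0 0 0))) ->
  (forall o, Q (lr_mx (Quat 1 0 0 0) (sq R (false, imag o)))) ->
  forall a b, Q (rot4 a b).
Proof.
move=> Qc Ql Qr.
have E o (a b c d : 'I_4) (g : R) :
    lr_mx (Quat 1 0 0 0) (sq R (false, imag o)) = rot4 a b - g *: rot4 c d ->
    lr_mx (sq R (false, imag o)) (Quat 1 0 0 0) = - rot4 a b - g *: rot4 c d ->
    g * g = 1 -> Q (rot4 a b) /\ Q (rot4 c d).
  move=> Er El gg; have H x y := Qc x y _ _ (Qr o) (Ql o).
  move: H; rewrite El Er; move: (rot4 a b) (rot4 c d) => A B H; split.
    have := H 2^-1 (- 2^-1); congr (Q _); apply/matrixP => p q; rewrite !mxE.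
    transitivity ((2^-1 * 2) * A p q); first by ring.
    by rewrite mulVf ?pnatr_eq0 // mul1r.
  have := H (- (g / 2)) (- (g / 2)); congr (Q _); apply/matrixP => p q; rewrite !mxE.
  transitivity ((g * g) * (2^-1 * 2) * B p q); first by ring.
  by rewrite gg mul1r mulVf ?pnatr_eq0 // mul1r.
have [Q01 Q23] : Q (rot4 (inord 0) (inord 1)) /\ Q (rot4 (inord 2) (inord 3)).
  apply: (E None _ _ _ _ 1); last by rewrite mulr1.
    apply/matrixP => p q; rewrite /= expr0 !mxE -!val_eqE /= !inordK //.
    by case: p => [[|[|[|[|]]]]] //= ?; case: q => [[|[|[|[|]]]]] //= ?; ring.
  apply/matrixP => p q; rewrite /= expr0 !mxE -!val_eqE /= !inordK //.
  by case: p => [[|[|[|[|]]]]] //= ?; case: q => [[|[|[|[|]]]]] //= ?; ring.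
have [Q02 Q13] : Q (rot4 (inord 0) (inord 2)) /\ Q (rot4 (inord 1) (inord 3)).
  apply: (E (Some false) _ _ _ _ (-1)); last by rewrite mulrNN mulr1.
    apply/matrixP => p q; rewrite /= expr0 !mxE -!val_eqE /= !inordK //.
    by case: p => [[|[|[|[|]]]]] //= ?; case: q => [[|[|[|[|]]]]] //= ?; ring.
  apply/matrixP => p q; rewrite /= expr0 !mxE -!val_eqE /= !inordK //.
  by case: p => [[|[|[|[|]]]]] //= ?; case: q => [[|[|[|[|]]]]] //= ?; ring.
have [Q03 Q12] : Q (rot4 (inord 0) (inord 3)) /\ Q (rot4 (inord 1) (inord 2)).
  apply: (E (Some true) _ _ _ _ 1); last by rewrite mulr1.
    apply/matrixP => p q; rewrite /= expr0 !mxE -!val_eqE /= !inordK //.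
    by case: p => [[|[|[|[|]]]]] //= ?; case: q => [[|[|[|[|]]]]] //= ?; ring.
  apply/matrixP => p q; rewrite /= expr0 !mxE -!val_eqE /= !inordK //.
  by case: p => [[|[|[|[|]]]]] //= ?; case: q => [[|[|[|[|]]]]] //= ?; ring.
have Q0 : Q 0 by have := Qc 0 0 _ _ Q01 Q01; rewrite !scale0r addr0.
have QN S : Q S -> Q (- S).
  by move=> QS; have := Qc (-1) 0 _ _ QS QS; rewrite scale0r addr0 scaleN1r.
have rN a b : rot4 b a = - rot4 a b by rewrite /rot4 opprB.
have r0 a : rot4 a a = 0 by rewrite /rot4 subrr.
move=> a b; rewrite -(inord_val a) -(inord_val b).
case: a => [[|[|[|[|]]]]] //= ?; case: b => [[|[|[|[|]]]]] //= ?;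
  by rewrite ?r0 //; rewrite rN; apply: QN.
Qed.

Lemma block_ul_delta m' n' (a b : 'I_m') : block_mx (delta_mx a b) 0 0 0 =
  delta_mx (lshift n' a) (lshift n' b) :> 'M[R]_(m' + n').
Proof.
apply/matrixP => c d.
case: (split_ordP c) => c' -> {c}; case: (split_ordP d) => d' -> {d}.
- by rewrite block_mxEul !mxE !eq_lshift.
- by rewrite block_mxEur !mxE eq_rlshift andbF.
- by rewrite block_mxEdl !mxE eq_rlshift.
- by rewrite block_mxEdr !mxE eq_rlshift.
Qed.

Lemma block_dr_delta m' n' (a b : 'I_n') : block_mx 0 0 0 (delta_mx a b) =
  delta_mx (rshift m' a) (rshift m' b) :> 'M[R]_(m' + n').
Proof.
apply/matrixP => c d.
case: (split_ordP c) => c' -> {c}; case: (split_ordP d) => d' -> {d}.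
- by rewrite block_mxEul !mxE eq_lrshift.
- by rewrite block_mxEur !mxE eq_lrshift.
- by rewrite block_mxEdl !mxE eq_lrshift andbF.
- by rewrite block_mxEdr !mxE !eq_rshift.
Qed.

(** The family spans the skew matrices, on which the trace form is
    nondegenerate. *)
Lemma Vt_total V : V^T = - V -> (forall t, \tr (V *m (Vt R t)^T) = 0) -> V = 0.
Proof.
move=> sV V0; pose Q (Y : 'M[C]_8) := \tr (V *m Y^T) = 0.
have Qc a b Y Y' : Q Y -> Q Y' -> Q (a *: Y + b *: Y').
  rewrite /Q linearD !linearZ /= mulmxDr mxtraceD -!scalemxAr !mxtraceZ => -> ->.
  by rewrite !mulr0 addr0.
have QZ c Y : Q Y -> Q (c *: Y).
  by move=> QY; have := Qc c 0 _ _ QY QY; rewrite scale0r addr0.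
have QT n o : Q (T R n (false, imag o)).
  have [n0|n0] := eqVneq n (false, false); last first.
    by have := V0 (inr (inr (n, o))); rewrite /Vt /rlab (negPf n0).
  rewrite n0; case: o => [w|]; last first.
    by have := V0 (inr (inr (n, None))); rewrite /Vt /rlab n0.
  have J0 : Q (J R false) := V0 (inr (inl false)).
  have J1 : Q (J R true) := V0 (inr (inl true)).
  case: w.
    have := Qc (2^-1 * I) (- (2^-1 * I)) _ _ J0 J1.
    rewrite /J expr0 expr1; move: (T _ _ _) (T _ _ _) (mulII R); move: I => i' A B ii.
    congr (Q _); apply/matrixP => a b; rewrite !mxE.
    transitivity (- (i' * i') * (2^-1 * 2) * A a b); first by ring.
    by rewrite ii opprK mul1r mulVf ?pnatr_eq0 // mul1r.
  have := Qc 2^-1 2^-1 _ _ J0 J1.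
  rewrite /J expr0 expr1; move: (T _ _ _) (T _ _ _); move: I => i' A B.
  congr (Q _); apply/matrixP => a b; rewrite !mxE.
  transitivity ((2^-1 * 2) * B a b); first by ring.
  by rewrite mulVf ?pnatr_eq0 // mul1r.
have QW u v : Q (W (sq R u) (sq R v)).
  by move: u v; apply: U11_span => // l; exact: (V0 (inl l)).
have trV a b : \tr (V *m (delta_mx a b)^T) = V a b.
  rewrite trmx_delta -(mul_delta_mx (ord0 : 'I_1)) mulmxA mxtrace_mulC mulmxA.
  by rewrite -rowE -colE trace_mx11 !mxE.
suff Qr a b : Q (cplx (val (rot R a b))).
  apply/matrixP => a b; have := Qr a b; rewrite /Q /= /rot_mx map_mxB !map_delta_mx.
  rewrite linearB /= mulmxBr linearB /= !trV => /eqP.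
  have -> : V b a = - V a b by move/matrixP/(_ a b): sV; rewrite !mxE.
  by rewrite opprK -mulr2n -mulr_natl mulf_eq0 pnatr_eq0 mxE => /eqP.
have Qoff (c d : 'I_4) : Q (cplx (val (rot R (lshift 4 c) (rshift 4 d)))).
  have [u ->] := unit_index_onto c; have [v ->] := unit_index_onto d.
  by rewrite -rot_W.
pose blk (n : bool) (B : 'M[R]_4) : 'M[R]_(4 + 4) :=
  if n then block_mx 0 0 0 B else block_mx B 0 0 0.
have Qdiag n (c d : 'I_4) : Q (cplx (blk n (rot4 c d))).
  apply: (rot4_span (Q := fun B => Q (cplx (blk n B)))) => [x y S S' QS QS'|o|o].
  - have -> : blk n (x *: S + y *: S') = x *: blk n S + y *: blk n S'.
      by rewrite /blk; case: n {QS QS'}; rewrite !scale_block_mx add_block_mx !scaler0 !addr0.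
    by rewrite map_mxD !map_mxZ; exact: Qc.
  - exact: (QT (n, false) o).
  - exact: (QT (n, true) o).
have Eul (c d : 'I_4) : blk false (rot4 c d) = rot_mx R (lshift 4 c) (lshift 4 d).
  rewrite /rot_mx -!(@block_ul_delta 4 4) /blk /rot4 (@opp_block_mx _ 4 4 4 4) (@add_block_mx _ 4 4 4 4).
  by rewrite !oppr0 !addr0.
have Edr (c d : 'I_4) : blk true (rot4 c d) = rot_mx R (rshift 4 c) (rshift 4 d).
  rewrite /rot_mx -!(@block_dr_delta 4 4) /blk /rot4 (@opp_block_mx _ 4 4 4 4) (@add_block_mx _ 4 4 4 4).
  by rewrite !oppr0 !addr0.
case: (@split_ordP 4 4 a) => c ->; case: (@split_ordP 4 4 b) => d ->.
- by have := Qdiag false c d; rewrite Eul.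
- exact: Qoff.
- have -> : rot R (rshift 4 c) (lshift 4 d) = - rot R (lshift 4 d) (rshift 4 c) by exact: rotN.
  have -> : cplx (val (- rot R (lshift 4 d) (rshift 4 c))) =
    -1 *: cplx (val (rot R (lshift 4 d) (rshift 4 c))).
    by rewrite scaleN1r; apply/matrixP => p q; rewrite !mxE rmorphN.
  exact: QZ (Qoff d c).
by have := Qdiag true c d; rewrite Edr.
Qed.

(** A nonzero skew matrix pairs nontrivially with a member of the spanning
    family. *)
Lemma weight11 lam : weight (F11 R) lam -> exists t : X, forall x, F11 R x ->
  exists z b eps, [/\ unitc z, eigen U11 x (kap z b) & lam x = (good z b eps t)^-1].
Proof.
move=> [V [sV V0 EV]].
have [t t0] : exists t, \tr (V *m (Vt R t)^T) != 0.
  apply: contrapT => H; case/eqP: V0; apply: Vt_total => // t.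
  by apply: contrapT => /eqP t0; apply: H; exists t.
exists t => x Fx; have EVx := EV x Fx; have [M [z [b [eps [uz xM Vx]]]]] := F11_tor11 Fx.
exists z, b, eps; split=> [//|l|]; first exact: (Vx (inl l)).
have g0 := good_neq0 b eps t uz; apply: (mulIf g0); rewrite mulVf //.
have EVt := Vx t; subst x.
exact: (weight_dual sV (Vt_skew R t) EVx EVt t0).
Qed.

Lemma kapV z b s u x : (kap z b (s, u, x))^-1 = kap z b (~~ s, u, x) :> C.
Proof. by rewrite /kap invfM invr_sign /=; case: s; rewrite ?invrK. Qed.

Lemma weight11_cases lam : weight (F11 R) lam ->
  [\/ exists l, forall x, F11 R x -> lam x = ev U11 x l,
      exists s, forall x, F11 R x -> exists z b, [/\ unitc z, eigen U11 x (kap z b) &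
         lam x = (if s then z^-1 else z) ^+ 2 * (-1) ^+ b.1.1]
    | forall x, F11 R x -> lam x ^+ 2 = 1].
Proof.
move=> /weight11[[l|[s|r]] H].
- apply: Or31; case: l H => [[s u] x] H; exists (~~ s, u, x) => g /H[z [b [eps [uz Eg ->]]]].
  by rewrite (evP (@U11_neq0 R) Eg) -kapV.
- apply: Or32; exists (~~ s) => g /H[z [b [eps [uz Eg ->]]]]; exists z, b; split=> //.
  by rewrite /good invfM invr_sign -exprVn; case: s {H}; rewrite ?invrK.
apply: Or33 => g /H[z [b [eps [uz Eg ->]]]].
by rewrite /good invr_sign sqrr_sign.
Qed.

End F11separation.

Section F11weyl.
Variable R : realType.
Local Notation C := R[i].
Local Notation G := (lie_aut (@so_bracket R 8)).
Local Notation I := ('i%C : C).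
Local Notation L := (bool * (bool * bool) * bool)%type.
Local Notation j8 := (false, (true, false)).
Local Notation k8 := (false, (true, true)).
Local Notation U11 := (@frame_vec R).
Local Notation i := (Sp1_i R).

Local Notation X := (L + (bool + (bool * bool) * option bool))%type.
Local Notation ev := (@ev R L U11).

Definition K11 : set (L -> C) := [set k | exists z b, unitc z /\ k = kap z b].

Lemma F11P x : F11 R x <-> exists2 k, K11 k & eigen U11 x k.
Proof.
split=> [Fx|[k [z [b [uz ->]]] Ek]].
  have [M [z [b [eps [uz _ Vx]]]]] := F11_tor11 Fx.
  by exists (kap z b) => [|l]; [exists z, b|exact: (Vx (inl l))].
have [y Fy Ey] := F11_real b uz.
by rewrite (eigen_inj (@U11_skew R) (@U11_gen R) Ek Ey).
Qed.

Lemma F11_real' k : K11 k -> exists x, eigen U11 x k.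
Proof. by move=> [z [b [uz ->]]]; have [x _ Ex] := F11_real b uz; exists x. Qed.

Lemma evE x z b : eigen U11 x (kap z b) -> forall l, ev x l = kap z b l.
Proof. by move=> E l; rewrite (evP (@U11_neq0 R) E). Qed.

Lemma ev_test z b : unitc z -> exists2 x, F11 R x & forall l, ev x l = kap z b l.
Proof. by move=> /(F11_real b)[x Fx /evE E]; exists x. Qed.

Lemma ev_kap x : F11 R x -> exists z b, unitc z /\ forall l, ev x l = kap z b l.
Proof. by move=> /F11P[k [z [b [uz ->]]] /evE E]; exists z, b. Qed.

Lemma kap_pair z b s u : kap z b (s, u, false) * kap z b (s, u, true) =
  (if s then z^-1 else z) ^+ 2 * (-1) ^+ b.1.1 :> C.
Proof.
rewrite /kap /= mulrACA -expr2 -signr_addb; congr (_ * (-1) ^+ _).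
by case: b => [[[] []] []]; case: u => [[] []].
Qed.

Lemma I_sqr (s : bool) : (if s then I^-1 else I) ^+ 2 = -1 :> C.
Proof. by case: s; rewrite ?exprVn sqr_i // invrN1. Qed.

Lemma m1_neq1 : (-1 == 1 :> C) = false.
Proof. by rewrite -subr_eq0 -opprD oppr_eq0 -mulr2n pnatr_eq0. Qed.

(** Separates z^2 from z^-2, even after squaring. *)
Lemma om4 : om R ^+ 4 != (om R)^-1 ^+ 4.
Proof.
rewrite omV /om -[4%N]/(2 * 2)%N !exprM !expr2 eq_complex /= negb_and; apply/orP; right.
rewrite -subr_eq0; set y := (X in X != 0).
have -> : y = - (672 / 625) by rewrite /y; field.
by rewrite oppr_eq0 mulf_neq0 ?invr_eq0 ?pnatr_eq0.
Qed.

Lemma om4_neq1 (s : bool) : (if s then (om R)^-1 else om R) ^+ 4 != 1.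
Proof.
have := om4; apply: contra_neq; case: s => H; last by rewrite exprVn H invr1.
by rewrite H -[LHS]invrK -exprVn H invr1.
Qed.

Lemma J_neq0 s : J R s != 0.
Proof.
have [a a2] : exists a : 'I_4, a = 2%N :> nat by exists (inord 2); rewrite inordK.
have [b b0] : exists b : 'I_4, b = 0%N :> nat by exists (inord 0); rewrite inordK.
have Tab u : T R (false, false) u (lshift 4 a) (lshift 4 b) =
    (lr_mx (sq R u) (Quat 1 0 0 0) a b)%:C%C.
  by rewrite mxE; congr (_%:C%C); exact: block_mxEul.
apply/eqP => /matrixP/(_ (lshift 4 a) (lshift 4 b)).
rewrite /J; move: (T R _ j8) (T R _ k8) (Tab j8) (Tab k8) => A B EA EB.
rewrite !mxE EA EB !mxE a2 /= b0 /= expr0.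
rewrite !(mulr0, mul0r, mulr1, mul1r, addr0, subr0, add0r, sub0r, oppr0).
by move/eqP; rewrite oner_eq0.
Qed.

Lemma pair_weight s u : weight (F11 R) (fun x => ev x (s, u, false) * ev x (s, u, true)).
Proof.
exists (J R s); split; [exact: (Vt_skew R (inr (inl s)))|exact: J_neq0|].
move=> x Fx; have [M [z [b [eps [uz _ Vx]]]]] := F11_tor11 Fx.
have E : eigen U11 x (kap z b) by move=> l; exact: (Vx (inl l)).
by rewrite !(evE E) kap_pair; exact: (Vx (inr (inl s))).
Qed.

Lemma ev_weight l : weight (F11 R) (fun x => ev x l).
Proof.
exists (U11 l); split; [exact: U11_skew|exact: U11_neq0|move=> x Fx].
have [M [z [b [eps [uz _ Vx]]]]] := F11_tor11 Fx.
have E : eigen U11 x (kap z b) by move=> m'; exact: (Vx (inl m')).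
by rewrite (evE E); exact: E.
Qed.

Lemma weight_cases lam : weight (F11 R) lam ->
  [\/ exists l, forall x, F11 R x -> lam x = ev x l,
      exists s, forall x, F11 R x -> forall u, lam x = ev x (s, u, false) * ev x (s, u, true)
    | forall x, F11 R x -> lam x ^+ 2 = 1].
Proof.
move=> /weight11_cases[?|[s H]|?]; [exact: Or31| |exact: Or33].
apply: Or32; exists s => x /H[z [b [uz /evE E ->]]] u.
by rewrite !E kap_pair.
Qed.

(** The weights z^(+-2) (-1)^b1 are determined by their squares, hence are not
    core; the remaining ones off the core have trivial square.  Flipping x
    gives another core weight with the same square. *)
Lemma core11 (lam : G -> C) :
  core (F11 R) lam <-> exists l, forall x, F11 R x -> lam x = ev x l.
Proof.
have uI := @unitcI R; have uom := @unitc_om R; have u1 := unitc1 R.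
have V1 (s : bool) : (if s then 1^-1 else 1 : C) = 1 by case: s; rewrite ?invr1.
split=> [[/weight_cases[//|[s lE]|l1]]|[[[s u] x] lE]].
- move=> _ [mu [/weight_cases mw [y Fy ne] sq]].
  have u0 : bool * bool := (false, false).
  case: mw => [[l mE]|[s' mE]|m1].
  (* At z = I the square of mu is -1 and that of lam is 1. *)
  + have [x Fx E] := ev_test (false, false, false) uI.
    have := sq x Fx; rewrite (mE x Fx) (lE x Fx u0) !E kap_pair I_sqr.
    rewrite expr0 mulr1 sqrrN expr1n /kap /= expr0 mulr1 I_sqr.
    by move/eqP; rewrite m1_neq1.
  + have [ss|ns] := eqVneq s' s.
      by move/eqP: ne; rewrite (mE y Fy u0) (lE y Fy u0) ss.
    (* Two weights z^2 and z^-2 have different squares at z = om. *)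
    have [x Fx E] := ev_test (false, false, false) uom.
    have := sq x Fx; rewrite (mE x Fx u0) (lE x Fx u0) !E !kap_pair expr0 !mulr1.
    rewrite -!exprM => /eqP; have := om4.
    by case: s s' ns {lE mE} => [] [] //= _ /negPf; [|rewrite eq_sym] => ->.
  + have [x Fx E] := ev_test (false, false, false) uom.
    have := sq x Fx; rewrite (m1 x Fx) (lE x Fx u0) !E !kap_pair expr0 !mulr1.
    by rewrite -exprM => /esym/eqP; rewrite (negPf (om4_neq1 s)).
- by move=> [x Fx]; rewrite (l1 x Fx) eqxx.
split.
- by apply: weight_eq (ev_weight (s, u, x)) => y /lE.
- have [y Fy E] := ev_test (false, false, false) uI; exists y => //.
  by rewrite (lE y Fy) E /kap /= expr0 mulr1 I_sqr m1_neq1.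
exists (fun y => ev y (s, u, ~~ x)); split; first exact: ev_weight.
  have [y Fy E] := ev_test (true, false, false) u1; exists y => //.
  rewrite (lE y Fy) !E /kap /= !V1 !mul1r; case: x {lE}; rewrite /= ?expr0 ?expr1.
    by rewrite eq_sym m1_neq1.
  by rewrite m1_neq1.
move=> y Fy; rewrite (lE y Fy); have [z [b [_ E]]] := ev_kap Fy.
by rewrite !E /kap !exprMn !sqrr_sign.
Qed.

End F11weyl.

(** * The group F_11: the permutations of labels *)

Section F11labels.
Variable R : realType.
Local Notation C := R[i].
Local Notation I := ('i%C : C).
Local Notation L := (bool * (bool * bool) * bool)%type.
Local Notation U11 := (@frame_vec R).
Local Notation i := (Sp1_i R).

Local Notation ev := (@ev R L U11).

Local Notation K11 := (@K11 R).
Local Notation sflip l := (~~ l.1.1, l.1.2, l.2).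

Lemma K_kap z b : unitc z -> K11 (kap z b). Proof. by move=> uz; exists z, b. Qed.

Lemma kap_sep l l' : (forall k, K11 k -> k l = k l') -> l = l'.
Proof.
have uI := @unitcI R; have u1 := unitc1 R.
have V1 (s : bool) : (if s then 1^-1 else 1 : C) = 1 by case: s; rewrite ?invr1.
have IV : I != I^-1.
  apply/eqP => E; have := mulII R; rewrite {2}E mulfV ?(unitc_neq0 uI) //.
  by move/eqP; rewrite eq_sym m1_neq1.
have sg (a b : bool) : (-1) ^+ a = (-1) ^+ b :> C -> a = b.
  by move/eqP; case: a; case: b; rewrite // ?expr0 ?expr1 1?[1 == _]eq_sym m1_neq1.
case: l l' => [[s [y w]] x] [[s' [y' w']] x'] E.
have := E _ (K_kap (false, false, false) uI); rewrite /kap /= expr0 !mulr1 => Es.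
have := E _ (K_kap (true, false, false) u1); rewrite /kap /= !V1 !mul1r => /sg Ex.
have := E _ (K_kap (false, true, false) u1); rewrite /kap /= !V1 !mul1r => /sg Ey.
have := E _ (K_kap (false, false, true) u1); rewrite /kap /= !V1 !mul1r => /sg Ew.
move: Ex Ey Ew; rewrite /= !addbF => -> -> ->; congr (_, _, _).
by case: s s' Es {E} => [] [] // /esym/eqP; rewrite ?(negPf IV) // eq_sym (negPf IV).
Qed.

(** A function of four points with even sum is affine over the field with two
    elements; its constant term is absorbed in z. *)
Lemma K_even (z : C) (b : bool) (h : bool * bool -> bool) : unitc z ->
  h (false, false) (+) h (false, true) (+) h (true, false) (+) h (true, true) = false ->
  K11 (fun l => (if l.1.1 then z^-1 else z) * (-1) ^+ ((b && l.2) (+) h l.1.2)).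
Proof.
move=> uz h0; have us : unitc ((-1) ^+ h (false, false) : C).
  by case: (h _); rewrite /unitc /=; ring.
exists (z * (-1) ^+ h (false, false)),
  (b, h (true, false) (+) h (false, false), h (false, true) (+) h (false, false)).
split; first exact: unitcM.
apply/funext => -[[s [y w]] x]; rewrite /kap /=.
have -> : (if s then (z * (-1) ^+ h (false, false))^-1 else z * (-1) ^+ h (false, false)) =
   (if s then z^-1 else z) * (-1) ^+ h (false, false) :> C.
  by case: s; rewrite ?invfM ?invr_sign.
rewrite -mulrA -signr_addb; congr (_ * (-1) ^+ _).
move: h0; case: b; case: x; case: y; case: w => /=;
by case: (h (false, false)); case: (h (false, true)); case: (h (true, false)); case: (h (true, true)).
Qed.

Lemma perm_even (p : {perm bool * bool}) (f : bool * bool -> bool) :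
  f (p (false, false)) (+) f (p (false, true)) (+) f (p (true, false)) (+) f (p (true, true)) =
  f (false, false) (+) f (false, true) (+) f (true, false) (+) f (true, true).
Proof.
have big4 (g : bool * bool -> bool) : \big[addb/false]_u g u =
    g (false, false) (+) g (false, true) (+) g (true, false) (+) g (true, true).
  rewrite (eq_bigr (fun u => g (u.1, u.2))); last by case.
  rewrite -(pair_bigA _ (fun y w => g (y, w))) /= !big_bool /=.
  by do 4 case: (g _).
by rewrite -(big4 f) (reindex_inj (@perm_inj _ p)) (big4 (fun u => f (p u))).
Qed.

(** All permutations of the four points preserve the functions with even sum,
    and so the affine functions; this is why the whole of S_4 acts. *)
Lemma K_act t k : K11 k -> K11 (k \o act11 t).
Proof.
move=> [z [b [uz ->]]]; case: t => [[e' p] [[al be] ga]].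
pose r (u : bool * bool) := b.1.1 && (al (+) (be && u.1) (+) (ga && u.2)).
pose q (u : bool * bool) := (b.1.2 && u.1) (+) (b.2 && u.2).
pose h u := r u (+) q (p u).
have -> : kap z b \o act11 (e', p, (al, be, ga)) =
    fun l => (if l.1.1 then (if e' then z^-1 else z)^-1 else if e' then z^-1 else z) *
       (-1) ^+ ((b.1.1 && l.2) (+) h l.1.2).
  apply/funext => -[[s u] x]; rewrite /kap /act11 /h /r /q /=; congr (_ * (-1) ^+ _).
    by case: s; case: e'; rewrite ?invrK.
  by case: (b.1.1); rewrite /= ?addbA ?addFb.
apply: K_even; first by case: (e') => //; exact: unitcV.
have q0 : q (false, false) (+) q (false, true) (+) q (true, false) (+) q (true, true) = false.
  by rewrite /q /= !andbF !andbT; case: (b.1.2); case: (b.2).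
have r0 : r (false, false) (+) r (false, true) (+) r (true, false) (+) r (true, true) = false.
  by rewrite /r /= !andbF !andbT; case: (b.1.1); case: (al); case: (be); case: (ga).
have := perm_even p q; rewrite {}q0 /h; move: r0.
move: (r _) (r _) (r _) (r _) (q _) (q _) (q _) (q _).
by do 8 case.
Qed.

Lemma act11_inj t : injective (act11 t).
Proof.
case: t => [[e' p] [[al be] ga]] [[s u] x] [[s' u'] x'] [].
by move=> /addIb -> /perm_inj -> /addIb/addIb/addIb ->.
Qed.

(** Some power of the permutation of labels is the identity, so that the
    inverse permutation preserves K as well. *)
Lemma K_actE t k : K11 (k \o act11 t) <-> K11 k.
Proof.
split=> [Kk|]; last exact: K_act.
pose s := perm (@act11_inj t).
have E n : (k \o act11 t) \o iter n (act11 t) = k \o (s ^+ n.+1)%g.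
  apply/funext => l /=; congr (k _); elim: n => [|n IH]; first by rewrite expg1 permE.
  by rewrite expgSr permM -IH permE.
have Kn n : K11 ((k \o act11 t) \o iter n (act11 t)).
  elim: n => [|n IH]; first by [].
  have -> : (k \o act11 t) \o iter n.+1 (act11 t) = ((k \o act11 t) \o iter n (act11 t)) \o act11 t.
    by apply/funext => l; rewrite /= -iterSr.
  exact: K_act.
(* The power of s whose exponent is its order is the identity. *)
have := Kn (#[s]%g).-1; rewrite E prednK ?order_gt0 // expg_order.
by rewrite (_ : k \o _ = k) //; apply/funext => l; rewrite /= perm1.
Qed.

Lemma act11_faithful t t' :
  (forall k, K11 k -> k \o act11 t =1 k \o act11 t') -> t = t'.
Proof.
move=> H; have {}H l : act11 t l = act11 t' l.
  by apply: kap_sep => k Kk; exact: (H k Kk l).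
case: t t' H => [[e1 p] [[al be] ga]] [[e2 p'] [[al' be'] ga']] H.
have [E1 _] := H (false, (false, false), false); rewrite !andbF !addbF => Ea.
have [_ _] := H (false, (true, false), false); rewrite !andbF !andbT !addbF => Eb.
have [_ _] := H (false, (false, true), false); rewrite !andbF !andbT ?addbF => Ec.
have Ep : p = p' by apply/permP => u; have [_ ->] := H (false, u, false).
subst e2 al' p'; congr (_, _, (_, _, _)); [exact: addbI Eb|exact: addbI Ec].
Qed.

Section Labels.
Variable phi : L -> L.
Hypothesis Kphi : forall k, K11 k -> K11 (k \o phi).
Hypothesis phiK : forall k, K11 k -> exists2 k', K11 k' & k = k' \o phi.
Hypothesis phi_weight : forall l l', weight (F11 R) (fun x => ev x l * ev x l') ->
  weight (F11 R) (fun x => ev x (phi l) * ev x (phi l')).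

Lemma phi_inj : injective phi.
Proof.
move=> l l' E; apply: kap_sep => k /phiK[k' _ ->].
by rewrite /= E.
Qed.

Lemma K_sflip k l : K11 k -> k (sflip l) = (k l)^-1.
Proof. by move=> [z [b [_ ->]]]; case: l => [[s u] x]; rewrite kapV. Qed.

Lemma phi_sflip l : phi (sflip l) = sflip (phi l).
Proof.
apply: kap_sep => k Kk; have /= := K_sflip l (Kphi Kk).
by rewrite (K_sflip (phi l) Kk).
Qed.

(** Squaring kills the signs and keeps the exponent of z. *)
Lemma phi_sign (u v : bool * bool) (x y : bool) :
  (phi (false, u, x)).1.1 = (phi (false, v, y)).1.1.
Proof.
have [z [b [uz E]]] := Kphi (K_kap (false, false, false) (@unitc_om R)).
have sq l : kap (om R) (false, false, false) (phi l) ^+ 2 = (if l.1.1 then z^-1 else z) ^+ 2.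
  have -> : kap (om R) (false, false, false) (phi l) = kap z b l by rewrite -E.
  by rewrite /kap exprMn sqrr_sign mulr1.
have := sq (false, u, x); rewrite -(sq (false, v, y)) /kap !exprMn !sqrr_sign !mulr1.
by move/eqP; rewrite om_sqr => /eqP.
Qed.

(** The product of two core weights of the same sign s contains z^(+-2), so
    that as a weight it must be z^(+-2) (-1)^b1. *)
Lemma pair_label s v v' x x' :
  weight (F11 R) (fun g => ev g (s, v, x) * ev g (s, v', x')) -> v = v' /\ x' = ~~ x.
Proof.
have uI := @unitcI R; have u1 := unitc1 R; have uom := @unitc_om R.
have V1 (t : bool) : (if t then 1^-1 else 1 : C) = 1 by case: t; rewrite ?invr1.
have sg (a c : bool) : (-1) ^+ a = (-1) ^+ c :> C -> a = c.
  by move/eqP; case: a; case: c; rewrite // ?expr0 ?expr1 1?[1 == _]eq_sym m1_neq1.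
have u0 : bool * bool := (false, false).
move=> /weight_cases[[l E]|[t E]|E].
(* A core weight takes the values I, - I at z = I, the product - 1. *)
- have [g Fg Eg] := ev_test (false, false, false) uI.
  have := congr1 (fun c => c ^+ 2) (E g Fg); rewrite !Eg /kap /= !expr0 !mulr1 -expr2 !I_sqr.
  by rewrite sqrrN expr1n => /eqP; rewrite eq_sym m1_neq1.
- have H (b0 : bool * bool * bool) : (b0.1.1 && x) (+) (b0.1.2 && v.1) (+) (b0.2 && v.2) (+)
     ((b0.1.1 && x') (+) (b0.1.2 && v'.1) (+) (b0.2 && v'.2)) = b0.1.1.
    have [g Fg Eg] := ev_test b0 u1.
    have := E g Fg u0; rewrite !Eg kap_pair /kap /= !V1 expr1n !mul1r -signr_addb.
    exact: sg.
  have := (H (true, false, false), H (false, true, false), H (false, false, true)).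
  move=> /= [[]]; rewrite !addbF; case: v v' {H E} => [y w] [y' w'] /=.
  by case: x; case: x'; case: y; case: y'; case: w; case: w'.
have [g Fg Eg] := ev_test (false, false, false) uom.
have := E g Fg; rewrite !Eg /kap /= !expr0 !mulr1 -expr2 -exprM => /eqP.
by rewrite (negPf (om4_neq1 R s)).
Qed.

Lemma phi_pair u : (phi (false, u, true)).1.2 = (phi (false, u, false)).1.2 /\
  (phi (false, u, true)).2 = ~~ (phi (false, u, false)).2.
Proof.
have := phi_weight (pair_weight R false u).
have := phi_sign u u false true.
case: (phi _) => [[s v] x]; case: (phi _) => [[s' v'] x'] /= <- /pair_label[-> ->].
by [].
Qed.

(** The permutation phi commutes with the sign flip and with the flip of x, so
    it is determined by a permutation of the pairs (y, w) and by a function f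
    of (y, w) giving the change of x.  The eigenvalues k at fixed s and x
    satisfy k(0,0) k(1,1) = k(0,1) k(1,0), so that f has even sum; hence f is
    affine. *)
Lemma label11 : exists t, phi =1 act11 t.
Proof.
pose p0 (u : bool * bool) := (phi (false, u, false)).1.2.
pose f u := (phi (false, u, false)).2.
pose s0 := (phi (false, (false, false), false)).1.1.
have phiE s u x : phi (s, u, x) = (s (+) s0, p0 u, x (+) f u).
  have H0 y : phi (false, u, y) = (s0, p0 u, y (+) f u).
    have S l : l = (l.1.1, l.1.2, l.2) :> L by case: l => [[]].
    rewrite (S (phi (false, u, y))) (phi_sign u (false, false) y false).
    by have [E1 E2] := phi_pair u; congr (_, _, _); case: y; rewrite ?E1 ?E2.
  case: s; last by rewrite H0.
  by have := phi_sflip (false, u, x); rewrite /= H0.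
have p0_inj : injective p0.
  move=> u v E; have E' : phi (false, u, false) = phi (false, v, f u (+) f v).
    by rewrite !phiE E -addbA addbb addbF.
  by have [] := phi_inj E'.
have f0 : f (false, false) (+) f (true, true) = f (true, false) (+) f (false, true).
  have [z [b [uz E]]] := Kphi (K_kap (true, false, false) (unitc1 R)).
  have Ef u : (-1) ^+ f u = kap z b (false, u, false) :> C.
    have V1 (s : bool) : (if s then 1^-1 else 1 : C) = 1 by case: s; rewrite ?invr1.
    by rewrite -E /= /kap phiE /= V1 mul1r !addbF.
  have sg (a c : bool) : (-1) ^+ a = (-1) ^+ c :> C -> a = c.
    by move/eqP; case: a; case: c; rewrite // ?expr0 ?expr1 1?[1 == _]eq_sym m1_neq1.
  apply: sg; rewrite !signr_addb !Ef /kap /= !andbF !andbT !addbF !addFb.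
  rewrite mulrACA [RHS]mulrACA -!signr_addb ?addbF; congr (_ * (-1) ^+ _).
exists (s0, perm p0_inj, (f (false, false), f (true, false) (+) f (false, false),
   f (false, true) (+) f (false, false))).
move=> [[s u] x]; rewrite phiE /act11 permE; congr (_, _, _).
move: f0; case: u => [[] []] /=; rewrite ?andbF ?andbT ?addbF.
all: by move: (f _) (f _) (f _) (f _); case: x; do 4 case.
Qed.

End Labels.

Lemma F11_card : [set: weyl (F11 R)] #= `I_(3 * 2 ^ 7)%N.
Proof.
have := card_weyl (T := (bool * {perm bool * bool} * (bool * bool * bool))%type) (@U11_skew R) (@U11_neq0 R) (@U11_gen R) (@F11P R)
  (@F11_real' R) act11_inj K_actE act11_faithful (@realised_act R) (@core11 R) label11.
have cperm : #|{: {perm bool * bool}}| = factorial #|{: bool * bool}|.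
  rewrite -[#|{: bool * bool}|]cardsT -card_perm; apply/esym/eq_card => s; rewrite [RHS]inE.
  by apply/fintype.subsetP => d _; rewrite inE.
by rewrite !card_prod cperm card_prod !card_bool.
Qed.

End F11labels.

Theorem proposition4p6 (R : realType) :
  [/\ [set: weyl (F10 R)] #= `I_(3 * 2 ^ 6)%N,
      [set: weyl (F11 R)] #= `I_(3 * 2 ^ 7)%N
    & isomorphic (weyl (F12 R)) ('S_6 * pm1)%type].
Proof. split; [exact: F10_card|exact: F11_card|exact: F12_iso]. Qed.
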